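(* Let $\lambda\in\mathfrak h^*$, i.e. let $\lambda:\mathfrak h\to R$ be an $R$-linear map. There is a one-to-one correspondence between the $\widehat{U(\mathfrak g)_K}$-submodules of the affinoid Verma module $\widehat{M(\lambda)}$ and the $U(\mathfrak g_K)$-submodules of the classical Verma module $M(\lambda)$. In particular, $\widehat{M(\lambda)}$ has a unique simple quotient $\widehat{L(\lambda)}$.
   Context: $R$ is a complete discrete valuation ring of mixed characteristic $(0,p)$ with uniformiser $\pi$ and field of fractions $K$. $G$ is a connected, simply connected, split semisimple, smooth affine algebraic group scheme over $\operatorname{Spec} R$ with Lie algebra $\mathfrak g$, with a fixed decomposition $\mathfrak g=\mathfrak n^-\oplus\mathfrak h\oplus\mathfrak n^+$ coming from a split maximal torus and a pair of opposite Borel subgroups; $\mathfrak b^+=\mathfrak h\oplus\mathfrak n^+$. A subscript $K$ denotes $-\otimes_R K$. For an $R$-Lie algebra $\mathfrak a$ which is free of finite rank, $\widehat{U(\mathfrak a)}=\varprojlim_i U(\mathfrak a)/\pi^iU(\mathfrak a)$ and $\widehat{U(\mathfrak a)_K}=\widehat{U(\mathfrak a)}\otimes_R K$; $\widehat{U(\mathfrak g)_K}$ is the affinoid enveloping algebra. Given an $R$-linear $\lambda:\mathfrak h\to R$, extend it to $\mathfrak b^+$ by zero on $\mathfrak n^+$; let $K_\lambda$ be the resulting one-dimensional module over $\widehat{U(\mathfrak b^+)_K}$ (and over $U(\mathfrak b^+_K)$). The affinoid Verma module is $\widehat{M(\lambda)}=\widehat{U(\mathfrak g)_K}\otimes_{\widehat{U(\mathfrak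 b^+)_K}}K_\lambda$ and the classical Verma module is $M(\lambda)=U(\mathfrak g_K)\otimes_{U(\mathfrak b^+_K)}K_\lambda$. *)

(* Defs.v *)
From HB Require Import structures.
From mathcomp Require Import all_boot all_order all_algebra.
From mathcomp Require Import boolp classical_sets functions.

Set Implicit Arguments.
Unset Strict Implicit.
Unset Printing Implicit Defensive.
Import GRing.Theory.
Local Open Scope ring_scope.
Local Open Scope classical_set_scope.

(* Objects that are only determined up to unique isomorphism (Lie algebras of
   group schemes, enveloping algebras, completions, base changes, tensor
   products) are records packing a model together with the property that
   characterises it; results are meant to be stated for all models. *)

(** ** Complete discrete valuation rings *)

Definition cong_pow (R : pzRingType) (M : lmodType R) (pi : R) (i : nat)
  (x y : M) : Prop := exists z : M, y - x = pi ^+ i *: z.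

Record complete_dvr_mixed (R : idomainType) (p : nat) (pi : R) : Prop := {
  dvr_unif_neq0 : pi != 0;
  dvr_unif_nonunit : pi \isn't a GRing.unit;
  dvr_factor : forall x : R, x != 0 ->
    exists n : nat, exists2 u : R, u \is a GRing.unit & x = u * pi ^+ n;
  dvr_complete : forall x : nat -> R^o,
    (forall i, cong_pow pi i (x i) (x i.+1)) ->
    exists l : R^o, forall i, cong_pow pi i (x i) l;
  dvr_char0 : forall n : nat, (0 < n)%N -> n%:R != 0 :> R;
  dvr_prime : prime p;
  dvr_residue_char : exists y : R, p%:R = pi * y }.

(** ** Affine group schemes as commutative Hopf algebras *)

(* An element of M \otimes_R M is written as a list of pairs (x, y), standing
   for the sum of the x \otimes y; equality in M \otimes_R M is tested against
   all bilinear maps. *)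
Definition bilin (R : comNzRingType) (M V : lmodType R) (b : M -> M -> V) :=
  (forall y, linear (b^~ y)) /\ (forall x, linear (b x)).

Definition trilin (R : comNzRingType) (M V : lmodType R)
    (b : M -> M -> M -> V) :=
  [/\ forall y z, linear (fun x => b x y z),
      forall x z, linear (fun y => b x y z)
    & forall x y, linear (fun z => b x y z)].

Definition tensor_eq (R : comNzRingType) (M : lmodType R) (s t : seq (M * M)) :=
  forall (V : lmodType R) (b : M -> M -> V), bilin b ->
    \sum_(u <- s) b u.1 u.2 = \sum_(u <- t) b u.1 u.2.

(* [comul a] is a chosen representative of the comultiplication of a. *)
Record hopfAlg (R : comNzRingType) := HopfAlg {
  hopf_ring :> comAlgType R;
  comul : hopf_ring -> seq (hopf_ring * hopf_ring);
  counit : {lrmorphism hopf_ring -> R^o};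
  antipode : {lrmorphism hopf_ring -> hopf_ring};
  comul_linear : forall (r : R) (a b : hopf_ring),
    tensor_eq (comul (r *: a + b))
              ([seq (r *: u.1, u.2) | u <- comul a] ++ comul b);
  comul1 : tensor_eq (comul 1) [:: (1, 1)];
  comulM : forall a b : hopf_ring,
    tensor_eq (comul (a * b))
              [seq (u.1 * v.1, u.2 * v.2) | u <- comul a, v <- comul b];
  comulA : forall (V : lmodType R)
      (f : hopf_ring -> hopf_ring -> hopf_ring -> V) (a : hopf_ring),
    trilin f ->
    \sum_(u <- comul a) \sum_(v <- comul u.1) f v.1 v.2 u.2 =
    \sum_(u <- comul a) \sum_(v <- comul u.2) f u.1 v.1 v.2;
  counitl : forall a : hopf_ring,
    \sum_(u <- comul a) (counit u.1 : R) *: u.2 = a;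
  counitr : forall a : hopf_ring,
    \sum_(u <- comul a) (counit u.2 : R) *: u.1 = a;
  antipodel : forall a : hopf_ring,
    \sum_(u <- comul a) antipode u.1 * u.2 = (counit a : R)%:A;
  antipoder : forall a : hopf_ring,
    \sum_(u <- comul a) u.1 * antipode u.2 = (counit a : R)%:A }.

Arguments counit {R h}.
Arguments antipode {R h}.

Record closedSubgroup (R : comNzRingType) (G : hopfAlg R) := ClosedSubgroup {
  cs_group :> hopfAlg R;
  cs_res : {lrmorphism G -> cs_group};
  cs_res_comul : forall a : G,
    tensor_eq (comul (cs_res a))
              [seq (cs_res u.1, cs_res u.2) | u <- comul a];
  cs_res_surj : forall b : cs_group, exists a : G, cs_res a = b }.

Definition finite_type (R : comNzRingType) (A : comAlgType R) :=
  exists s : seq A, forall B : set A,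
    (forall a, a \in s -> B a) -> B 1 ->
    (forall (r : R) a b, B a -> B b -> B (r *: a + b)) ->
    (forall a b, B a -> B b -> B (a * b)) ->
    forall a, B a.

Definition formally_smooth (R : comNzRingType) (A : comAlgType R) :=
  forall (C C' : comAlgType R) (q : {lrmorphism C -> C'}),
    (forall c', exists c, q c = c') ->
    (forall x y, q x = 0 -> q y = 0 -> x * y = 0) ->
  forall f : {lrmorphism A -> C'},
    exists g : {lrmorphism A -> C}, forall a, q (g a) = f a.

(* Finite type and finite presentation agree over a noetherian base. *)
Definition smooth (R : comNzRingType) (A : comAlgType R) :=
  finite_type A /\ formally_smooth A.

(** ** Geometric fibres

   For a smooth G and a ring morphism s from R to an algebraically closed
   field k, the fibre of G at s is reduced, hence is the classical linear
   algebraic group G(k) with the k-algebra of functions spanned by the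
   evaluations at the elements of the coordinate ring of G. *)
Section GeometricFibre.
Variables (R : comNzRingType) (G : hopfAlg R).
Variables (k : closedFieldType) (s : {rmorphism R -> k}).

Definition points : set (G -> k) := [set x |
  [/\ x 1 = 1, {morph x : a b / a + b}, {morph x : a b / a * b}
    & forall r : R, x r%:A = s r]].

Definition pt1 : G -> k := fun a => s (counit a).
Definition ptM (x y : G -> k) : G -> k :=
  fun a => \sum_(u <- comul a) x u.1 * y u.2.
Definition ptV (x : G -> k) : G -> k := fun a => x (antipode a).

Definition pt_subgroup (H : set (G -> k)) :=
  [/\ H `<=` points, H pt1,
      forall x y, H x -> H y -> H (ptM x y)
    & forall x, H x -> H (ptV x)].

Definition regfun (f : seq (k * G)) (x : G -> k) : k :=
  \sum_(t <- f) t.1 * x t.2.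

Definition zclosed (Z : set (G -> k)) :=
  exists F : set (seq (k * G)),
    Z = [set x | points x /\ forall f, F f -> regfun f x = 0].

Definition zconnected (Z : set (G -> k)) :=
  forall Z1 Z2, zclosed Z1 -> zclosed Z2 ->
    Z `<=` Z1 `|` Z2 -> Z `&` (Z1 `&` Z2) = set0 ->
    Z `<=` Z1 \/ Z `<=` Z2.

Definition pt_normal (H : set (G -> k)) :=
  forall g h, points g -> H h -> H (ptM (ptM g h) (ptV g)).

Definition pt_derived (H : set (G -> k)) : set (G -> k) := [set x |
  forall D, pt_subgroup D ->
    (forall g h, H g -> H h -> D (ptM (ptM g h) (ptM (ptV g) (ptV h)))) ->
    D x].

Definition pt_solvable (H : set (G -> k)) :=
  exists n : nat, iter n pt_derived H `<=` [set pt1].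

Definition pt_character (H : set (G -> k)) (chi : (G -> k) -> k) :=
  [/\ chi pt1 = 1,
      forall x y, H x -> H y -> chi (ptM x y) = chi x * chi y
    & exists f, forall x, H x -> chi x = regfun f x].

Definition pt_diagonalizable (H : set (G -> k)) :=
  forall f : seq (k * G), exists (n : nat) (c : 'I_n -> k)
      (chi : 'I_n -> (G -> k) -> k),
    (forall i, pt_character H (chi i)) /\
    forall x, H x -> regfun f x = \sum_(i < n) c i * chi i x.

Definition pt_torus (H : set (G -> k)) :=
  [/\ pt_subgroup H, zclosed H, zconnected H & pt_diagonalizable H].

Definition pt_max_torus (H : set (G -> k)) :=
  pt_torus H /\ forall H', pt_torus H' -> H `<=` H' -> H' = H.

Definition pt_conn_solvable (H : set (G -> k)) :=
  [/\ pt_subgroup H, zclosed H, zconnected H & pt_solvable H].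

Definition pt_borel (H : set (G -> k)) :=
  pt_conn_solvable H /\
  forall H', pt_conn_solvable H' -> H `<=` H' -> H' = H.

Definition pt_semisimple :=
  zconnected points /\
  forall H, pt_conn_solvable H -> pt_normal H -> H = [set pt1].

End GeometricFibre.

Definition sub_points (R : comNzRingType) (G : hopfAlg R)
    (H : closedSubgroup G) (k : closedFieldType) (s : {rmorphism R -> k}) :
    set (G -> k) :=
  [set x | exists2 y : H -> k, points s y & x = y \o @cs_res _ _ H].

(* Smooth with connected semisimple geometric fibres. *)
Definition semisimple_group (R : comNzRingType) (G : hopfAlg R) :=
  smooth G /\
  forall (k : closedFieldType) (s : {rmorphism R -> k}),
    pt_semisimple G s.

Definition maximal_torus (R : comNzRingType) (G : hopfAlg R)
    (T : closedSubgroup G) :=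
  forall (k : closedFieldType) (s : {rmorphism R -> k}),
    pt_max_torus s (sub_points T s).

Definition borel_subgroup (R : comNzRingType) (G : hopfAlg R)
    (B : closedSubgroup G) :=
  smooth B /\
  forall (k : closedFieldType) (s : {rmorphism R -> k}),
    pt_borel s (sub_points B s).

(* An isomorphism of T with the diagonalisable group scheme of Z^r: the
   coordinate ring of T has a basis of group-like elements indexed by Z^r. *)
Record splitting (R : comNzRingType) (T : hopfAlg R) := Splitting {
  sp_rank : nat;
  sp_chr : 'rV[int]_sp_rank -> T;
  sp_chr0 : sp_chr 0 = 1;
  sp_chrD : forall m n, sp_chr (m + n) = sp_chr m * sp_chr n;
  sp_chr_comul : forall m,
    tensor_eq (comul (sp_chr m)) [:: (sp_chr m, sp_chr m)];
  sp_span : forall a : T, exists (ms : seq 'rV[int]_sp_rank)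
      (c : 'rV[int]_sp_rank -> R), a = \sum_(m <- ms) c m *: sp_chr m;
  sp_free : forall (ms : seq 'rV[int]_sp_rank) (c : 'rV[int]_sp_rank -> R),
    uniq ms -> \sum_(m <- ms) c m *: sp_chr m = 0 ->
    forall m, m \in ms -> c m = 0 }.

(** ** Lie algebras *)

Record lieAlg (R : comNzRingType) := LieAlg {
  lie_mod :> lmodType R;
  lbr : lie_mod -> lie_mod -> lie_mod;
  lbr_bilin : bilin lbr;
  lbrxx : forall x, lbr x x = 0;
  lbr_jacobi : forall x y z,
    lbr x (lbr y z) + lbr y (lbr z x) + lbr z (lbr x y) = 0 }.

Definition is_lie_hom (R : comNzRingType) (L L' : lieAlg R) (f : L -> L') :=
  forall x y, f (lbr x y) = lbr (f x) (f y).

Definition counit_derivation (R : comNzRingType) (G : hopfAlg R)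
    (D : {linear G -> R^o}) :=
  forall a b : G, D (a * b) = (counit a : R) * D b + D a * (counit b : R).

(* The Lie algebra of G: the derivations of the coordinate ring at the unit
   section, with the commutator of the convolution product. *)
Record lieOf (R : comNzRingType) (G : hopfAlg R) := LieOf {
  lie_alg :> lieAlg R;
  lie_ev : lie_alg -> {linear G -> R^o};
  lie_ev_linear : forall (r : R) x y a,
    lie_ev (r *: x + y) a = r * (lie_ev x a : R) + lie_ev y a;
  lie_ev_der : forall x, counit_derivation (lie_ev x);
  lie_ev_inj : forall x y, lie_ev x =1 lie_ev y -> x = y;
  lie_ev_surj : forall D : {linear G -> R^o}, counit_derivation D ->
    exists x, lie_ev x =1 D;
  lie_ev_lbr : forall x y a,
    lie_ev (lbr x y) a = \sum_(u <- comul a)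
      ((lie_ev x u.1 : R) * lie_ev y u.2 - (lie_ev y u.1 : R) * lie_ev x u.2) }.

Definition is_differential (R : comNzRingType) (G : hopfAlg R)
    (H : closedSubgroup G) (h : lieOf H) (g : lieOf G) (f : h -> g) :=
  forall x a, lie_ev (f x) a = lie_ev x (cs_res H a).

Definition chr_pair (r : nat) (m c : 'rV[int]_r) : int :=
  \sum_(i < r) m 0 i * c 0 i.

Section Weights.
Variables (R : comNzRingType) (G : hopfAlg R) (T : closedSubgroup G).
Variables (sp : splitting T) (g : lieOf G).

(* x has weight m for the adjoint action of T: on coordinate rings the
   conjugate t x t^-1 is a |-> a_(1)(t) x(a_(2)) a_(3)(t^-1). *)
Definition has_weight (m : 'rV[int]_(sp_rank sp)) (x : g) :=
  forall a : G,
    \sum_(u <- comul a) \sum_(v <- comul u.2)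
      (lie_ev x v.1 : R) *: cs_res T (u.1 * antipode v.2)
    = (lie_ev x a : R) *: sp_chr m.

Definition root_in (B : set g) (m : 'rV[int]_(sp_rank sp)) :=
  m <> 0 /\ exists x, [/\ x <> 0, B x & has_weight m x].

(* As the roots span the rational character space of a maximal torus of a
   semisimple group, there is exactly one such c for every root m. *)
Definition is_coroot (m c : 'rV[int]_(sp_rank sp)) :=
  [/\ root_in setT m, chr_pair m c = 2
    & forall b, root_in setT b -> root_in setT (b - m *~ chr_pair b c)].

(* The coroots generate the cocharacter group. *)
Definition simply_connected_datum :=
  forall mu : 'rV[int]_(sp_rank sp),
    exists (n : nat) (z : 'I_n -> int) (c : 'I_n -> 'rV[int]_(sp_rank sp)),
      (forall i, exists m, is_coroot m (c i)) /\
      mu = \sum_(i < n) c i *~ z i.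

(* For the Lie algebra B of a Borel subgroup containing T, the Lie algebra of
   its unipotent radical: the sum of the nonzero weight spaces of B. *)
Definition nilradical (B : set g) : set g := [set x |
  exists (n : nat) (v : 'I_n -> g),
    (forall i, B (v i) /\ exists2 m, m <> 0 & has_weight m (v i)) /\
    x = \sum_(i < n) v i].

End Weights.

Arguments root_in {R G T} sp {g} B m.
Arguments nilradical {R G T} sp {g} B.

(* A split maximal torus T, opposite Borel subgroups B+ and B- with
   intersection T, and the triangular decomposition they induce on the Lie
   algebra g of G.  The pair of Borel subgroups corresponds to a system of
   positive roots, which is the set of the roots that are positive on some
   regular cocharacter. *)
Record triangular (R : comNzRingType) (G : hopfAlg R) := Triangular {
  tr_T : closedSubgroup G;
  tr_split : splitting tr_T;
  tr_T_max : maximal_torus tr_T;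
  tr_Bp : closedSubgroup G;
  tr_Bm : closedSubgroup G;
  tr_Bp_borel : borel_subgroup tr_Bp;
  tr_Bm_borel : borel_subgroup tr_Bm;
  tr_opposite : forall a : G, cs_res tr_T a = 0 <->
    exists b c, [/\ cs_res tr_Bp b = 0, cs_res tr_Bm c = 0 & a = b + c];
  tr_g : lieOf G;
  tr_h : lieOf tr_T;
  tr_bp : lieOf tr_Bp;
  tr_bm : lieOf tr_Bm;
  tr_h_in : {linear tr_h -> tr_g};
  tr_bp_in : {linear tr_bp -> tr_g};
  tr_bm_in : {linear tr_bm -> tr_g};
  tr_h_inP : is_differential tr_h_in;
  tr_bp_inP : is_differential tr_bp_in;
  tr_bm_inP : is_differential tr_bm_in;
  tr_np : set tr_g := nilradical tr_split (range tr_bp_in);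
  tr_nm : set tr_g := nilradical tr_split (range tr_bm_in);
  tr_g_sum : forall x : tr_g, exists y t z,
    [/\ tr_nm y, tr_np z & x = y + tr_h_in t + z];
  tr_g_direct : forall y t z, tr_nm y -> tr_np z ->
    y + tr_h_in t + z = 0 -> [/\ y = 0, tr_h_in t = 0 & z = 0];
  tr_bp_sum : range tr_bp_in =
    [set x | exists t z, tr_np z /\ x = tr_h_in t + z];
  tr_bm_sum : range tr_bm_in =
    [set x | exists t y, tr_nm y /\ x = tr_h_in t + y];
  tr_mu : 'rV[int]_(sp_rank tr_split);
  tr_pos : forall m, root_in tr_split [set: tr_g] m ->
    (root_in tr_split (range tr_bp_in) m <-> 0 < chr_pair m tr_mu) /\
    (root_in tr_split (range tr_bm_in) m <-> chr_pair m tr_mu < 0) }.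

Definition simply_connected (R : comNzRingType) (G : hopfAlg R)
    (D : triangular G) := simply_connected_datum (tr_split D) (tr_g D).

(** ** Enveloping algebras, completions and base change *)

Definition is_lie_map (R : comNzRingType) (L : lieAlg R) (U : algType R)
    (f : L -> U) :=
  forall x y, f (lbr x y) = f x * f y - f y * f x.

Record envAlg (R : comNzRingType) (L : lieAlg R) := EnvAlg {
  env_alg :> algType R;
  env_in : {linear L -> env_alg};
  env_lie : is_lie_map env_in;
  env_univ : forall (W : algType R) (f : {linear L -> W}), is_lie_map f ->
    exists F : {lrmorphism env_alg -> W}, (forall x, F (env_in x) = f x) /\
      forall F' : {lrmorphism env_alg -> W},
        (forall x, F' (env_in x) = f x) -> F' =1 F }.

(* The inverse limit of the U / pi^i U.  [cpl_red i x u] says that the image of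
   x in U / pi^i U is the class of u. *)
Record adicCompletion (R : comNzRingType) (pi : R) (U : algType R) :=
    AdicCompletion {
  cpl_alg :> algType R;
  cpl_red : nat -> cpl_alg -> U -> Prop;
  cpl_red_total : forall i x, exists u, cpl_red i x u;
  cpl_red_class : forall i x u v,
    cpl_red i x u -> (cpl_red i x v <-> cong_pow pi i u v);
  cpl_red1 : forall i, cpl_red i 1 1;
  cpl_redP : forall i (r : R) x y u v, cpl_red i x u -> cpl_red i y v ->
    cpl_red i (r *: x + y) (r *: u + v);
  cpl_redM : forall i x y u v, cpl_red i x u -> cpl_red i y v ->
    cpl_red i (x * y) (u * v);
  cpl_redS : forall i x u, cpl_red i.+1 x u -> cpl_red i x u;
  cpl_lim : forall u : nat -> U,
    (forall i, cong_pow pi i (u i) (u i.+1)) ->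
    exists x, forall i, cpl_red i x (u i);
  cpl_sep : forall x y,
    (forall i u, cpl_red i x u -> cpl_red i y u) -> x = y;
  cpl_in : {lrmorphism U -> cpl_alg};
  cpl_inP : forall i u, cpl_red i (cpl_in u) u }.

Definition frac_linear (R : idomainType) (V : lmodType R)
    (W : lmodType {fraction R}) (f : V -> W) :=
  forall (r : R) x, f (r *: x) = tofrac r *: f x.

(* A \otimes_R K as a K-algebra, K the field of fractions of R. *)
Record algFrac (R : idomainType) (A : algType R) := AlgFrac {
  af_alg :> algType {fraction R};
  af_in : {rmorphism A -> af_alg};
  af_in_lin : frac_linear af_in;
  af_univ : forall (W : algType {fraction R}) (f : {rmorphism A -> W}),
    frac_linear f ->
    exists F : {lrmorphism af_alg -> W}, (forall x, F (af_in x) = f x) /\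
      forall F' : {lrmorphism af_alg -> W},
        (forall x, F' (af_in x) = f x) -> F' =1 F }.

(* L \otimes_R K as a Lie algebra over K. *)
Record lieFrac (R : idomainType) (L : lieAlg R) := LieFrac {
  lf_lie :> lieAlg {fraction R};
  lf_in : {additive L -> lf_lie};
  lf_in_lin : frac_linear lf_in;
  lf_in_lbr : forall x y, lf_in (lbr x y) = lbr (lf_in x) (lf_in y);
  lf_univ : forall (W : lmodType {fraction R}) (f : {additive L -> W}),
    frac_linear f ->
    exists F : {linear lf_lie -> W}, (forall x, F (lf_in x) = f x) /\
      forall F' : {linear lf_lie -> W},
        (forall x, F' (lf_in x) = f x) -> F' =1 F }.

(* The affinoid enveloping algebra of L. *)
Record affEnv (R : idomainType) (pi : R) (L : lieAlg R) := AffEnv {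
  ae_env : envAlg L;
  ae_cpl : adicCompletion pi ae_env;
  ae_alg :> algFrac ae_cpl }.

Definition ae_in (R : idomainType) (pi : R) (L : lieAlg R) (E : affEnv pi L)
  (x : L) : E := af_in E (cpl_in (ae_cpl E) (env_in (ae_env E) x)).

(* The enveloping algebra of L_K. *)
Record classEnv (R : idomainType) (L : lieAlg R) := ClassEnv {
  ce_lie : lieFrac L;
  ce_alg :> envAlg ce_lie }.

Definition ce_in (R : idomainType) (L : lieAlg R) (E : classEnv L)
  (x : L) : E := env_in E (lf_in (ce_lie E) x).

(* The maps induced by a morphism f of Lie algebras over R; the affinoid one
   extends the map between the completions. *)
Record affEnvMap (R : idomainType) (pi : R) (L L' : lieAlg R) (f : L -> L')
    (E : affEnv pi L) (E' : affEnv pi L') := AffEnvMap {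
  aem_cpl : {lrmorphism ae_cpl E -> ae_cpl E'};
  aem_cplP : forall x, aem_cpl (cpl_in (ae_cpl E) (env_in (ae_env E) x)) =
    cpl_in (ae_cpl E') (env_in (ae_env E') (f x));
  aem_map :> {lrmorphism E -> E'};
  aem_mapP : forall x, aem_map (af_in E x) = af_in E' (aem_cpl x) }.

Record classEnvMap (R : idomainType) (L L' : lieAlg R) (f : L -> L')
    (E : classEnv L) (E' : classEnv L') := ClassEnvMap {
  cem_map :> {lrmorphism E -> E'};
  cem_mapP : forall x, cem_map (ce_in E x) = ce_in E' (f x) }.

(** ** Modules *)

(* The one-dimensional S-module given by a character of a K-algebra S. *)
Definition charMod (K : fieldType) (S : algType K)
  (chi : {lrmorphism S -> K^o}) : Type := K.

Section CharMod.
Variables (K : fieldType) (S : algType K) (chi : {lrmorphism S -> K^o}).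

HB.instance Definition _ := GRing.Zmodule.copy (charMod chi) K.

Definition charMod_scale (s : S) (c : charMod chi) : charMod chi :=
  (chi s : K) * (c : K).

Fact charMod_scaleA s t c :
  charMod_scale s (charMod_scale t c) = charMod_scale (s * t) c.
Proof. by rewrite /charMod_scale rmorphM /= mulrA. Qed.

Fact charMod_scale1 : left_id 1 charMod_scale.
Proof. by move=> c; rewrite /charMod_scale rmorph1 mul1r. Qed.

Fact charMod_scaleDr : right_distributive charMod_scale +%R.
Proof. by move=> s c d; rewrite /charMod_scale mulrDr. Qed.

Fact charMod_scaleDl c :
  {morph charMod_scale^~ c : s t / s + t}.
Proof. by move=> s t; rewrite /charMod_scale raddfD mulrDl. Qed.

HB.instance Definition _ := GRing.Zmodule_isLmodule.Build S (charMod chi)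
  charMod_scaleA charMod_scale1 charMod_scaleDr charMod_scaleDl.
End CharMod.

Section Induction.
Variables (S T : nzRingType) (j : {rmorphism S -> T}) (N : lmodType S).

Definition balanced (V : zmodType) (f : T -> N -> V) :=
  [/\ forall t t' n, f (t + t') n = f t n + f t' n,
      forall t n n', f t (n + n') = f t n + f t n'
    & forall t s n, f (t * j s) n = f t (s *: n)].

(* T \otimes_S N with its left T-action. *)
Record inducedMod := InducedMod {
  im_mod :> lmodType T;
  im_tens : T -> N -> im_mod;
  im_balanced : balanced im_tens;
  im_scale : forall t t' n, im_tens (t * t') n = t *: im_tens t' n;
  im_univ : forall (V : zmodType) (f : T -> N -> V), balanced f ->
    exists F : {additive im_mod -> V}, (forall t n, F (im_tens t n) = f t n) /\
      forall F' : {additive im_mod -> V},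
        (forall t n, F' (im_tens t n) = f t n) -> F' =1 F }.
End Induction.

Definition submodules (S : nzRingType) (M : lmodType S) : set (set M) :=
  [set N | N 0 /\ forall (s : S) x y, N x -> N y -> N (s *: x + y)].

Definition simple_module (S : nzRingType) (M : lmodType S) :=
  (exists x : M, x <> 0) /\
  forall N : set M, submodules N -> N = [set 0] \/ N = setT.

Definition is_simple_quotient (S : nzRingType) (M L : lmodType S)
    (q : {linear M -> L}) :=
  simple_module L /\ forall y, exists x, q x = y.

Definition has_unique_simple_quotient (S : nzRingType) (M : lmodType S) :=
  exists (L : lmodType S) (q : {linear M -> L}),
    is_simple_quotient q /\
    forall (L' : lmodType S) (q' : {linear M -> L'}), is_simple_quotient q' ->
      exists2 f : {linear L -> L'}, bijective f & forall x, q' x = f (q x).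

(** ** Verma modules *)

(* [lamb] is the extension of [lam] to b+ by zero on n+. *)
Definition extends_weight (R : comNzRingType) (G : hopfAlg R)
    (D : triangular G) (lam : {linear tr_h D -> R^o})
    (lamb : {linear tr_bp D -> R^o}) :=
  (forall x t, tr_bp_in D x = tr_h_in D t -> lamb x = lam t) /\
  (forall x, tr_np (tr_bp_in D x) -> lamb x = 0).

Record affVerma (R : idomainType) (pi : R) (G : hopfAlg R) (D : triangular G)
    (lam : {linear tr_h D -> R^o}) (Eg : affEnv pi (tr_g D)) := AffVerma {
  av_Eb : affEnv pi (tr_bp D);
  av_map : affEnvMap (tr_bp_in D) av_Eb Eg;
  av_lamb : {linear tr_bp D -> R^o};
  av_lambP : extends_weight lam av_lamb;
  av_chi : {lrmorphism av_Eb -> {fraction R}^o};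
  av_chiP : forall x, av_chi (ae_in av_Eb x) = tofrac (av_lamb x : R);
  av_mod :> inducedMod (aem_map av_map) (charMod av_chi) }.

Record classVerma (R : idomainType) (G : hopfAlg R) (D : triangular G)
    (lam : {linear tr_h D -> R^o}) (Eg : classEnv (tr_g D)) := ClassVerma {
  cv_Eb : classEnv (tr_bp D);
  cv_map : classEnvMap (tr_bp_in D) cv_Eb Eg;
  cv_lamb : {linear tr_bp D -> R^o};
  cv_lambP : extends_weight lam cv_lamb;
  cv_chi : {lrmorphism cv_Eb -> {fraction R}^o};
  cv_chiP : forall x, cv_chi (ce_in cv_Eb x) = tofrac (cv_lamb x : R);
  cv_mod :> inducedMod (cem_map cv_map) (charMod cv_chi) }.

(* The canonical map from the classical to the affinoid Verma module, semilinear
   along the canonical map theta from U(g_K) to its affinoid completion. *)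
Definition is_canonical_map (R : idomainType) (pi : R) (G : hopfAlg R)
    (D : triangular G) (lam : {linear tr_h D -> R^o})
    (Eg : classEnv (tr_g D)) (Egh : affEnv pi (tr_g D))
    (M : classVerma lam Eg) (Mh : affVerma lam Egh)
    (theta : {lrmorphism Eg -> Egh}) (can : {additive M -> Mh}) :=
  (forall x, theta (ce_in Eg x) = ae_in Egh x) /\
  (forall (t : Eg) (c : {fraction R}),
     can (im_tens (cv_mod M) t c) = im_tens (av_mod Mh) (theta t) c).

(* Main.v *)
Require Import Defs.
From HB Require Import structures.
From mathcomp Require Import all_boot all_order all_algebra.
From mathcomp Require Import generic_quotient ring_quotient.
From mathcomp Require Import boolp classical_sets functions.
From mathcomp Require Import ring.
Set Implicit Arguments.
Unset Strict Implicit.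
Unset Printing Implicit Defensive.
Import GRing.Theory.
Local Open Scope ring_scope.
Local Open Scope classical_set_scope.

(** The affinoid Verma module contains the classical one as a dense subspace:
    its elements are the series in the ordered monomials of a basis of n^-,
    applied to the highest weight vector, whose coefficients tend to 0. A
    submodule N of it is sent to its intersection with the classical Verma
    module, and the inverse map takes closures. Three facts make this work.

    Every submodule N is closed (submodule_closed). Modulo pi the monomials
    multiply like those of a polynomial ring, up to terms of lower degree. So,
    by Dickson's lemma, finitely many integral elements of N generate all of
    them modulo pi (fg_mod_unif), and as the completed enveloping algebra is
    complete, successive approximation shows that they generate the closure.

    Every submodule N is homogeneous (submodule_graded). The cocharacter that
    is positive on the positive roots has a derivative H in the Cartan
    subalgebra, and H has the monomials as eigenvectors, with eigenvalues that
    differ from the one on the highest weight vector by a natural number, the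
    degree. For this grading each homogeneous part is finite-dimensional.
    Lagrange interpolation at integers, whose denominators are absorbed by
    binomial coefficients, gives polynomials in H that preserve the lattice of
    integral elements and project to degree d up to any given degree. Thus the
    homogeneous components of an element of N are limits of elements of N. As
    a consequence N is the closure of its classical part (preim_sub), and the
    correspondence is injective and reflects inclusions.

    Conversely the classical part of the closure of a classical submodule N0
    is N0 (preim_completion): this can be checked degree by degree, and
    subspaces of finite-dimensional spaces over K are closed.

    Finally a submodule whose elements are not all without component in degree
    0, even after applying operators, contains the highest weight vector by
    homogeneity; so there is a largest proper submodule
    (unique_simple_quotient).

    These arguments are carried out for modules with a lattice, a topological
    basis and a degree operator (lattice_module_submodules). To apply them one
    needs coordinates on the affinoid Verma module, and these rest on the
    Poincare-Birkhoff-Witt theorem. As R has characteristic 0, the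
    independence of the monomials follows from the action of the enveloping
    algebra on the coordinate ring of G by differential operators (pbw_free).
    The coordinates are then defined on monomials and extended by continuity
    and base change, and they separate points because the left ideal that
    annihilates the highest weight vector is finitely generated
    (verma_lattice_sep). *)

(** * Generation of universal objects *)

Section Linear.
Variables (R : nzRingType) (V W : lmodType R) (f : V -> W).
Hypothesis f_lin : linear f.

Lemma lin0 : f 0 = 0.
Proof. by have := f_lin (-1) 0 0; rewrite scaler0 addr0 scaleN1r addNr. Qed.

Lemma linZ r x : f (r *: x) = r *: f x.
Proof. by rewrite -[r *: x]addr0 f_lin lin0 addr0. Qed.

Lemma linD x y : f (x + y) = f x + f y.
Proof. by have := f_lin 1 x y; rewrite !scale1r. Qed.
End Linear.

Section Subalgebra.
Variables (R : comNzRingType) (A : algType R) (S : set A).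

Definition subalgebra := [/\ S 1,
  forall (r : R) x y, S x -> S y -> S (r *: x + y)
  & forall x y, S x -> S y -> S (x * y)].

Definition subalg_pred (hS : subalgebra) : {pred A} := fun x => `[< S x >].

Variable hS : subalgebra.

Fact subalg_predP : GRing.subsemialg_closed (subalg_pred hS).
Proof.
case: hS => S1 SZ SM; apply: GRing.subalg_closed_semi; split.
- exact/asboolP.
- by move=> r x y /asboolP Sx /asboolP Sy; apply/asboolP/SZ.
- by move=> x y /asboolP Sx /asboolP Sy; apply/asboolP/SM.
Qed.
HB.instance Definition _ :=
  GRing.isSubalgClosed.Build R A (subalg_pred hS) subalg_predP.

Definition subalg := {x : A | x \in subalg_pred hS}.
HB.instance Definition _ := SubChoice.on subalg.
HB.instance Definition _ := [SubChoice_isSubAlgebra of subalg by <:].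

Definition subalg_val (x : subalg) : A := val x.
Fact subalg_val_linear : linear subalg_val.
Proof. by move=> r x y; rewrite /subalg_val linearP. Qed.
Fact subalg_val_monoid : monoid_morphism subalg_val.
Proof. by split=> [|x y]; rewrite /subalg_val ?rmorph1 ?rmorphM. Qed.
HB.instance Definition _ :=
  GRing.isLinear.Build R subalg A *:%R subalg_val subalg_val_linear.
HB.instance Definition _ :=
  GRing.isMonoidMorphism.Build subalg A subalg_val subalg_val_monoid.

End Subalgebra.

Lemma subalg_in (R : comNzRingType) (A : algType R) (S : set A)
    (hS : subalgebra S) (x : subalg hS) : S (val x).
Proof. by case: x => x /= /asboolP. Qed.

(** The corestriction of the generators to a subalgebra containing them extends
    to U; followed by the inclusion it is an endomorphism of U fixing the
    generators, hence the identity by uniqueness. The same argument gives the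
    induction principles of the other universal objects below. *)
Lemma env_ind (R : comNzRingType) (L : lieAlg R) (U : envAlg L) (S : set U) :
  subalgebra S -> (forall x, S (env_in U x)) -> forall u, S u.
Proof.
move=> hS Sin.
pose f0 x : subalg hS := exist _ (env_in U x) (asboolT (Sin x)).
have f0_lin : linear f0.
  by move=> r x y; apply: val_inj; rewrite !linearP /= linearP.
pose f : {linear L -> subalg hS} :=
  HB.pack f0 (GRing.isLinear.Build _ _ _ _ f0 f0_lin).
have f_lie : is_lie_map f.
  by move=> x y; apply: val_inj; rewrite rmorphB !rmorphM /= env_lie.
have [F [hF _]] := env_univ U f_lie.
have [F1 [_ uniq]] := env_univ U (@env_lie _ _ U).
pose Q : {lrmorphism U -> U} := @subalg_val _ _ _ hS \o F.
have hQ x : Q (env_in U x) = env_in U x by rewrite /Q /= hF.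
have FE u : subalg_val (F u) = u.
  transitivity (Q u) => //; rewrite (uniq Q hQ); symmetry.
  exact: (uniq [the {lrmorphism U -> U} of idfun]).
by move=> u; rewrite -[u]FE; apply: subalg_in.
Qed.

Lemma algFrac_ind (R : idomainType) (A : algType R) (B : algFrac A)
    (S : set B) :
  subalgebra S -> (forall x, S (af_in B x)) -> forall u, S u.
Proof.
move=> hS Sin.
pose f0 x : subalg hS := exist _ (af_in B x) (asboolT (Sin x)).
have f0B : zmod_morphism f0 by move=> x y; apply: val_inj; rewrite raddfB /= raddfB.
have f0M : monoid_morphism f0.
  by split=> [|x y]; apply: val_inj; rewrite ?rmorphM /= ?rmorph1 ?rmorphM.
pose f : {rmorphism A -> subalg hS} :=
  HB.pack f0 (GRing.isZmodMorphism.Build _ _ f0 f0B)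
    (GRing.isMonoidMorphism.Build _ _ f0 f0M).
have f_lin : frac_linear f.
  by move=> r x; apply: val_inj; rewrite linearZ /= af_in_lin.
have [F [hF _]] := af_univ B f_lin.
have [F1 [_ uniq]] := af_univ B (@af_in_lin _ _ B).
pose Q : {lrmorphism B -> B} := @subalg_val _ _ _ hS \o F.
have hQ x : Q (af_in B x) = af_in B x by rewrite /Q /= hF.
have FE u : subalg_val (F u) = u.
  transitivity (Q u) => //; rewrite (uniq Q hQ); symmetry.
  exact: (uniq [the {lrmorphism B -> B} of idfun]).
by move=> u; rewrite -[u]FE; apply: subalg_in.
Qed.

Section Submodule.
Variables (R : nzRingType) (M : lmodType R) (S : set M).
Definition submod_pred (hS : submodules S) : {pred M} := fun x => `[< S x >].
Variable hS : submodules S.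
Fact submod_predP : GRing.subsemimod_closed (submod_pred hS).
Proof.
case: hS => S0 SZ; apply: GRing.submod_closed_semi; split.
- exact/asboolP.
- by move=> r x y /asboolP Sx /asboolP Sy; apply/asboolP/SZ.
Qed.
HB.instance Definition _ :=
  GRing.isSubmodClosed.Build R M (submod_pred hS) submod_predP.
Definition submod := {x : M | x \in submod_pred hS}.
HB.instance Definition _ := SubChoice.on submod.
HB.instance Definition _ := [SubChoice_isSubLmodule of submod by <:].
Definition submod_val (x : submod) : M := val x.
Fact submod_val_linear : linear submod_val.
Proof. by move=> r x y; rewrite /submod_val linearP. Qed.
HB.instance Definition _ :=
  GRing.isLinear.Build R submod M *:%R submod_val submod_val_linear.
Lemma submod_in (x : submod) : S (val x).
Proof. by case: x => x /= /asboolP. Qed.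
End Submodule.

Lemma lieFrac_ind (R : idomainType) (L : lieAlg R) (B : lieFrac L)
    (S : set B) :
  submodules S -> (forall x, S (lf_in B x)) -> forall u, S u.
Proof.
move=> hS Sin.
pose f0 x : submod hS := exist _ (lf_in B x) (asboolT (Sin x)).
have f0B : zmod_morphism f0 by move=> x y; apply: val_inj; rewrite raddfB /= raddfB.
pose f : {additive L -> submod hS} :=
  HB.pack f0 (GRing.isZmodMorphism.Build _ _ f0 f0B).
have f_lin : frac_linear f.
  by move=> r x; apply: val_inj; rewrite linearZ /= lf_in_lin.
have [F [hF _]] := lf_univ B f_lin.
have [F1 [_ uniq]] := lf_univ B (@lf_in_lin _ _ B).
pose Q : {linear B -> B} := @submod_val _ _ _ hS \o F.
have hQ x : Q (lf_in B x) = lf_in B x by rewrite /Q /= hF.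
have FE u : submod_val (F u) = u.
  transitivity (Q u) => //; rewrite (uniq Q hQ); symmetry.
  exact: (uniq [the {linear B -> B} of idfun]).
by move=> u; rewrite -[u]FE; apply: submod_in.
Qed.

Section Subgroup.
Variables (M : zmodType) (S : set M).
Definition subgroup := S 0 /\ forall x y, S x -> S y -> S (x - y).
Definition subgrp_pred (hS : subgroup) : {pred M} := fun x => `[< S x >].
Variable hS : subgroup.
Fact subgrp_predP : zmod_closed (subgrp_pred hS).
Proof.
case: hS => S0 SB; split; first exact/asboolP.
by move=> x y /asboolP Sx /asboolP Sy; apply/asboolP/SB.
Qed.
HB.instance Definition _ :=
  GRing.isZmodClosed.Build M (subgrp_pred hS) subgrp_predP.
Definition subgrp := {x : M | x \in subgrp_pred hS}.
HB.instance Definition _ := SubChoice.on subgrp.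
HB.instance Definition _ := [SubChoice_isSubZmodule of subgrp by <:].
Definition subgrp_val (x : subgrp) : M := val x.
Fact subgrp_val_additive : zmod_morphism subgrp_val.
Proof. by move=> x y; rewrite /subgrp_val raddfB. Qed.
HB.instance Definition _ :=
  GRing.isZmodMorphism.Build subgrp M subgrp_val subgrp_val_additive.
Lemma subgrp_in (x : subgrp) : S (val x).
Proof. by case: x => x /= /asboolP. Qed.
End Subgroup.

Lemma inducedMod_ind (S T : nzRingType) (j : {rmorphism S -> T})
    (N : lmodType S) (I : inducedMod j N) (P : set I) :
  subgroup P -> (forall t n, P (im_tens I t n)) -> forall x, P x.
Proof.
move=> hP Pt.
pose f t n : subgrp hP := exist _ (im_tens I t n) (asboolT (Pt t n)).
have [b1 b2 b3] := im_balanced I.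
have f_bal : balanced j f by split=> *; apply: val_inj; rewrite /= ?b1 ?b2 ?b3.
have [F [hF _]] := im_univ I f_bal.
have [F1 [_ uniq]] := im_univ I (im_balanced I).
pose Q : {additive I -> I} := @subgrp_val _ _ hP \o F.
have hQ t n : Q (im_tens I t n) = im_tens I t n by rewrite /Q /= hF.
have FE u : subgrp_val (F u) = u.
  transitivity (Q u) => //; rewrite (uniq Q hQ); symmetry.
  exact: (uniq [the {additive I -> I} of idfun]).
by move=> x; rewrite -[x]FE; apply: subgrp_in.
Qed.

(** * The algebra of endomorphisms of a module *)

Section Endomorphisms.
Variables (K : comNzRingType) (V : lmodType K).

Definition linear_maps : set (V -> V) := [set f | linear f].

Fact linear_maps_submod : submodules linear_maps.
Proof.
split=> [r x y|c f g hf hg r x y]; rewrite /= ?fctE.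
  by rewrite scaler0 addr0.
by rewrite hf hg !scalerDr !scalerA addrACA [r * c]mulrC.
Qed.

Variable v0 : V.
Hypothesis v0_neq0 : v0 <> 0.

(** The nonzero vector is a parameter because a ring structure requires 1 to
    differ from 0. *)
Definition endo of v0 <> 0 := submod linear_maps_submod.
Local Notation E := (endo v0_neq0).
HB.instance Definition _ := GRing.Lmodule.on E.

Definition endo_fun (f : E) : V -> V := val f.

Lemma endo_ext (f g : E) : endo_fun f =1 endo_fun g -> f = g.
Proof. by move=> fg; apply: val_inj; apply/funext. Qed.

Lemma endo_lin (f : E) : linear (endo_fun f).
Proof. exact: submod_in. Qed.

Lemma endoD (f g : E) x : endo_fun (f + g) x = endo_fun f x + endo_fun g x.
Proof. by []. Qed.
Lemma endoZ (f : E) c x : endo_fun (c *: f) x = c *: endo_fun f x. Proof. by []. Qed.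
Lemma endoN (f : E) x : endo_fun (- f) x = - endo_fun f x. Proof. by []. Qed.

Definition mk_endo (f : V -> V) (hf : linear f) : E :=
  exist _ f (asboolT (hf : linear_maps f)).

Fact id_lin : linear (@id V). Proof. by []. Qed.
Fact comp_lin (f g : E) : linear (endo_fun f \o endo_fun g).
Proof. by move=> r x y; rewrite /= !endo_lin. Qed.

Definition endo1 : E := mk_endo id_lin.
Definition endoM (f g : E) : E := mk_endo (comp_lin f g).

Fact endoMA : associative endoM. Proof. by move=> f g h; apply: endo_ext. Qed.
Fact endo1M : left_id endo1 endoM. Proof. by move=> f; apply: endo_ext. Qed.
Fact endoM1 : right_id endo1 endoM. Proof. by move=> f; apply: endo_ext. Qed.
Fact endoMDl : left_distributive endoM +%R.
Proof. by move=> f g h; apply: endo_ext. Qed.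
Fact endoMDr : right_distributive endoM +%R.
Proof.
by move=> f g h; apply: endo_ext => x; apply: linD (endo_lin f) _ _.
Qed.
Fact endo1_neq0 : endo1 != 0.
Proof.
apply/eqP => /(congr1 (fun f : E => endo_fun f v0)) /= h.
by apply: v0_neq0.
Qed.
HB.instance Definition _ := GRing.Zmodule_isNzRing.Build E
  endoMA endo1M endoM1 endoMDl endoMDr endo1_neq0.
Fact endoZAl (c : K) (f g : E) : c *: (f * g) = (c *: f) * g.
Proof. by apply: endo_ext. Qed.
HB.instance Definition _ := GRing.Lmodule_isLalgebra.Build K E endoZAl.
Fact endoZAr (c : K) (f g : E) : c *: (f * g) = f * (c *: g).
Proof.
by apply: endo_ext => x; apply: esym (linZ (endo_lin f) c _).
Qed.
HB.instance Definition _ := GRing.Lalgebra_isAlgebra.Build K E endoZAr.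

Lemma endo_mulE (f g : E) x : endo_fun (f * g) x = endo_fun f (endo_fun g x).
Proof. by []. Qed.
Lemma endo_1E x : endo_fun (1 : E) x = x. Proof. by []. Qed.
Lemma mk_endoE (f : V -> V) (hf : linear f) x : endo_fun (mk_endo hf) x = f x.
Proof. by []. Qed.
End Endomorphisms.

(** * Discrete valuation rings and their fraction fields *)

Lemma fracE (R : idomainType) (c : {fraction R}) :
  exists (a b : R), b != 0 /\ c = tofrac a / tofrac b.
Proof.
elim/quotW: c => x; exists \n_x, \d_x; split; first exact: denom_ratioP.
have d0 : tofrac \d_x != 0 by rewrite tofrac_eq0 denom_ratioP.
apply: (mulIf d0); rewrite divfK //; unlock tofrac.
apply: etrans (esym (FracField.pi_mul _ _)) _; apply/eqmodP.
rewrite /= FracField.equivfE /FracField.mulf.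
by rewrite !numden_Ratio ?mulr1 ?oner_eq0 ?denom_ratioP // mulrC.
Qed.

Section DVR.
Variables (R : idomainType) (p : nat) (pi : R).
Hypothesis hR : complete_dvr_mixed p pi.
Local Notation K := {fraction R}.

Lemma unif_expf_neq0 i : pi ^+ i != 0.
Proof. exact/expf_neq0/(dvr_unif_neq0 hR). Qed.

Lemma dvr_sep (x : R) : (forall i, exists y, x = pi ^+ i * y) -> x = 0.
Proof.
move=> hx; apply/eqP/negPn/negP => /(dvr_factor hR) [n [u uU xE]].
have [y] := hx n.+1; rewrite xE exprSr [u * _]mulrC -mulrA.
move=> /(mulfI (unif_expf_neq0 n)) uE.
move: uU; rewrite uE unitrM => /andP[piU _].
by have := dvr_unif_nonunit hR; rewrite piU.
Qed.

Lemma dvr_unit_or (x : R) : x \is a GRing.unit \/ exists y, x = pi * y.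
Proof.
have [->|/(dvr_factor hR) [[|n] [u uU ->]]] := eqVneq x 0.
- by right; exists 0; rewrite mulr0.
- by left; rewrite mulr1.
- by right; exists (u * pi ^+ n); rewrite exprS mulrCA.
Qed.

(** An element of least valuation. *)
Lemma dvr_min (P : set R) : (exists x, P x /\ x != 0) ->
  exists x, [/\ P x, x != 0 & forall y, P y -> exists d, y = d * x].
Proof.
move=> [x [Px x0]].
pose Q n := `[< exists2 u : R, u \is a GRing.unit & P (u * pi ^+ n) >].
have exQ : exists n, Q n.
  have [n [u uU xE]] := dvr_factor hR x0.
  by exists n; apply/asboolP; exists u => //; rewrite -xE.
case: (ex_minnP exQ) => n /asboolP[u uU Pu] nmin.
exists (u * pi ^+ n); split=> //.
  by rewrite mulf_neq0 ?unif_expf_neq0 //; apply: contraTneq uU => ->; rewrite unitr0.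
move=> y Py; have [->|y0] := eqVneq y 0; first by exists 0; rewrite mul0r.
have [m [w wU yE]] := dvr_factor hR y0.
have nm : (n <= m)%N by apply: nmin; apply/asboolP; exists w => //; rewrite -yE.
exists (w * pi ^+ (m - n) * u^-1).
by rewrite yE -mulrA mulKr // -mulrA -exprD subnK.
Qed.

Lemma dvr_dvd_total (a b : R) : (exists c, a = c * b) \/ (exists c, b = c * a).
Proof.
have [->|a0] := eqVneq a 0; first by left; exists 0; rewrite mul0r.
have [|x [[->|->] x0 hx]] := @dvr_min [set x | x = a \/ x = b].
- by exists a; split=> //; left.
- by right; apply: hx; right.
- by left; apply: hx; left.
Qed.

Local Notation "x %:K" := (tofrac x : K) (at level 2, format "x %:K").

Lemma unifK_neq0 : pi%:K != 0.
Proof. by rewrite tofrac_eq0 (dvr_unif_neq0 hR). Qed.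

Lemma frac_denom (c : K) : exists k r, pi%:K ^+ k * c = r%:K.
Proof.
have [a [b [b0 ->]]] := fracE c.
have [n [u uU bE]] := dvr_factor hR b0.
exists n, (a * u^-1); have bK : b%:K != 0 by rewrite tofrac_eq0.
apply: (mulIf bK); rewrite -!mulrA mulVf // mulr1 -tofracXn -!tofracM.
by rewrite bE mulrA mulrVK // mulrC.
Qed.

(** A fraction either has nonnegative valuation or is the inverse of a multiple
    of the uniformiser. *)
Lemma frac_val (c : K) :
  (exists r, c = r%:K) \/ (exists r, pi%:K * r%:K * c = 1).
Proof.
have [a [b [b0 ->]]] := fracE c; have bK : b%:K != 0 by rewrite tofrac_eq0.
have [[d ->]|[d E]] := dvr_dvd_total a b.
  by left; exists d; rewrite tofracM mulfK.
have [dU|[y dE]] := dvr_unit_or d.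
  left; exists d^-1; apply: (mulIf bK).
  by rewrite divfK // E -tofracM mulKr.
right; exists y; rewrite -tofracM -dE mulrA -tofracM -E divff //.
Qed.

End DVR.

(** * Torsion-free modules over a discrete valuation ring *)

Section Families.
Variables (R : nzRingType) (V : lmodType R) (n : nat) (b : 'I_n -> V).
Definition free_fam := forall c : 'I_n -> R,
  \sum_i c i *: b i = 0 -> forall i, c i = 0.
Definition spans_fam (S : set V) := forall x, S x ->
  exists c : 'I_n -> R, x = \sum_i c i *: b i.
End Families.

Lemma submodD (R : nzRingType) (V : lmodType R) (S : set V) : submodules S ->
  forall x y, S x -> S y -> S (x + y).
Proof. by case=> _ SZ x y Sx Sy; rewrite -[x]scale1r; apply: SZ. Qed.

Lemma submodZ (R : nzRingType) (V : lmodType R) (S : set V) : submodules S ->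
  forall r x, S x -> S (r *: x).
Proof. by case=> S0 SZ r x Sx; rewrite -[_ *: _]addr0; apply: SZ. Qed.

Lemma submodB (R : nzRingType) (V : lmodType R) (S : set V) : submodules S ->
  forall x y, S x -> S y -> S (x - y).
Proof.
by case=> S0 SZ x y Sx Sy; rewrite addrC -scaleN1r; apply: SZ.
Qed.

Lemma submod_sum (R : nzRingType) (V : lmodType R) (S : set V) : submodules S ->
  forall (I : Type) (r : seq I) (P : pred I) F, (forall i, P i -> S (F i)) ->
  S (\sum_(i <- r | P i) F i).
Proof.
move=> hS I r P F hF; elim/big_rec: _ => [|i x Pi Sx]; first by case: hS.
by apply: submodD => //; apply: hF.
Qed.

Section DVRModules.
Variables (R : idomainType) (p : nat) (pi : R).
Hypothesis hR : complete_dvr_mixed p pi.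

(** Over a discrete valuation ring, finitely many linear forms that separate
    the points of S make it finitely generated: the values of the last form are
    generated by one of them, and a vector taking that value complements the
    kernel of the form. *)
Lemma fg_of_functionals (V : lmodType R) (l : nat -> V -> R^o) m (S : set V) :
  (forall i, linear (l i)) -> submodules S ->
  (forall x, S x -> (forall i, (i < m)%N -> l i x = 0) -> x = 0) ->
  exists n (b : 'I_n -> V), (forall i, S (b i)) /\ spans_fam b S.
Proof.
move=> ll; elim: m S => [|m IH] S hS inj.
  exists 0%N, (fun=> 0); split=> [[]//|x Sx]; exists (fun=> 0).
  by rewrite big_ord0; apply: inj.
have l0 i : l i 0 = 0 := lin0 (ll i).
have [||n [b [Sb sb]]] := IH [set x | S x /\ l m x = 0].
- split=> [|r x y [Sx lx] [Sy ly]]; first by split; [case: hS|].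
  by split; [case: hS => _; apply|rewrite ll lx ly scaler0 addr0].
- move=> x [Sx lx] h; apply: inj => // i; rewrite ltnS leq_eqVlt.
  by case/orP => [/eqP -> //|]; apply: h.
have [[x0 [Sx0 lx0]]|none] := pselect (exists x, S x /\ l m x != 0); last first.
  exists n, b; split=> [i|x Sx]; first by case: (Sb i).
  apply: sb; split=> //; apply/eqP/negPn/negP => lx.
  by apply: none; exists x.
have [|_ [[x Sx <-] lx dx]] := dvr_min hR (P := [set l m x | x in S]).
  by exists (l m x0); split=> //; exists x0.
(* x is the vector whose value generates the values of the last form. *)
exists n.+1, (fun i => if unlift ord0 i is Some j then b j else x); split=> [i|y Sy].
  by case: unliftP => [j|] _ //; case: (Sb j).
have [|d dE] := dx (l m y); first by exists y.
have [|c cE] := sb (y - d *: x).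
  split; first by apply: submodB => //; apply: submodZ.
  by rewrite addrC -scaleNr ll dE scaleNr addNr.
exists (fun i => if unlift ord0 i is Some j then c j else d).
rewrite big_ord_recl unlift_none; under eq_bigr do rewrite liftK.
by rewrite -cE addrC subrK.
Qed.

(** A generating subfamily of least length is free: in a nontrivial relation
    all the coefficients are multiples of one of them, which can be cancelled,
    so that the vector at that place is redundant. *)
Lemma min_basis (V : lmodType R) (S : set V) n (b : 'I_n -> V) :
  (forall r (x : V), r *: x = 0 -> r = 0 \/ x = 0) -> spans_fam b S ->
  exists m (f : 'I_m -> 'I_n), spans_fam (b \o f) S /\ free_fam (b \o f).
Proof.
move=> tf; elim: n b => [|n IH] b sb.
  by exists 0%N, id; split=> // c _ [].
have [fb|] := pselect (free_fam b); first by exists n.+1, id.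
move=> /existsNP[c] /not_implyP[cE] /existsNP[i /eqP ci].
have [|_ [[i0 _ <-] c0 hd]] := dvr_min hR (P := [set c i | i in setT]).
  by exists (c i); split=> //; exists i.
have /choice[d dE] j : exists d, c j = d * c i0 by apply: hd; exists j.
have bE : \sum_j d j *: b j = 0.
  have [|ci0|//] := tf (c i0) (\sum_j d j *: b j).
    rewrite scaler_sumr -[RHS]cE; apply: eq_bigr => j _.
    by rewrite scalerA [in RHS]dE mulrC.
  by rewrite ci0 eqxx in c0.
have d1 : d i0 = 1 by apply: (mulIf c0); rewrite mul1r -dE.
have b0E : b i0 = - \sum_j d (lift i0 j) *: b (lift i0 j).
  apply/eqP; rewrite -addr_eq0; apply/eqP; rewrite -[RHS]bE.
  by rewrite (bigD1_ord i0) //= d1 scale1r.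
have [|m [f [sf ff]]] := IH (fun j => b (lift i0 j)); last first.
  by exists m, (fun j => lift i0 (f j)).
move=> x /sb[e ->]; exists (fun j => e (lift i0 j) - e i0 * d (lift i0 j)).
rewrite (bigD1_ord i0) //= b0E scalerN -scaleNr scaler_sumr -big_split /=.
by apply: eq_bigr => j _; rewrite scalerBl scalerA mulNr scaleNr addrC.
Qed.
End DVRModules.

(** Gram-Schmidt without division: over a domain a dual family exists only up
    to a common factor c. *)
Lemma dual_family (R : idomainType) (V : lmodType R) n (x : 'I_n -> V -> R^o) :
  (forall i, linear (x i)) ->
  (forall c : 'I_n -> R, (forall v, \sum_i c i * x i v = 0) ->
     forall i, c i = 0) ->
  exists2 c : R, c != 0 &
    exists f : 'I_n -> V, forall i j, x i (f j) = c *+ (i == j).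
Proof.
elim: n x => [|n IH] x xl xf.
  by exists 1; [exact: oner_neq0 | exists (fun=> 0) => [[]]].
have x0 i : x i 0 = 0 := lin0 (xl i).
have xZ i r v : x i (r *: v) = r * x i v := linZ (xl i) r v.
have xD i v w : x i (v + w) = x i v + x i w := linD (xl i) v w.
have xS i m (F : 'I_m -> V) : x i (\sum_j F j) = \sum_j x i (F j).
  by elim/big_rec2: _ => // j y z _ <-; rewrite xD.
have [|c c0 [f fE]] := IH (fun i => x (lift ord0 i)) (fun i => xl _).
  move=> c cE i; pose c' j := if unlift ord0 j is Some k then c k else 0.
  have := xf c' _ (lift ord0 i); rewrite {2}/c' liftK; apply=> v; rewrite /c'.
  rewrite big_ord_recl unlift_none mul0r add0r -[RHS](cE v).
  by apply: eq_bigr => j _; rewrite liftK.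
(* The form sum_i d i * x i vanishes on all the f k; as the x i are
   independent it does not vanish at some v, and subtracting from c v its
   components along the f k gives a vector g on which only x ord0 is nonzero. *)
pose d i := if unlift ord0 i is Some k then - x ord0 (f k) else c.
have [v dv] : exists v, \sum_i d i * x i v != 0.
  apply: contrapT => /forallNP dv0; have := xf d _ ord0.
  rewrite /d unlift_none => d0; move/eqP: c0; apply; apply: d0 => v.
  by apply/eqP/negPn/negP/dv0.
set e := \sum_i _ in dv.
have eE : e = c * x ord0 v - \sum_j x ord0 (f j) * x (lift ord0 j) v.
  rewrite /e big_ord_recl {1}/d unlift_none -sumrN; congr (_ + _).
  by apply: eq_bigr => j _; rewrite /d liftK mulNr.
pose g := c *: v - \sum_j x (lift ord0 j) v *: f j.
have gN i : x i (- \sum_j x (lift ord0 j) v *: f j) =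
    - \sum_j x (lift ord0 j) v * x i (f j).
  by rewrite -scaleN1r xZ mulN1r xS; congr (- _); apply: eq_bigr => j _.
have g0 : x ord0 g = e.
  by rewrite xD xZ gN eE; congr (_ - _); apply: eq_bigr => j _; rewrite mulrC.
have gi i : x (lift ord0 i) g = 0.
  rewrite xD xZ gN (bigD1 i) //= fE eqxx mulr1n big1 ?addr0.
    by rewrite mulrC subrr.
  by move=> j ji; rewrite fE eq_sym (negPf ji) mulr0n mulr0.
exists (c * e); first by rewrite mulf_neq0.
exists (fun j => if unlift ord0 j is Some k then e *: f k - x ord0 (f k) *: g
  else c *: g) => i j.
case: unliftP => [k|] ->; case: (unliftP ord0 i) => [h|] ->.
- rewrite -scaleNr xD !xZ gi mulr0 addr0 fE (inj_eq lift_inj) mulrnAr.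
  by rewrite mulrC.
- rewrite -scaleNr xD !xZ g0 mulNr mulrC subrr.
  by rewrite -(inj_eq val_inj).
- by rewrite xZ gi mulr0 eq_sym -(inj_eq val_inj).
- by rewrite xZ g0 eqxx.
Qed.

(** * Spans and bases *)

Lemma big_subseq_uniq (V : nmodType) (I : eqType) (s t : seq I) (F : I -> V) :
  uniq s -> uniq t -> {subset s <= t} -> (forall i, i \notin s -> F i = 0) ->
  \sum_(i <- s) F i = \sum_(i <- t) F i.
Proof.
move=> us ut st F0; rewrite [RHS](bigID (mem s)) /= [X in _ + X]big1 //.
rewrite addr0 -[RHS]big_filter; apply: perm_big; apply: uniq_perm => //.
  exact: filter_uniq.
move=> i; rewrite mem_filter; have [/= si|//] := boolP (i \in s).
by rewrite st.
Qed.

Section Span.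
Variables (R : nzRingType) (V : lmodType R).

Inductive lspan (S : set V) : V -> Prop :=
| lspan0 : lspan S 0
| lspanS r x y : S x -> lspan S y -> lspan S (r *: x + y).

Lemma lspan_gen (S : set V) x : S x -> lspan S x.
Proof. by move=> Sx; rewrite -[x]scale1r -[_ *: _]addr0; do !constructor. Qed.

Lemma lspan_submod (S : set V) : submodules (lspan S).
Proof.
split=> [|r x y]; first by constructor.
elim=> [|s x' y' Sx _ IH] Sy; first by rewrite scaler0 add0r.
by rewrite scalerDr scalerA -addrA; constructor=> //; apply: IH.
Qed.

Lemma lspan_min (S T : set V) : submodules T -> S `<=` T -> lspan S `<=` T.
Proof.
move=> [T0 TZ] ST x; elim=> // r x' y Sx _ Ty.
by apply: TZ => //; apply: ST.
Qed.

Lemma lspan_sub (S T : set V) : S `<=` T -> lspan S `<=` lspan T.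
Proof.
by move=> ST; apply: lspan_min => [|x /ST]; [apply: lspan_submod|apply: lspan_gen].
Qed.

(** The coefficients are defined on all of I and vanish off s, so that
    expansions with different supports can be compared. *)
Lemma lspan_expand (I : eqType) (f : I -> V) (P : set I) x :
  lspan (f @` P) x -> exists (s : seq I) (c : I -> R),
    [/\ uniq s, (forall i, i \notin s -> c i = 0), (forall i, i \in s -> P i)
      & x = \sum_(i <- s) c i *: f i].
Proof.
elim=> [|r _ y [i Pi <-] _ [s [c [us c0 sP ->]]]].
  by exists [::], (fun=> 0); split=> //; rewrite big_nil.
exists (undup (i :: s)), (fun j => c j + r *+ (j == i)); split.
- exact: undup_uniq.
- move=> j; rewrite mem_undup inE negb_or => /andP[/negPf -> js].
  by rewrite c0 // addr0.
- by move=> j; rewrite mem_undup inE => /orP[/eqP ->|/sP].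
under [RHS]eq_bigr do rewrite scalerDl.
rewrite big_split addrC; congr (_ + _).
  apply: big_subseq_uniq; rewrite ?undup_uniq // => j js.
    by rewrite mem_undup inE js orbT.
  by rewrite c0 ?scale0r.
rewrite (bigD1_seq i) ?undup_uniq ?mem_undup ?mem_head //= eqxx big1 ?addr0 //.
by move=> j /negPf ->; rewrite scale0r.
Qed.

Definition free_on (I : eqType) (f : I -> V) := forall (s : seq I) (c : I -> R),
  uniq s -> \sum_(i <- s) c i *: f i = 0 -> forall i, i \in s -> c i = 0.

Lemma free_on_unique (I : eqType) (f : I -> V) (s t : seq I) (c d : I -> R) :
  free_on f -> uniq s -> uniq t -> (forall i, i \notin s -> c i = 0) ->
  (forall i, i \notin t -> d i = 0) ->
  \sum_(i <- s) c i *: f i = \sum_(i <- t) d i *: f i -> c =1 d.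
Proof.
move=> ff us ut c0 d0 E i.
have [ii|] := boolP (i \in undup (s ++ t)); last first.
  by rewrite mem_undup mem_cat negb_or => /andP[/c0 -> /d0 ->].
apply/eqP; rewrite -subr_eq0; apply/eqP.
apply: (ff (undup (s ++ t)) (fun j => c j - d j)) => //.
  exact: undup_uniq.
under eq_bigr do rewrite scalerBl.
rewrite sumrB.
have <- : \sum_(j <- s) c j *: f j = \sum_(j <- undup (s ++ t)) c j *: f j.
  apply: big_subseq_uniq => //; rewrite ?undup_uniq // => j js.
    by rewrite mem_undup mem_cat js.
  by rewrite c0 ?scale0r.
have <- : \sum_(j <- t) d j *: f j = \sum_(j <- undup (s ++ t)) d j *: f j.
  apply: big_subseq_uniq => //; rewrite ?undup_uniq // => j js.
    by rewrite mem_undup mem_cat js orbT.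
  by rewrite d0 ?scale0r.
by rewrite E subrr.
Qed.
End Span.

(** The basis may be infinite: coordinates are read off a chosen finite
    expansion, and freeness makes the result independent of that choice. *)
Lemma basis_functional (R : comNzRingType) (V : lmodType R) (I : eqType)
    (f : I -> V) (w : I -> R) :
  (forall v, lspan (range f) v) -> free_on f ->
  exists phi : {linear V -> R^o}, forall i, phi (f i) = w i.
Proof.
move=> sf ff.
have /choice[s /choice[c sc]] v := lspan_expand (sf v).
pose phi v : R^o := \sum_(i <- s v) c v i * w i.
have phiE v t d : uniq t -> (forall i, i \notin t -> d i = 0) ->
    v = \sum_(i <- t) d i *: f i -> phi v = \sum_(i <- t) d i * w i.
  have [us c0 _ vE] := sc v; move=> ut d0 vE'.
  have cd : c v =1 d by apply: (free_on_unique ff us ut c0 d0); rewrite -vE.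
  rewrite /phi; under eq_bigr do rewrite cd.
  rewrite (@big_subseq_uniq _ _ _ (undup (s v ++ t))) ?undup_uniq //.
  - rewrite [RHS](@big_subseq_uniq _ _ _ (undup (s v ++ t))) ?undup_uniq //.
      by move=> j js; rewrite mem_undup mem_cat js orbT.
    by move=> j js; rewrite d0 ?mul0r.
  - by move=> j js; rewrite mem_undup mem_cat js.
  - by move=> j js; rewrite -cd c0 ?mul0r.
have phi_lin : linear phi.
  move=> r x y; have [ux cx _ xE] := sc x; have [uy cy _ yE] := sc y.
  set t := undup (s x ++ s y).
  have ut : uniq t by apply: undup_uniq.
  have xt : {subset s x <= t} by move=> j js; rewrite mem_undup mem_cat js.
  have yt : {subset s y <= t} by move=> j js; rewrite mem_undup mem_cat js orbT.
  rewrite (phiE _ t (fun i => r * c x i + c y i)) //.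
  - under eq_bigr do rewrite mulrDl -mulrA.
    rewrite big_split -mulr_sumr /=; congr (_ * _ + _); symmetry.
      by apply: big_subseq_uniq => // j js; rewrite cx ?mul0r.
    by apply: big_subseq_uniq => // j js; rewrite cy ?mul0r.
  - move=> i; rewrite mem_undup mem_cat negb_or => /andP[/cx -> /cy ->].
    by rewrite mulr0 addr0.
  - under eq_bigr do rewrite scalerDl -scalerA.
    rewrite big_split -scaler_sumr /= {1}xE {1}yE; congr (_ *: _ + _).
      by apply: big_subseq_uniq => // j js; rewrite cx ?scale0r.
    by apply: big_subseq_uniq => // j js; rewrite cy ?scale0r.
pose Phi : {linear V -> R^o} :=
  HB.pack phi (GRing.isLinear.Build _ _ _ _ phi phi_lin).
exists Phi => i; rewrite /Phi /=.
rewrite (phiE _ [:: i] (fun j => (j == i)%:R)) //.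
- by rewrite big_seq1 eqxx mul1r.
- by move=> j; rewrite inE => /negPf ->.
- by rewrite big_seq1 eqxx scale1r.
Qed.

(** * Words, straightening and monomials *)

Definition wprod (A : pzSemiRingType) (I : Type) (x : I -> A) (w : seq I) : A :=
  \prod_(i <- w) x i.

Lemma wprod_nil (A : pzSemiRingType) (I : Type) (x : I -> A) :
  wprod x [::] = 1.
Proof. by rewrite /wprod big_nil. Qed.

Lemma wprod_cons (A : pzSemiRingType) (I : Type) (x : I -> A) i w :
  wprod x (i :: w) = x i * wprod x w.
Proof. by rewrite /wprod big_cons. Qed.

Lemma wprod_cat (A : pzSemiRingType) (I : Type) (x : I -> A) u v :
  wprod x (u ++ v) = wprod x u * wprod x v.
Proof. by rewrite /wprod big_cat. Qed.

Lemma wprod_map (A : pzSemiRingType) (I J : Type) (x : I -> A) (f : J -> I) w :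
  wprod x (map f w) = wprod (x \o f) w.
Proof. by rewrite /wprod big_map. Qed.

Lemma rmorph_wprod (A B : pzSemiRingType) (f : {rmorphism A -> B}) (I : Type)
  (x : I -> A) w : f (wprod x w) = wprod (f \o x) w.
Proof. by rewrite /wprod rmorph_prod. Qed.

Section Straightening.
Variables (k : comNzRingType) (A : algType k) (I : eqType) (x : I -> A).
Hypothesis x_comm : forall i j, lspan (range x) (x i * x j - x j * x i).

Definition words (P : set (seq I)) : set A := lspan (wprod x @` P).
Local Notation short n := (words [set u | (size u < n)%N]).

Lemma words_submod P : submodules (words P). Proof. exact: lspan_submod. Qed.

Lemma words_sub P Q : P `<=` Q -> words P `<=` words Q.
Proof.
by move=> PQ; apply: lspan_sub => _ [w Pw <-]; exists w => //; apply: PQ.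
Qed.

Lemma words_gen (P : set (seq I)) w : P w -> words P (wprod x w).
Proof. by move=> Pw; apply: lspan_gen; exists w. Qed.

Lemma wordsM (P Q S : set (seq I)) :
  (forall u v, P u -> Q v -> S (u ++ v)) ->
  forall a b, words P a -> words Q b -> words S (a * b).
Proof.
move=> PQ a b Pa Qb; have [S0 SZ] := words_submod S.
have key u : P u -> words S (wprod x u * b).
  move=> Pu; elim: Qb => [|r _ z [v Qv <-] _ IH]; first by rewrite mulr0.
  rewrite mulrDr -scalerAr; apply: SZ => //.
  by rewrite -wprod_cat; apply: words_gen; apply: PQ.
elim: Pa => [|r _ y [u Pu <-] _ IH]; first by rewrite mul0r.
by rewrite mulrDl -scalerAl; apply: SZ => //; apply: key.
Qed.

Lemma shortMl n i a : short n a -> short n.+1 (x i * a).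
Proof.
move=> na; apply: (@wordsM [set [:: i]] [set u | (size u < n)%N]) => //.
  by move=> u v /= ->.
by rewrite -[x i]mulr1 -(wprod_nil x) -wprod_cons; apply: words_gen.
Qed.

(** Exchanging two neighbouring letters costs a commutator, which is a
    combination of single letters and so produces shorter words. *)
Lemma move_front u i v :
  short (size u + size v).+1 (wprod x (u ++ i :: v) - wprod x (i :: u ++ v)).
Proof.
elim: u => [|j u IH] /=; first by rewrite subrr; constructor.
have := shortMl j IH; rewrite mulrBr -!wprod_cons => h1.
have h2 : short (size u + size v).+2
    (wprod x [:: j, i & u ++ v] - wprod x [:: i, j & u ++ v]).
  rewrite !wprod_cons !mulrA -mulrBl.
  apply: (@wordsM [set w | (size w <= 1)%N] [set w | (size w <= size u + size v)%N]).
  - by move=> w w' /= h h'; rewrite size_cat ltnS -[_.+1]add1n leq_add.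
  - apply: lspan_sub (x_comm j i) => _ [l _ <-].
    by exists [:: l] => //; rewrite wprod_cons wprod_nil mulr1.
  - by apply: words_gen; rewrite /= size_cat.
rewrite addSn -[X in short _ X](subrKA (wprod x [:: j, i & u ++ v])).
exact: submodD (words_submod _) _ _ h1 h2.
Qed.

Lemma straighten w w' : perm_eq w w' ->
  short (size w) (wprod x w - wprod x w').
Proof.
elim: w w' => [|i w IH] w' pw.
  have -> : w' = [::] by apply/perm_nilP; rewrite perm_sym.
  by rewrite subrr; constructor.
have iw' : i \in w' by rewrite -(perm_mem pw) mem_head.
case: (splitPr iw') pw => u v pw.
have pw1 : perm_eq w (u ++ v).
  by rewrite -(perm_cons i) (perm_trans pw) // -cat1s perm_catCA.
have h1 := shortMl i (IH _ pw1); have h2 := move_front u i v.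
rewrite -size_cat -(perm_size pw1) in h2.
rewrite mulrBr -!wprod_cons in h1.
rewrite -[X in short _ X](subrKA (wprod x (i :: u ++ v))) -[X in _ + X]opprB.
exact: (submodB (words_submod _)) h1 h2.
Qed.

(** Replacing a word by the rearrangement nf of it changes it by shorter words,
    so that induction on the length applies. The choice of nf is free; sorting
    the letters gives the usual ordered monomials. *)
Lemma normal_words (nf : seq I -> seq I) n :
  (forall w, perm_eq w (nf w)) ->
  forall a, short n a -> words (nf @` [set w | (size w < n)%N]) a.
Proof.
move=> hnf; elim: n => [|n IH]; first by apply: words_sub => w.
apply: lspan_min => [|_ [w /= wn <-]]; first exact: words_submod.
rewrite -[wprod x w](subrK (wprod x (nf w))); apply: (submodD (words_submod _)).
  have h : short n (wprod x w - wprod x (nf w)).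
    apply: words_sub (straighten (hnf w)) => u /= uw.
    exact: leq_trans uw _.
  apply: words_sub (IH _ h) => _ [u un <-]; exists u => //=.
  exact: ltnW.
by apply: words_gen; exists w.
Qed.

End Straightening.

Section Monomials.
Variable n : nat.
Implicit Types a b : {ffun 'I_n -> nat}.

Definition mdeg a := (\sum_i a i)%N.
(** The nondecreasing word in which the letter i occurs a i times; mcont is the
    inverse operation on words up to rearrangement. *)
Definition mword a : seq 'I_n := flatten [seq nseq (a i) i | i <- enum 'I_n].
Definition mcont (w : seq 'I_n) : {ffun 'I_n -> nat} := [ffun i => count_mem i w].
Definition madd a b : {ffun 'I_n -> nat} := [ffun i => (a i + b i)%N].
Definition mzero : {ffun 'I_n -> nat} := [ffun => 0%N].

Lemma perm_count (T : eqType) (u v : seq T) :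
  perm_eq u v <-> forall i, count_mem i u = count_mem i v.
Proof.
split=> [/permP h i|h]; first exact: h.
by apply/allP => i _; apply/eqP.
Qed.

Lemma count_mword a i : count_mem i (mword a) = a i.
Proof.
rewrite /mword count_flatten -map_comp sumnE big_map big_enum /=.
rewrite (bigD1 i) //= count_nseq /= eqxx mul1n big1 ?addn0 // => j ji.
by rewrite count_nseq /= (negPf ji).
Qed.

Lemma mcontK w : perm_eq w (mword (mcont w)).
Proof. by apply/perm_count => i; rewrite count_mword ffunE. Qed.

Lemma size_mword a : size (mword a) = mdeg a.
Proof.
rewrite /mword size_flatten /shape -map_comp sumnE big_map big_enum /=.
by apply: eq_bigr => i _; rewrite size_nseq.
Qed.

Lemma mwordD a b : perm_eq (mword a ++ mword b) (mword (madd a b)).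
Proof.
by apply/perm_count => i; rewrite count_cat !count_mword ffunE.
Qed.

Lemma mdegD a b : mdeg (madd a b) = (mdeg a + mdeg b)%N.
Proof. by rewrite -!size_mword -(perm_size (mwordD a b)) size_cat. Qed.

Lemma mword0 : mword mzero = [::].
Proof.
apply/nilP; rewrite /nilp size_mword /mdeg big1 // => i _.
by rewrite ffunE.
Qed.

End Monomials.

Definition mon (A : pzSemiRingType) n (x : 'I_n -> A) a : A := wprod x (mword a).

(** * Tangent vectors as derivations of the coordinate ring *)

Section Hopf.
Variables (R : comNzRingType) (G : hopfAlg R).

Lemma linear_scaler (V : lmodType R) (f : G -> R^o) (v : V) : linear f ->
  linear (fun a => (f a : R) *: v).
Proof. by move=> hf r a b; rewrite hf scalerDl scalerA. Qed.

Lemma comul_bilin (V : lmodType R) (b : G -> G -> V) : bilin b ->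
  linear (fun a => \sum_(u <- comul a) b u.1 u.2).
Proof.
move=> hb r x y /=; rewrite (comul_linear r x y hb) big_cat big_map /=.
rewrite scaler_sumr; congr (_ + _); apply: eq_bigr => u _.
by have [hl _] := hb; rewrite (linZ (hl u.2)).
Qed.

Lemma bilin_scale (f : G -> R^o) (V : lmodType R) (l : G -> V) :
  linear f -> linear l -> bilin (fun u v : G => (f u : R) *: l v).
Proof.
move=> hf hl; split=> [v|u] r a b /=; first exact: linear_scaler.
by rewrite hl scalerDr !scalerA mulrC.
Qed.

Variable g : lieOf G.
Implicit Types (x y : g) (a b : G).

Lemma ev_lin x : linear (lie_ev x). Proof. exact: linearP. Qed.

Lemma ev_linE x r a b :
  (lie_ev x (r *: a + b) : R) = r * lie_ev x a + lie_ev x b.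
Proof. exact: linearP. Qed.

Lemma evZ x r a : (lie_ev x (r *: a) : R) = r * lie_ev x a.
Proof. by have := ev_linE x r a 0; rewrite raddf0 !addr0. Qed.

Lemma lie_ev_lin a : linear (fun x => lie_ev x a : R^o).
Proof. by move=> r x y; rewrite lie_ev_linear. Qed.

Lemma lie_ev0 a : (lie_ev (0 : g) a : R) = 0.
Proof. exact: lin0 (lie_ev_lin a). Qed.

Lemma lie_evZ r x a : (lie_ev (r *: x) a : R) = r * lie_ev x a.
Proof. exact: linZ (lie_ev_lin a) r x. Qed.

Lemma lie_evD x y a : (lie_ev (x + y) a : R) = lie_ev x a + lie_ev y a.
Proof. exact: linD (lie_ev_lin a) x y. Qed.

(** The left-invariant derivation of the coordinate ring whose value at the
    unit is the tangent vector x. *)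
Definition act x a : G := \sum_(u <- comul a) (lie_ev x u.2 : R) *: u.1.

Lemma bilin_act x : bilin (fun u v : G => (lie_ev x v : R) *: u).
Proof.
split=> [v|u] r a b /=; last exact: (linear_scaler _ (ev_lin x)).
by rewrite scalerDr !scalerA mulrC.
Qed.

Lemma act_lin x : linear (act x).
Proof. exact: comul_bilin (bilin_act x). Qed.

HB.instance Definition _ x := GRing.isLinear.Build R G G *:%R (act x) (act_lin x).

Lemma act_der x a b : act x (a * b) = act x a * b + a * act x b.
Proof.
rewrite /act (comulM a b (bilin_act x)) big_allpairs_dep /=.
have E (u v : G * G) : (lie_ev x (u.2 * v.2) : R) *: (u.1 * v.1) =
    (lie_ev x u.2 : R) *: u.1 * ((counit v.2 : R) *: v.1) +
    ((counit u.2 : R) *: u.1) * ((lie_ev x v.2 : R) *: v.1).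
  by rewrite lie_ev_der scalerDl addrC -!scalerAl -!scalerAr !scalerA.
rewrite (eq_bigr _ (fun u _ => eq_bigr _ (fun v _ => E u v))).
rewrite -{2}[b]counitr -{3}[a]counitr !big_distrlr -big_split /=.
by apply: eq_bigr => u _; rewrite -big_split.
Qed.

Lemma act_eps x a : counit (act x a) = lie_ev x a.
Proof.
rewrite -{2}[a]counitl /act !raddf_sum /=; apply: eq_bigr => u _.
by rewrite !linearZ; apply: mulrC.
Qed.

Lemma actD x y a : act (x + y) a = act x a + act y a.
Proof.
rewrite /act -big_split; apply: eq_bigr => u _ /=.
by rewrite -scalerDl lie_evD.
Qed.

Lemma actZ r x a : act (r *: x) a = r *: act x a.
Proof.
by rewrite /act scaler_sumr; apply: eq_bigr => u _; rewrite scalerA lie_evZ.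
Qed.

Lemma act_comm x y a : act x (act y a) - act y (act x a) = act (lbr x y) a.
Proof.
have E (z t : g) : act z (act t a) = \sum_(u <- comul a) \sum_(v <- comul u.2)
    ((lie_ev z v.1 : R) * lie_ev t v.2) *: u.1.
  rewrite -(@comulA _ G _ (fun p q r => ((lie_ev z q : R) * lie_ev t r) *: p)).
    rewrite {2}/act raddf_sum; apply: eq_bigr => u _ /=.
    rewrite linearZ /= /act scaler_sumr; apply: eq_bigr => v _.
    by rewrite scalerA mulrC.
  split=> [q r|p r|p q] c d e /=.
  - by rewrite scalerDr !scalerA mulrC.
  - by rewrite ev_linE mulrDl scalerDl !scalerA mulrA.
  - by rewrite ev_linE mulrDr scalerDl !scalerA mulrCA.
rewrite !E -sumrB; apply: eq_bigr => u _; rewrite -sumrB.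
rewrite lie_ev_lbr scaler_suml; apply: eq_bigr => v _.
by rewrite -scalerBl; congr (_ *: _); rewrite mulrC [in X in _ - X]mulrC.
Qed.

End Hopf.

Section Weights.
Variables (R : comNzRingType) (G : hopfAlg R) (g : lieOf G).
Implicit Types (x y : g) (a b : G).

Lemma ev_one x : lie_ev x 1 = 0.
Proof.
have := lie_ev_der x 1 1; rewrite mulr1 rmorph1 mul1r mulr1.
by move/(congr1 (+%R (- lie_ev x 1))); rewrite addNr addKr.
Qed.

Lemma counit_antipode a : counit (antipode a) = counit a.
Proof.
have /(congr1 (@counit R G)) := antipodel a.
rewrite raddf_sum linearZ rmorph1 /= => /esym; rewrite -[LHS]/(counit a * 1) mulr1.
move=> ->; rewrite -{1}[a]counitr !raddf_sum; apply: eq_bigr => u _ /=.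
by rewrite rmorphM !linearZ; apply: mulrC.
Qed.

Lemma ev_antipode x a : lie_ev x (antipode a) = - lie_ev x a.
Proof.
have e1 : \sum_(u <- comul a) (counit u.1 : R) * lie_ev x u.2 = lie_ev x a.
  rewrite -[in RHS](counitl a) raddf_sum /=; apply: eq_bigr => u _.
  by rewrite evZ.
have e2 : \sum_(u <- comul a) (lie_ev x (antipode u.1) : R) * counit u.2 =
    lie_ev x (antipode a).
  rewrite -[in RHS](counitr a) !raddf_sum; apply: eq_bigr => u _ /=.
  have -> : antipode ((counit u.2 : R) *: u.1) = (counit u.2 : R) *: antipode u.1.
    by rewrite linearZ.
  by rewrite evZ mulrC.
have := congr1 (lie_ev x : G -> R) (antipodel a).
rewrite raddf_sum /= evZ ev_one mulr0.
under eq_bigr do rewrite lie_ev_der counit_antipode.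
by rewrite big_split /= e1 e2 addrC => /eqP; rewrite addr_eq0 => /eqP.
Qed.

Variables (T : closedSubgroup G) (sp : splitting T) (h : lieOf T).
Variable hin : h -> g.
Hypothesis hinP : is_differential hin.

(** The derivative in the direction of H of the statement that the torus acts
    on a weight vector through a character. It uses that a tangent vector
    changes sign under the antipode. *)
Lemma weight_bracket (H : h) m x : @has_weight _ _ _ sp g m x ->
  lbr (hin H) x = (lie_ev H (sp_chr m) : R) *: x.
Proof.
move=> wx; apply: lie_ev_inj => a.
have -> : lie_ev ((lie_ev H (sp_chr m) : R) *: x) a =
    lie_ev H ((lie_ev x a : R) *: sp_chr m).
  by rewrite lie_evZ evZ mulrC.
rewrite -wx raddf_sum lie_ev_lbr sumrB /=.
set D := hin H.
have E u v : lie_ev H ((lie_ev x v.1 : R) *: cs_res T (u * antipode v.2)) =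
    (lie_ev D u : R) * ((counit v.2 : R) * lie_ev x v.1)
    - (counit u : R) * ((lie_ev x v.1 : R) * lie_ev D v.2) :> R.
  rewrite evZ -hinP lie_ev_der ev_antipode counit_antipode.
  rewrite mulrDr mulrN mulrN addrC; congr (_ - _).
    by rewrite mulrCA; congr (_ * _); rewrite mulrC.
  by rewrite mulrCA.
pose Q c : R^o := \sum_(v <- comul c) (lie_ev x v.1 : R) * lie_ev D v.2.
have Qlin : linear Q.
  exact (@comul_bilin R G R^o _
    (@bilin_scale R G (lie_ev x) R^o (lie_ev D) (ev_lin x) (ev_lin D))).
have Q0 : Q 0 = 0 := lin0 Qlin.
have QS (s : seq (G * G)) : Q (\sum_(u <- s) (counit u.1 : R) *: u.2) =
    \sum_(u <- s) (counit u.1 : R) * Q u.2.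
  elim: s => [|u s IH]; first by rewrite !big_nil.
  by rewrite !big_cons Qlin IH.
have -> : \sum_(u <- comul a) (lie_ev x u.1 : R) * lie_ev D u.2 = Q a by [].
rewrite -[in Q a](counitl a) QS -sumrB; apply: eq_bigr => u _.
rewrite raddf_sum /=; under eq_bigr do rewrite E.
rewrite sumrB -!mulr_sumr; congr (_ * _ - _).
by rewrite -{1}[u.2]counitr raddf_sum /=; apply: eq_bigr => v _; rewrite evZ.
Qed.
End Weights.

(** * Independence of ordered monomials in an enveloping algebra *)

Section PBW.
Variables (R : idomainType) (G : hopfAlg R) (g : lieOf G).
Hypothesis char0 : forall n : nat, (0 < n)%N -> n%:R != 0 :> R.

Fact G1_neq0 : (1 : G) <> 0. Proof. exact/eqP/oner_neq0. Qed.
Local Notation E := (endo G1_neq0).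

Definition rho (x : g) : E := mk_endo G1_neq0 (act_lin x).

Fact rho_lin : linear rho.
Proof.
move=> r x y; apply: endo_ext => a.
by rewrite endoD endoZ /rho !mk_endoE actD actZ.
Qed.
HB.instance Definition _ := GRing.isLinear.Build R g E *:%R rho rho_lin.

Fact rho_lie : is_lie_map rho.
Proof.
move=> x y; apply: endo_ext => a.
by rewrite endoD endoN !endo_mulE /rho !mk_endoE act_comm.
Qed.

Variables (I : eqType) (x : I -> g).

Definition actw (w : seq I) (a : G) : G := foldr (fun i => act (x i)) a w.

Lemma wprod_rho w a : endo_fun (wprod (rho \o x) w) a = actw w a.
Proof.
elim: w => [|i w IH] /=; first by rewrite wprod_nil endo_1E.
by rewrite wprod_cons endo_mulE IH.
Qed.

Lemma actw_lin w : linear (actw w).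
Proof. by elim: w => // i w IH r a b; rewrite /= IH act_lin. Qed.

Lemma actw_rcons w i a : actw (rcons w i) a = actw w (act (x i) a).
Proof. by rewrite /actw foldr_rcons. Qed.

(** The functions that vanish to order n at the unit, as tested by the
    differential operators that are products of fewer than n of the
    derivations. *)
Definition vanishing n : set G := [set a |
  forall w, (size w < n)%N -> counit (actw w a) = 0].

Lemma vanishing_submod n : submodules (vanishing n).
Proof.
have c0 w : actw w 0 = 0 := lin0 (actw_lin w).
split=> [w _|r a b va vb w wn]; first by rewrite c0 raddf0.
by rewrite actw_lin linearP /= va // vb // scaler0 addr0.
Qed.

Lemma vanishing1 a : counit a = 0 -> vanishing 1 a.
Proof. by move=> a0 [|j w]. Qed.

Lemma vanishing_act n i a : vanishing n a -> vanishing n.-1 (act (x i) a).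
Proof.
case: n => [|n] va w wn //; rewrite -actw_rcons; apply: va.
by rewrite size_rcons.
Qed.

Lemma vanishingM m n a b :
  vanishing m a -> vanishing n b -> vanishing (m + n) (a * b).
Proof.
move=> va vb w; elim/last_ind: w m n a b va vb => [|w i IH] m n a b va vb wn.
  rewrite /= rmorphM /=; case: m va wn => [|m] va wn.
    by have := vb [::] wn => /= ->; rewrite mulr0.
  by have := va [::] isT => /= ->; rewrite mul0r.
rewrite actw_rcons act_der.
rewrite (linD (actw_lin w)) size_rcons in wn *; rewrite raddfD /=.
rewrite (IH m.-1 n) ?(IH m n.-1) ?addr0 //; try exact: vanishing_act.
  by case: n {vb} wn => [|n]; rewrite ?addn0 ?addnS //; apply: ltnW.
by case: m {va} wn => [|m]; rewrite ?add0n ?addSn //; apply: ltnW.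
Qed.

Variables (c : R) (f : I -> G).
Hypothesis c_neq0 : c != 0.
Hypothesis f_eps : forall i, counit (f i) = 0.
Hypothesis f_dual : forall i j, lie_ev (x i) (f j) = c *+ (i == j).

Lemma vanishing_f w : vanishing (size w) (wprod f w).
Proof.
elim: w => [|i w IH] //=; rewrite wprod_cons -add1n; apply: vanishingM => //.
exact: vanishing1.
Qed.

(** To leading order x i acts on the monomials in the coordinates f as c times
    a partial derivative. *)
Lemma act_fmon i w : vanishing (size w)
  (act (x i) (wprod f w) - (c *+ count_mem i w) *: wprod f (rem i w)).
Proof.
elim: w => [|j w IH] //=.
rewrite !wprod_cons act_der.
have -> : (c *+ ((j == i) + count_mem i w)) *:
    wprod f (if j == i then w else j :: rem i w) =
    (c *+ (i == j)) *: wprod f w +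
    f j * ((c *+ count_mem i w) *: wprod f (rem i w)).
  rewrite -scalerAr eq_sym; have [<-|ij] := eqVneq; last first.
    by rewrite wprod_cons mulr0n scale0r add0r add0n.
  rewrite mulrnDr scalerDl; congr (_ + _).
  have [iw|iw] := boolP (i \in w).
    by rewrite -wprod_cons /wprod -(perm_big _ (perm_to_rem iw)).
  by rewrite (count_memPn iw) mulr0n !scale0r.
rewrite opprD addrACA -mulrBr.
apply: (submodD (vanishing_submod _)); last first.
  by rewrite -add1n; apply: vanishingM => //; apply: vanishing1.
rewrite -[(c *+ _) *: _]mul1r -scalerCA.
rewrite -mulrBl -add1n; apply: vanishingM; last exact: vanishing_f.
apply: vanishing1; rewrite raddfB /= act_eps f_dual linearZ rmorph1.
by apply/eqP; rewrite subr_eq0; apply/eqP; symmetry; apply: mulr1.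
Qed.

(** A product of m derivations lowers the order of vanishing by at most m. *)
Lemma pairing_lt w v : (size w < size v)%N ->
  counit (actw w (wprod f v)) = 0.
Proof. by apply: vanishing_f. Qed.

(** Each derivation in w removes the matching coordinate from the monomial v,
    with a factor c times a multiplicity; in characteristic 0 this factor is
    nonzero. *)
Lemma pairing_eq w v : size w = size v ->
  (counit (actw w (wprod f v)) != 0) = perm_eq w v.
Proof.
elim/last_ind: w v => [|w i IH] v.
  by case: v => // _; rewrite /= wprod_nil rmorph1 oner_eq0.
rewrite size_rcons actw_rcons => wv.
rewrite -(subrK ((c *+ count_mem i v) *: wprod f (rem i v)) (act _ _)).
rewrite (linD (actw_lin w)) raddfD /= act_fmon -?wv // add0r.
rewrite (linZ (actw_lin w)) linearZ -[X in X != 0]/(_ * _) mulf_eq0 negb_or.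
rewrite (perm_rcons i w) perm_sym.
have [iv|iv] := boolP (i \in v); last first.
  rewrite (count_memPn iv) mulr0n eqxx /=; symmetry; apply: contraNF iv => h.
  by rewrite (perm_mem h) mem_head.
have -> : c *+ count_mem i v != 0.
  rewrite -mulr_natr mulf_neq0 // char0 // -has_count.
  by apply/hasP; exists i => /=.
rewrite (permPl (perm_to_rem iv)) perm_cons perm_sym; apply: IH.
by rewrite size_rem // -wv.
Qed.

(** The independence part of the Poincare-Birkhoff-Witt theorem for the Lie
    algebra of a group scheme, by letting the enveloping algebra act on the
    coordinate ring by differential operators. A relation between words that
    are not rearrangements of one another is applied to the monomials in the
    dual coordinates and evaluated at the unit: starting from the longest
    words, one coefficient after the other is seen to vanish. *)
Lemma pbw_free (U : envAlg g) (T : eqType) (W : T -> seq I) :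
  (forall a b, perm_eq (W a) (W b) -> a = b) ->
  free_on (fun a => wprod (env_in U \o x) (W a)).
Proof.
move=> Winj s d us ds0.
pose rl : {linear g -> E} := rho.
have [F [hF _]] := env_univ U (rho_lie : is_lie_map rl).
have ev v : \sum_(a <- s) d a * counit (actw (W a) (wprod f v)) = 0.
  transitivity (counit (endo_fun (F 0) (wprod f v))); last first.
    by rewrite raddf0 raddf0.
  rewrite -ds0; elim: s {us ds0} => [|a s IH]; first by rewrite !big_nil !raddf0.
  rewrite !big_cons raddfD endoD raddfD /= -IH; congr (_ + _).
  rewrite linearZ endoZ linearZ; congr (_ * counit _).
  rewrite rmorph_wprod -wprod_rho; congr (endo_fun _ _).
  by apply: eq_bigr => i _; apply: esym (hF _).
(* Descending induction on the length of W a, in the form of an induction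
   on k with B < size (W a) + k. *)
pose B := \max_(a <- s) size (W a).
have key k a : a \in s -> (B < size (W a) + k)%N -> d a = 0.
  elim: k a => [|k IH] a sa Bk.
    by move: Bk; rewrite addn0 ltnNge (@leq_bigmax_seq _ s xpredT (size \o W) a).
  have := ev (W a); rewrite (bigD1_seq a) //= [X in _ + X]big_seq_cond big1.
    move/eqP; rewrite addr0 mulf_eq0 => /orP[/eqP //|/negPn].
    by rewrite pairing_eq // perm_refl.
  move=> b /andP[sb ba]; have [lt|gt|E] := ltngtP (size (W b)) (size (W a)).
  - by rewrite pairing_lt // mulr0.
  - by rewrite IH ?mul0r // (leq_trans Bk) // addnS -addSn leq_add2r.
  - have h : ~~ perm_eq (W b) (W a) by apply: contra ba => /Winj ->.
    have /eqP -> : counit (actw (W b) (wprod f (W a))) == 0.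
      by rewrite -[_ == 0]negbK (pairing_eq E).
    by rewrite mulr0.
by move=> a sa; apply: (key B.+1) => //; rewrite addnS ltnS leq_addl.
Qed.
End PBW.

(** * Bases adapted to the triangular decomposition *)

(** As the characters form a basis of the coordinate ring of T, phi extends to
    a linear form; it is a derivation at the unit because phi is additive and
    characters take the value 1 there. *)
Lemma torus_vector (R : comNzRingType) (T : hopfAlg R) (sp : splitting T)
    (h : lieOf T) (phi : 'rV[int]_(sp_rank sp) -> R) :
  {morph phi : m n / m + n} -> exists H : h, forall m, lie_ev H (sp_chr m) = phi m.
Proof.
move=> phiD; pose chr : _ -> T := @sp_chr R T sp.
have sf (v : T) : lspan (range chr) v.
  have [ms [c ->]] := sp_span sp v.
  apply: (submod_sum (lspan_submod _)) => m _.
  by apply: (submodZ (lspan_submod _)); apply: lspan_gen; exists m.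
have ff : free_on chr by move=> ms c; apply: sp_free.
have [D DE] := basis_functional phi sf ff.
have eps m : (counit (chr m) : R) = 1.
  have lb : bilin (fun u v : T => (counit u : R) *: v).
    split=> [v|u] r a b /=; last by rewrite scalerDr !scalerA mulrC.
    by rewrite linearP scalerDl -scalerA.
  have := counitl (chr m); rewrite (sp_chr_comul m lb) big_seq1 /= => E.
  have := @ff [:: m] (fun=> (counit (chr m) : R) - 1) isT.
  rewrite big_seq1 scalerBl E scale1r subrr => /(_ erefl m (mem_head _ _)) /eqP.
  by rewrite subr_eq0 => /eqP.
have Dder : counit_derivation D.
  have DZ r a : (D (r *: a) : R) = r * D a by rewrite linearZ.
  have DD a b : (D (a + b) : R) = D a + D b by rewrite raddfD.
  have eZ r a : (counit (r *: a) : R) = r * counit a by rewrite linearZ.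
  have eD a b : (counit (a + b : T) : R) = counit a + counit b by rewrite raddfD.
  move=> a b; elim: (sf a) => [|r _ a' [m _ <-] _ IHa].
    by rewrite mul0r !raddf0 !mul0r addr0.
  rewrite mulrDl -scalerAl DD !DZ IHa eD eZ DD DZ.
  rewrite -[r * D (chr m * b)](_ :
    r * ((counit (chr m) : R) * D b + D (chr m) * (counit b : R)) = _).
    by rewrite mulrDr !mulrDl !mulrA addrACA.
  congr (_ * _); elim: (sf b) => [|s _ b' [n _ <-] _ IHb].
    by rewrite mulr0 !raddf0 !mulr0 addr0.
  rewrite mulrDr -scalerAr !DD !DZ eD eZ -IHb eps eps -sp_chrD !DE phiD.
  by rewrite !mul1r mulr1 !mulrDr [phi m * s]mulrC addrACA [s * phi n + _]addrC.
have [H HE] := lie_ev_surj h Dder.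
by exists H => m; rewrite HE DE.
Qed.

Lemma differential_inj (R : comNzRingType) (G : hopfAlg R)
    (H : closedSubgroup G) (h : lieOf H) (g : lieOf G) (f : h -> g) :
  is_differential f -> injective f.
Proof.
move=> hf x y fxy; apply: lie_ev_inj => b.
by have [a <-] := cs_res_surj b; rewrite -!hf fxy.
Qed.

(** A derivation is determined by its values on algebra generators. With
    fg_of_functionals this makes every submodule of the Lie algebra finitely
    generated. *)
Lemma finite_type_functionals (R : comNzRingType) (G : hopfAlg R)
    (g : lieOf G) : finite_type G ->
  exists (m : nat) (a : nat -> G), forall x : g,
    (forall i, (i < m)%N -> lie_ev x (a i) = 0) -> x = 0.
Proof.
move=> [s gen]; exists (size s), (nth 0 s) => x x0.
apply: lie_ev_inj => a; rewrite lie_ev0.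
apply: (gen [set a | lie_ev x a = 0]) => //=.
- by move=> b /(nthP 0) [i si <-]; apply: x0.
- exact: ev_one.
- by move=> r b c hb hc; rewrite ev_linE hb hc mulr0 addr0.
- by move=> b c hb hc; rewrite lie_ev_der hb hc mulr0 mul0r addr0.
Qed.

Lemma lie_torsion_free (R : idomainType) (G : hopfAlg R) (g : lieOf G)
  (r : R) (x : g) : r *: x = 0 -> r = 0 \/ x = 0.
Proof.
move=> rx; have [->|r0] := eqVneq r 0; [by left | right].
apply: lie_ev_inj => a; apply: (mulfI r0).
by rewrite -lie_evZ rx !lie_ev0 mulr0.
Qed.

Lemma chr_pairD (r : nat) (c m n : 'rV[int]_r) :
  chr_pair (m + n) c = chr_pair m c + chr_pair n c.
Proof.
rewrite /chr_pair -big_split; apply: eq_bigr => i _.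
by rewrite mxE mulrDl.
Qed.

Section TriangularBasis.
Variables (R : idomainType) (p : nat) (pi : R).
Hypothesis hR : complete_dvr_mixed p pi.
Variables (G : hopfAlg R) (D : triangular G).
Local Notation g := (tr_g D).
Local Notation nm := (@tr_nm R G D).

Lemma nilradical_submod (T : closedSubgroup G) (sp : splitting T) (B : set g) :
  submodules B -> submodules (nilradical sp B).
Proof.
move=> hB; split=> [|r _ _ [n [v [hv ->]]] [m [w [hw ->]]]].
  by exists 0%N, (fun=> 0); rewrite big_ord0; split=> // [[]].
exists (n + m)%N, (fun i =>
  match fintype.split i with inl j => r *: v j | inr j => w j end).
split=> [i|]; last first.
  rewrite big_split_ord scaler_sumr; congr (_ + _); apply: eq_bigr => i _ /=.
    by rewrite (unsplitK (inl i : 'I_n + 'I_m)).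
  by rewrite (unsplitK (inr i : 'I_n + 'I_m)).
case: fintype.split => // j; have [Bv [k k0 wk]] := hv j; split.
  exact: submodZ.
exists k => // a.
rewrite lie_evZ -scalerA -wk scaler_sumr; apply: eq_bigr => u _.
by rewrite scaler_sumr; apply: eq_bigr => t _; rewrite scalerA lie_evZ.
Qed.

Lemma range_submod (M N : lmodType R) (f : {linear M -> N}) :
  submodules (range f).
Proof.
split=> [|r _ _ [x _ <-] [y _ <-]]; first by exists 0; rewrite ?raddf0.
by exists (r *: x + y) => //; rewrite linearP.
Qed.

Lemma nm_submod : submodules nm.
Proof. exact: nilradical_submod (range_submod _). Qed.

(** H is the derivative of the cocharacter tr_mu defining the positive roots,
    so it acts on a weight space by the pairing of the weight with tr_mu. *)
Lemma grading_vector : exists2 H : tr_bp D,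
  (exists t, tr_bp_in D H = tr_h_in D t) &
  forall m (x : g), @has_weight _ _ _ (tr_split D) _ m x ->
    lbr (tr_bp_in D H) x = (chr_pair m (tr_mu D))%:~R *: x.
Proof.
have [|H0 H0E] := @torus_vector R _ (tr_split D) (tr_h D)
  (fun m => (chr_pair m (tr_mu D))%:~R).
  by move=> m n; rewrite chr_pairD rmorphD.
have [H _ HE] : range (tr_bp_in D) (tr_h_in D H0).
  rewrite tr_bp_sum; exists H0, 0; rewrite addr0; split=> //.
  by case: (nilradical_submod (tr_split D) (range_submod (tr_bp_in D))).
exists H; first by exists H0.
move=> m x wx; rewrite HE (weight_bracket (@tr_h_inP _ _ D) _ wx).
by rewrite H0E.
Qed.

Lemma lie_lbrZ (L : lieAlg R) (r : R) (x y : L) : lbr x (r *: y) = r *: lbr x y.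
Proof.
by have [_ lr] := @lbr_bilin _ L; apply: linZ (lr x) r y.
Qed.

Lemma lie_fg (S : set g) : finite_type G -> submodules S ->
  exists n (b : 'I_n -> g), (forall i, S (b i)) /\ spans_fam b S.
Proof.
move=> ftG hS; have [m [a ha]] := finite_type_functionals g ftG.
apply: (fg_of_functionals hR (l := fun i x => lie_ev x (a i)) (m := m)) => //.
  by move=> i r x y; rewrite lie_ev_linear.
by move=> x _; apply: ha.
Qed.

(** Weight vectors generate the nilradical, and finitely many suffice; a
    minimal subfamily is a basis. Since the roots of the opposite Borel
    subgroup are negative on tr_mu, H acts on these vectors with negative
    integral eigenvalues. *)
Lemma negative_basis (H : tr_bp D) : finite_type G ->
  (forall m (x : g), @has_weight _ _ _ (tr_split D) _ m x ->
    lbr (tr_bp_in D H) x = (chr_pair m (tr_mu D))%:~R *: x) ->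
  exists s (y : 'I_s -> g) (ht : 'I_s -> nat),
    [/\ forall i, nm (y i), spans_fam y nm, free_fam y, forall i, (0 < ht i)%N
      & forall i, lbr (tr_bp_in D H) (y i) = - (ht i)%:R *: y i].
Proof.
move=> ftG HE.
(* Homogeneous elements: eigenvectors of H of positive height. *)
pose hom (x : g) := nm x /\
  exists2 e, (0 < e)%N & lbr (tr_bp_in D H) x = - e%:R *: x.
have homP m (x : g) : range (tr_bm_in D) x -> m <> 0 ->
    @has_weight _ _ _ (tr_split D) _ m x -> hom x.
  move=> Bx m0 wx; split.
    exists 1%N, (fun=> x); rewrite big_ord1; split=> // _.
    by split=> //; exists m.
  have [->|/eqP x0] := eqVneq x 0.
    exists 1%N => //; have := lie_lbrZ 0 (tr_bp_in D H) 0.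
    by rewrite !scale0r scaler0.
  have rB : root_in (tr_split D) (range (tr_bm_in D)) m by split=> //; exists x.
  have rT : root_in (tr_split D) [set: g] m by split=> //; exists x.
  have [_ [/(_ rB) + _]] := tr_pos rT; rewrite (HE _ _ wx).
  case: (chr_pair _ _) => // e _; exists e.+1 => //.
have [n [b [nmb sb]]] := lie_fg ftG nm_submod.
have /choice[kv kvP] i : exists kv : {k & 'I_k -> g},
    (forall j, hom (tagged kv j)) /\ b i = \sum_j tagged kv j.
  have [k [v [hv bE]]] := nmb i; exists (Tagged _ v); split=> // j.
  by have [Bv [m m0 wm]] := hv j; apply: homP wm.
pose T := {i : 'I_n & 'I_(tag (kv i))}.
pose w (t : T) := tagged (kv (tag t)) (tagged t).
have hw t : hom (w t) by case: (kvP (tag t)) => + _; apply.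
have sw : spans_fam (fun q : 'I_#|{: T}| => w (enum_val q)) nm.
  move=> x /sb[c ->]; exists (fun q => c (tag (enum_val q))).
  rewrite -(big_enum_val (fun t : T => c (tag t) *: w t)) /=.
  transitivity (\sum_(i < n) \sum_(j < tag (kv i)) c i *: tagged (kv i) j).
    by apply: eq_bigr => i _; rewrite -scaler_sumr; case: (kvP i) => _ <-.
  exact: (sig_big_dep xpredT (fun=> xpredT) (fun i j => c i *: tagged (kv i) j)).
have [s [f [sf ff]]] := min_basis hR (@lie_torsion_free _ _ _) sw.
have /choice[ht htP] i : exists e, (0 < e)%N /\
    lbr (tr_bp_in D H) (w (enum_val (f i))) = - e%:R *: w (enum_val (f i)).
  by have [_ [e e0 He]] := hw (enum_val (f i)); exists e.
exists s, (fun i => w (enum_val (f i))), ht; split=> // i.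
- by have [] := hw (enum_val (f i)).
- by have [] := htP i.
- by have [] := htP i.
Qed.

(** A basis of n^- made of eigenvectors of H, followed by a basis of the Borel
    subalgebra. It plays the part of the root space decomposition. *)
Lemma triangular_basis : finite_type G -> exists (H : tr_bp D)
    (s : nat) (y : 'I_s -> g) (ht : 'I_s -> nat) (t : nat) (b : 'I_t -> tr_bp D),
  let x (i : 'I_s + 'I_t) := match i with inl j => y j | inr j => tr_bp_in D (b j) end in
  [/\ forall i, (0 < ht i)%N,
      forall i, lbr (tr_bp_in D H) (y i) = - (ht i)%:R *: y i,
      spans_fam b setT,
      forall z, exists c, z = \sum_i c i *: x i
    & forall c, \sum_i c i *: x i = 0 -> forall i, c i = 0].
Proof.
move=> ftG; have [H _ HE] := grading_vector.
have [s [y [ht [nmy sy fy ht0 Hy]]]] := negative_basis ftG HE.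
have [n [b [Sb sb]]] := lie_fg ftG (range_submod (tr_bp_in D)).
have inj := differential_inj (@tr_bp_inP _ _ D).
have /choice[b' b'E] i : exists z, tr_bp_in D z = b i.
  by have [z _ <-] := Sb i; exists z.
have sb' : spans_fam b' setT.
  move=> z _; have [|c cE] := sb (tr_bp_in D z); first by exists z.
  exists c; apply: inj; rewrite cE raddf_sum; apply: eq_bigr => i _.
  by rewrite /= linearZ b'E.
have [t [f [sf ff]]] := min_basis hR (@lie_torsion_free _ _ _) sb'.
exists H, s, y, ht, t, (b' \o f) => x; split=> //.
- move=> z; have [z1 [t0 [z2 [nz1 nz2 ->]]]] := tr_g_sum z.
  have [c ->] := sy _ nz1.
  have [z' _ z'E] : range (tr_bp_in D) (tr_h_in D t0 + z2).
    by rewrite tr_bp_sum; exists t0, z2.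
  have [d dE] := sf z' I.
  exists (fun i => match i with inl j => c j | inr j => d j end).
  rewrite big_sumType /= -addrA; congr (_ + _).
  rewrite -z'E dE raddf_sum; apply: eq_bigr => i _.
  by rewrite /= linearZ.
- move=> c; rewrite big_sumType /=.
  set Y := \sum_(i < s) _.
  have nY : nm Y.
    by apply: (submod_sum nm_submod) => i _; apply: (submodZ nm_submod).
  set B := \sum_(i < t) _ => YB.
  have BE : B = tr_bp_in D (\sum_i c (inr i) *: b' (f i)).
    by rewrite raddf_sum; apply: eq_bigr => i _; rewrite /= linearZ.
  have [t0 [z [nz Bz]]] : [set x | exists t0 z, tr_np z /\ x = tr_h_in D t0 + z] B.
    by rewrite -tr_bp_sum BE; exists (\sum_i c (inr i) *: b' (f i)).
  rewrite Bz addrA in YB.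
  have [Y0 h0 z0] := tr_g_direct nY nz YB.
  have cl := fy (fun i => c (inl i)) Y0.
  have B0 : B = 0 by rewrite Bz h0 z0 addr0.
  have cr : forall i, c (inr i) = 0.
    by apply: ff; apply: inj; rewrite -BE B0 raddf0.
  by case.
Qed.
End TriangularBasis.

(** * Adic completions *)

Section Completion.
Variables (R : idomainType) (p : nat) (pi : R).
Hypothesis hR : complete_dvr_mixed p pi.
Variables (U : algType R) (C : adicCompletion pi U).
Implicit Types (x y : C) (u v : U).
Local Notation red := (@cpl_red _ _ _ C).

Lemma red_cong i x u v : red i x u -> red i x v -> cong_pow pi i u v.
Proof. by move=> xu xv; apply: (@cpl_red_class _ _ _ C i x u v xu).1. Qed.

Lemma redB i x y u v : red i x u -> red i y v -> red i (x - y) (u - v).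
Proof.
by move=> xu yv; rewrite addrC [u - v]addrC -!scaleN1r; apply: cpl_redP.
Qed.

Lemma redZ i r x u : red i x u -> red i (r *: x) (r *: u).
Proof.
move=> xu; have := cpl_redP r xu (redB xu xu).
by rewrite !subrr !addr0.
Qed.

Lemma red_le i j x u : (i <= j)%N -> red j x u -> red i x u.
Proof.
by move=> /subnK <-; elim: (j - i)%N => // k IH /cpl_redS.
Qed.

Lemma red_congr i x u v : red i x u -> cong_pow pi i u v -> red i x v.
Proof. by move=> xu; apply: (@cpl_red_class _ _ _ C i x u v xu).2. Qed.

Lemma red_ext x y : (forall i, exists2 u, red i x u & red i y u) -> x = y.
Proof.
move=> h; apply: cpl_sep => i u xu; have [v xv yv] := h i.
exact: red_congr yv (red_cong xv xu).
Qed.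

Lemma red_pow k y : red k (pi ^+ k *: y) 0.
Proof.
have [v yv] := cpl_red_total k y.
apply: (red_congr (redZ (pi ^+ k) yv)).
by exists (- v); rewrite sub0r scalerN.
Qed.

(** From index k on, a sequence of representatives of x is divisible by pi^k,
    and the quotients form a Cauchy sequence. *)
Lemma red_divides k x : red k x 0 -> exists y, x = pi ^+ k *: y.
Proof.
move=> x0; have /choice[u xu] i := cpl_red_total i x.
have /choice[z zE] i : cong_pow pi i (u i) (u i.+1).
  exact: red_cong (xu i) (cpl_redS (xu _)).
have [z' z'E] := red_cong x0 (xu k); rewrite subr0 in z'E.
pose w i := z' + \sum_(j < i) pi ^+ j *: z (k + j)%N.
have uw i : u (k + i)%N = pi ^+ k *: w i.
  elim: i => [|i IH]; first by rewrite addn0 /w big_ord0 addr0.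
  rewrite addnS -[LHS](subrK (u (k + i)%N)) zE IH /w big_ord_recr /= addrA.
  by rewrite [LHS]addrC [RHS]scalerDr scalerA -exprD.
have [|y yw] := @cpl_lim _ _ _ C w.
  move=> i; exists (z (k + i)%N).
  by rewrite /w big_ord_recr /= addrA [X in X - _]addrC addrK.
exists y; apply: red_ext => i; exists (u (k + i)%N).
  exact: red_le (leq_addl _ _) (xu _).
by rewrite uw; apply: redZ.
Qed.

Lemma cpl_separated x : (forall k, exists y, x = pi ^+ k *: y) -> x = 0.
Proof.
move=> h; apply: red_ext => i; exists 0; first by have [y ->] := h i; apply: red_pow.
by have := red_pow i 0; rewrite scaler0.
Qed.

Lemma cpl_dense x k : exists u y, x = cpl_in C u + pi ^+ k *: y.
Proof.
have [u xu] := cpl_red_total k x.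
have := redB xu (cpl_inP C k u); rewrite subrr => /red_divides[y yE].
by exists u, y; rewrite -yE addrC subrK.
Qed.

(** The completion does not make elements of U more divisible. *)
Lemma cpl_in_divides u k y : cpl_in C u = pi ^+ k *: y ->
  exists v, u = pi ^+ k *: v.
Proof.
move=> E; have h := cpl_inP C k u; rewrite E in h.
by have [v vE] := red_cong (red_pow k y) h; exists v; rewrite -vE subr0.
Qed.

Lemma cpl_complete (a : nat -> C) : exists x, forall k, exists y,
  x = \sum_(j < k) pi ^+ j *: a j + pi ^+ k *: y.
Proof.
have /choice[u hu] i := cpl_red_total i (\sum_(j < i) pi ^+ j *: a j).
have [|x xu] := @cpl_lim _ _ _ C u.
  move=> i; apply: red_cong (hu i) _.
  have := redB (cpl_redS (hu i.+1)) (red_pow i (a i)).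
  by rewrite big_ord_recr /= addrK subr0.
exists x => k; have := redB (xu k) (hu k); rewrite subrr => /red_divides[y yE].
by exists y; rewrite -yE addrC subrK.
Qed.

Lemma cpl_expand x : exists a : nat -> U, forall k, exists y,
  x = \sum_(j < k) pi ^+ j *: cpl_in C (a j) + pi ^+ k *: y.
Proof.
have /choice[f /choice[h fh]] z : exists u y, z = cpl_in C u + pi *: y.
  by have := cpl_dense z 1; rewrite expr1.
exists (fun j => f (iter j h x)) => k; exists (iter k h x).
elim: k => [|k IH]; first by rewrite big_ord0 add0r scale1r.
rewrite {1}IH big_ord_recr /= -addrA; congr (_ + _).
by rewrite {1}[iter k h x]fh scalerDr exprSr scalerA.
Qed.

(** The inverse is the geometric series in pi s. *)
Lemma cpl_geometric (s : C) : exists t, t * (1 - pi *: s) = 1.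
Proof.
have [t ht] := cpl_complete (fun j => s ^+ j); exists t.
apply/eqP; rewrite -subr_eq0; apply/eqP/cpl_separated => k.
have [y ->] := ht k; rewrite mulrDl.
have -> : (\sum_(j < k) pi ^+ j *: s ^+ j) * (1 - pi *: s) = 1 - pi ^+ k *: s ^+ k.
  elim: k {ht} => [|k IH]; first by rewrite big_ord0 mul0r scale1r subrr.
  rewrite big_ord_recr mulrDl IH /= mulrBr mulr1 -scalerAl -scalerAr scalerA -!exprSr.
  by rewrite addrA subrK.
exists (y * (1 - pi *: s) - s ^+ k).
by rewrite scalerBr -scalerAl addrAC [1 - _ - 1]addrAC subrr add0r addrC.
Qed.

(** Linear forms are continuous for the pi-adic topologies, and R is complete
    and separated. *)
Lemma cpl_functional (phi : {linear U -> R^o}) :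
  exists psi : {linear C -> R^o}, forall u, psi (cpl_in C u) = phi u.
Proof.
pose f u : R := phi u.
have phiZ r u : f (r *: u) = r * f u by rewrite /f linearZ.
have phiD u v : f (u + v) = f u + f v by rewrite /f raddfD.
(* P x l says that l is the limit of the values of phi at approximations
   of x. *)
pose P x (l : R) := forall k u y, x = cpl_in C u + pi ^+ k *: y ->
  exists r : R, l = f u + pi ^+ k * r.
have key k u v y z : cpl_in C u + pi ^+ k *: y = cpl_in C v + pi ^+ k *: z ->
    exists r : R, f u = f v + pi ^+ k * r.
  move=> E; have [w wE] : exists w, u - v = pi ^+ k *: w.
    apply: (@cpl_in_divides _ _ (z - y)); rewrite raddfB scalerBr /=.
    by apply/eqP; rewrite subr_eq addrAC [X in X - _]addrC -E addrK.
  by exists (f w); rewrite -phiZ -phiD -wE addrC subrK.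
have exP x : exists l, P x l.
  have /choice[u /choice[y xE]] k := cpl_dense x k.
  have [k|l lE] := dvr_complete hR (x := fun k => f (u k)).
    have [r rE] : exists r : R, f (u k) = f (u k.+1) + pi ^+ k * r.
      apply: (key _ _ _ (y k) (pi *: y k.+1)).
      by rewrite -xE scalerA -exprSr -xE.
    exists (- r); rewrite rE opprD addrA subrr add0r scalerN; congr (- _).
  exists l => k v z xv; have [r rE] := lE k.
  have [r' r'E] : exists r : R, f (u k) = f v + pi ^+ k * r.
    by apply: (key _ _ _ (y k) z); rewrite -xE.
  exists (r' + r); rewrite mulrDr addrA -r'E.
  by have /eqP := rE; rewrite subr_eq addrC => /eqP.
have P_uniq x l l' : P x l -> P x l' -> l = l'.
  move=> Pl Pl'; apply/eqP; rewrite -subr_eq0; apply/eqP/(dvr_sep hR) => k.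
  have [u [y xE]] := cpl_dense x k.
  have [r ->] := Pl k u y xE; have [r' ->] := Pl' k u y xE.
  by exists (r - r'); rewrite mulrBr opprD addrACA subrr add0r.
have /choice[psi psiP] := exP.
have psi_lin : linear (psi : C -> R^o).
  move=> r x x'; apply: (P_uniq (r *: x + x')) => // k w z wE.
  have [u [y xE]] := cpl_dense x k; have [u' [y' xE']] := cpl_dense x' k.
  have [s ->] := psiP x k u y xE; have [s' ->] := psiP x' k u' y' xE'.
  have [q qE] : exists q : R, f (r *: u + u') = f w + pi ^+ k * q.
    apply: (key _ _ _ (r *: y + y') z); rewrite -wE xE xE' linearP.
    by rewrite !scalerDr !scalerA addrACA [_ * r]mulrC.
  exists (q + (r * s + s')).
  suff E : (r * (f u + pi ^+ k * s) + (f u' + pi ^+ k * s') : R) =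
      f w + pi ^+ k * (q + (r * s + s')) by exact: E.
  rewrite [X in _ = _ + X]mulrDr [RHS]addrA -qE phiD phiZ mulrDr addrACA.
  by congr (_ + _); rewrite mulrDr mulrCA.
pose Psi : {linear C -> R^o} :=
  HB.pack (psi : C -> R^o) (GRing.isLinear.Build _ _ _ _ (psi : C -> R^o) psi_lin).
exists Psi => u; apply: (P_uniq (cpl_in C u)); first exact: psiP.
move=> k v y uE; apply: (key _ _ _ 0 y); by rewrite scaler0 addr0.
Qed.
End Completion.

(** * Modules with a largest proper submodule *)

Section QuotientModule.
Local Open Scope quotient_scope.
Variables (S : nzRingType) (M : lmodType S) (N : set M).
Hypothesis hN : submodules N.

Definition quotmod := Quotient.quot (submod_pred hN : zmodClosed M).
HB.instance Definition _ := GRing.Zmodule.on quotmod.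

Definition quot_proj (x : M) : quotmod :=
  \pi_(Quotient.quot (submod_pred hN : zmodClosed M)) x.

Lemma quot_projD x y : quot_proj (x + y) = quot_proj x + quot_proj y.
Proof. exact: raddfD. Qed.

Lemma quot_projP x y : quot_proj x = quot_proj y <-> N (x - y).
Proof.
split=> [/eqP|Nxy].
  by rewrite /quot_proj -Quotient.idealrBE => /asboolP.
by apply/eqP; rewrite /quot_proj -Quotient.idealrBE; apply/asboolP.
Qed.

Lemma quot_proj_surj y : exists x, quot_proj x = y.
Proof. by exists (repr y); apply: reprK. Qed.

Definition quot_scale (s : S) (y : quotmod) : quotmod :=
  quot_proj (s *: (repr (y : Quotient.quot (submod_pred hN : zmodClosed M)))).

Lemma quot_scaleE s x : quot_scale s (quot_proj x) = quot_proj (s *: x).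
Proof.
apply/quot_projP; rewrite -scalerBr; apply: (submodZ hN).
by apply/quot_projP; apply: reprK.
Qed.

Fact quot_scaleA s t y : quot_scale s (quot_scale t y) = quot_scale (s * t) y.
Proof.
by have [x <-] := quot_proj_surj y; rewrite !quot_scaleE scalerA.
Qed.
Fact quot_scale1 : left_id 1 quot_scale.
Proof. by move=> y; have [x <-] := quot_proj_surj y; rewrite quot_scaleE scale1r. Qed.
Fact quot_scaleDr : right_distributive quot_scale +%R.
Proof.
move=> s y z; have [x <-] := quot_proj_surj y; have [x' <-] := quot_proj_surj z.
by rewrite -quot_projD !quot_scaleE scalerDr quot_projD.
Qed.
Fact quot_scaleDl y : {morph quot_scale^~ y : s t / s + t}.
Proof.
move=> s t; have [x <-] := quot_proj_surj y.
by rewrite !quot_scaleE scalerDl quot_projD.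
Qed.
HB.instance Definition _ := GRing.Zmodule_isLmodule.Build S quotmod
  quot_scaleA quot_scale1 quot_scaleDr quot_scaleDl.

Fact quot_proj_lin : linear quot_proj.
Proof. by move=> s x y; rewrite quot_projD -quot_scaleE. Qed.
HB.instance Definition _ :=
  GRing.isLinear.Build S M quotmod *:%R quot_proj quot_proj_lin.

Lemma quot_proj_eq0 x : quot_proj x = 0 <-> N x.
Proof. by rewrite -(raddf0 quot_proj) quot_projP subr0. Qed.
End QuotientModule.

(** The kernel of a map onto a simple module is a maximal proper submodule,
    hence equal to N. *)
Lemma largest_proper_submodule (S : nzRingType) (M : lmodType S) (N : set M)
    (x0 : M) : submodules N -> ~ N x0 ->
  (forall N', submodules N' -> N' = setT \/ N' `<=` N) ->
  has_unique_simple_quotient M.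
Proof.
move=> hN Nx0 max; pose q : {linear M -> quotmod hN} := @quot_proj S M N hN.
have qS : forall y, exists x, q x = y := @quot_proj_surj _ _ _ hN.
have q0 x : q x = 0 <-> N x := quot_proj_eq0 hN x.
exists (quotmod hN), q; split; first split=> //.
  split=> [|P [P0 PZ]]; first by exists (q x0) => /q0.
  have [||PT] := max [set x | P (q x)].
  - split=> [|s x y Px Py]; first by rewrite /= raddf0.
    by rewrite /= linearP; apply: PZ.
  - move=> PT; right; apply/seteqP; split=> // y _; have [x <-] := qS y.
    by have : setT x by []; rewrite -PT.
  - left; apply/seteqP; split=> [y Py|_ -> //].
    by have [x xE] := qS y; rewrite -xE; apply/q0/PT; rewrite /= xE.
move=> L q' [[[l l0] simL] surj].
have kerE x : q' x = 0 <-> N x.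
  have kN : [set x | q' x = 0] `<=` N.
    have [||//] := max [set x | q' x = 0].
      split=> [|s u v u0 v0]; first by rewrite /= raddf0.
      by rewrite /= linearP u0 v0 scaler0 addr0.
    move=> kT; have [u uE] := surj l; case: l0; rewrite -uE.
    by have : setT u by []; rewrite -kT.
  split; first exact: kN; move=> Nx.
  have [|im0|imT] := simL (q' @` N).
  - split=> [|s _ _ [u Nu <-] [v Nv <-]]; first exists 0.
    + by have [] := hN.
    + by rewrite raddf0.
   
    exists (s *: u + v); last by rewrite linearP.
    by have [_] := hN; apply.
  - have : (q' @` N) (q' x) by exists x.
    by rewrite im0.
  - case: Nx0; have : (q' @` N) (q' x0) by rewrite imT.
    case=> u Nu uE; rewrite -(subrK u x0); apply: (submodD hN) => //.
    by apply: kN; rewrite /= raddfB /= uE subrr.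
have /choice[r rq] y := qS y.
have fE y x : q x = y -> q' (r y) = q' x.
  move=> xy; apply/eqP; rewrite -subr_eq0 -raddfB; apply/eqP/kerE/q0.
  by rewrite raddfB /= rq xy subrr.
have f_lin : linear (q' \o r).
  move=> s y z /=; rewrite (fE _ (s *: r y + r z)) ?linearP //.
  by rewrite !rq.
pose f : {linear quotmod hN -> L} :=
  HB.pack (q' \o r) (GRing.isLinear.Build _ _ _ _ (q' \o r) f_lin).
exists f; last by move=> x; rewrite /f /= (fE _ x).
have /choice[r' rq'] y := surj y.
exists (q \o r') => y; rewrite /f /=.
  rewrite -[RHS]rq; apply/eqP; rewrite -subr_eq0 -raddfB; apply/eqP/q0/kerE.
  by rewrite raddfB /= rq' subrr.
by rewrite (fE _ (r' y)).
Qed.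

(** * Monomial orders, falling factorials and closed subspaces *)

(** Dickson's lemma for the first n values of k, by induction on n: a finite
    set for n bounds the next value by m, and the elements whose next value is
    less than m fall into m classes to which the induction hypothesis
    applies. *)
Lemma dickson n (T : eqType) (P : set T) (k : T -> nat -> nat) :
  exists B : seq T, (forall t, t \in B -> P t) /\
    forall t, P t -> exists2 b, b \in B &
      forall i, (i < n)%N -> (k b i <= k t i)%N.
Proof.
elim: n P => [|n IH] P.
  have [[t Pt]|none] := pselect (exists t, P t).
    exists [:: t]; split=> [b|t' _]; first by rewrite inE => /eqP ->.
    by exists t; rewrite ?inE.
  by exists [::]; split=> // t Pt; case: none; exists t.
have [B [BP hB]] := IH P.
pose m := \max_(t <- B) k t n.
have /choice[C hC] j := IH [set t | P t /\ k t n = j].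
exists (B ++ flatten [seq C j | j <- iota 0 m]); split.
  move=> t; rewrite mem_cat => /orP[/BP //|/flatten_mapP[j _ tC]].
  by have [h _] := hC j; have [] := h t tC.
move=> t Pt; have [mt|tm] := leqP m (k t n).
  have [b bB hb] := hB t Pt; exists b; first by rewrite mem_cat bB.
  move=> i; rewrite ltnS leq_eqVlt => /orP[/eqP ->|]; last exact: hb.
  apply: leq_trans mt; exact: (@leq_bigmax_seq _ B xpredT (fun t => k t n) b).
have [h1 h2] := hC (k t n); have [|b bC hb] := h2 t; first by [].
exists b.
  rewrite mem_cat; apply/orP; right; apply/flatten_mapP.
  by exists (k t n); rewrite ?mem_iota.
move=> i; rewrite ltnS leq_eqVlt => /orP[/eqP ->|]; last exact: hb.
by have [_ ->] := h1 b bC.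
Qed.

(** Later positions weigh more, so that the last one can hold a total
    degree. *)
Fixpoint lexlt n (e e' : nat -> nat) : bool :=
  if n is n'.+1 then (e n' < e' n')%N || ((e n' == e' n') && lexlt n' e e')
  else false.

Lemma lexlt_irr n e : lexlt n e e = false.
Proof. by elim: n => //= n ->; rewrite ltnn andbF. Qed.

Lemma lexlt_trans n e1 e2 e3 : lexlt n e1 e2 -> lexlt n e2 e3 -> lexlt n e1 e3.
Proof.
elim: n => //= n IH /orP[h1|/andP[/eqP E1 h1]] /orP[h2|/andP[/eqP E2 h2]].
- by rewrite (ltn_trans h1 h2).
- by rewrite -E2 h1.
- by rewrite E1 h2.
- by rewrite E1 E2 eqxx (IH h1 h2) orbT.
Qed.

Lemma lexlt_total n e1 e2 :
  [\/ lexlt n e1 e2, lexlt n e2 e1 | forall i, (i < n)%N -> e1 i = e2 i].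
Proof.
elim: n => [|n IH] /=; first by constructor 3.
have [lt|gt|E] := ltngtP (e1 n) (e2 n); rewrite ?orbT /=.
- by constructor 1.
- by constructor 2.
case: IH => [->|->|h]; [by constructor 1|by constructor 2|constructor 3] => i.
by rewrite ltnS leq_eqVlt => /orP[/eqP ->|/h].
Qed.

Lemma lexltD n e1 e2 d : lexlt n e1 e2 ->
  lexlt n (fun i => d i + e1 i)%N (fun i => d i + e2 i)%N.
Proof.
elim: n => //= n IH /orP[h|/andP[/eqP -> /IH ->]]; first by rewrite ltn_add2l h.
by rewrite eqxx orbT.
Qed.

Lemma eq_lexlt n e1 e2 f1 f2 : (forall i, (i < n)%N -> e1 i = f1 i) ->
  (forall i, (i < n)%N -> e2 i = f2 i) -> lexlt n e1 e2 = lexlt n f1 f2.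
Proof.
elim: n => //= n IH h1 h2; rewrite h1 // h2 // IH // => i ilt.
  by apply: h1; apply: ltnW.
by apply: h2; apply: ltnW.
Qed.

Lemma lexlt_ind n (P : (nat -> nat) -> Prop) :
  (forall e, (forall e', lexlt n e' e -> P e') -> P e) -> forall e, P e.
Proof.
elim: n P => [|n IH] P hP; first by move=> e; apply: hP.
suff h m e : e n = m -> P e by move=> e; apply: (h (e n)).
elim/ltn_ind: m e => m IHm; apply: IH => e IHe em.
apply: hP => e' /= /orP[lt|/andP[/eqP E lt]].
  by apply: (IHm (e' n)) => //; rewrite -em.
by apply: IHe => //; rewrite E.
Qed.

Lemma ffact_prodE (K : comNzRingType) n m :
  \prod_(i < m) (n%:R - i%:R) = (n ^_ m)%:R :> K.
Proof.
elim: m => [|m IH]; first by rewrite big_ord0 ffactn0.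
rewrite big_ord_recr /= IH ffactnSr natrM.
have [mn|nm] := leqP m n; first by rewrite natrB.
by rewrite ffact_small // !mul0r.
Qed.

Lemma neg_ffact (K : comNzRingType) m :
  \prod_(i < m) (- 1 - i%:R) = (-1) ^+ m * (m`!)%:R :> K.
Proof.
elim: m => [|m IH]; first by rewrite big_ord0 mulr1.
have E : - 1 - m%:R = - (m.+1)%:R :> K by rewrite -natr1 opprD addrC.
rewrite big_ord_recr /= IH E factS exprS natrM mulrN mulN1r !mulNr -mulrA.
by rewrite [_ * (m.+1)%:R]mulrC.
Qed.

(** A subspace is the kernel of a matrix. After multiplication by a power of w
    its entries lie in O, so that membership passes to w-adic limits of the
    coordinates. *)
Lemma subspace_closed (K : fieldType) (O : set K) (w : K) r (S : set 'rV[K]_r) :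
  (forall a b, O a -> O b -> O (a - b)) ->
  (forall a b, O a -> O b -> O (a * b)) -> O 1 -> w != 0 -> O w ->
  (forall c, exists k, O (w ^+ k * c)) ->
  (forall c, (forall k, exists2 d, O d & c = w ^+ k * d) -> c = 0) ->
  S 0 -> (forall c u v, S u -> S v -> S (c *: u + v)) ->
  forall v : 'rV[K]_r,
    (forall k, exists2 u, S u &
       forall i, exists2 d, O d & v 0 i - u 0 i = w ^+ k * d) -> S v.
Proof.
move=> OB OM O1 w0 Ow Oabs Osep S0 SZ v hv.
have O0 : O 0 by rewrite -(subrr 1); apply: (OB).
have OD a b : O a -> O b -> O (a + b).
  by move=> Oa Ob; rewrite -[b]opprK -[- b]sub0r; apply: (OB) => //; apply: (OB).
have Osum m (F : 'I_m -> K) : (forall i, O (F i)) -> O (\sum_i F i).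
  by move=> h; elim/big_rec: _ => // i x _; apply: (OD).
have OX k : O (w ^+ k) by elim: k => [|k IH]; rewrite ?expr0 // exprS; apply: (OM).
(* A matrix of greatest rank among those with rows in S spans S. *)
pose Q n := `[< exists2 A : 'M[K]_r, (forall i, S (row i A)) & \rank A = n >].
have exQ : exists n, Q n.
  exists 0%N; apply/asboolP; exists 0; last by rewrite mxrank0.
  by move=> i; rewrite row0.
have Qle n : Q n -> (n <= r)%N.
  by move=> /asboolP[A _ <-]; apply: rank_leq_col.
case: (ex_maxnP exQ Qle) => n /asboolP[A SA rA] nmax.
have Sub u : (u <= A)%MS -> S u.
  move=> /submxP[d ->]; rewrite mulmx_sum_row.
  elim/big_rec: _ => // i x _ Sx; exact: SZ.
have subA u : S u -> (u <= A)%MS.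
  move=> Su; apply/negPn/negP => uA.
  have h : (\rank A < \rank (A + u)%MS)%N.
    rewrite ltn_neqAle mxrankS ?addsmxSl // andbT.
    apply: contra uA => /eqP E; apply: submx_trans (addsmxSr A u) _.
    by rewrite -(geq_leqif (mxrank_leqif_sup (addsmxSl A u))) E.
  have : Q (\rank (A + u)%MS).
    apply/asboolP; exists (A + u)%MS => // i.
    have : (row i (A + u)%MS <= A + u)%MS by apply: row_sub.
    move=> /sub_addsmxP[[a b] /= ->].
    rewrite -[a *m A]scale1r; apply: (SZ); first by apply: (Sub); apply: submxMl.
    by rewrite [b]mx11_scalar mul_scalar_mx -[_ *: u]addr0; apply: (SZ).
  by move=> /nmax; rewrite -rA leqNgt h.
apply: (Sub); rewrite submxE; apply/eqP/rowP => j; rewrite mxE [RHS]mxE.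
have /choice[q hq] i := Oabs (cokermx A i j).
pose N := \max_i q i.
have hN i : O (w ^+ N * cokermx A i j).
  rewrite -(subnK (leq_bigmax i : (q i <= N)%N)) exprD -mulrA.
  exact: OM.
apply: Osep => k; have [u Su uv] := hv (N + k)%N.
have /choice[d dP] i : exists d, O d /\ v 0 i - u 0 i = w ^+ (N + k) * d.
  by have [d] := uv i; exists d.
exists (\sum_i d i * (w ^+ N * cokermx A i j)).
  by apply: Osum => i; apply: (OM) => //; have [] := dP i.
have : (u *m cokermx A) 0 j = 0.
  by have := subA u Su; rewrite submxE => /eqP ->; rewrite mxE.
rewrite mxE => u0; rewrite -[LHS]subr0 -[X in _ - X]u0 -sumrB mulr_sumr.
apply: eq_bigr => i _; rewrite -mulrBl; have [_ ->] := dP i.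
by rewrite [(N + k)%N]addnC exprD -!mulrA; congr (_ * _); rewrite mulrCA.
Qed.

Section DegLex.
Variable s : nat.
Local Notation E := {ffun 'I_s -> nat}.
Implicit Types a b g : E.

(** The exponents, followed at position s by the total degree: comparing these
    keys with lexlt gives the degree-lexicographic order. *)
Definition mkey a (i : nat) : nat := oapp a (mdeg a) (insub i).
Definition mlt a b := lexlt s.+1 (mkey a) (mkey b).

Lemma mkey_deg a : mkey a s = mdeg a.
Proof. by rewrite /mkey insubN // ltnn. Qed.

Lemma mkey_ord a (i : 'I_s) : mkey a i = a i.
Proof. by rewrite /mkey valK. Qed.

Lemma mkeyD g a i : mkey (madd g a) i = (mkey g i + mkey a i)%N.
Proof.
by rewrite /mkey; case: insubP => [j _ _|_] /=; rewrite ?ffunE ?mdegD.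
Qed.

Lemma mlt_deg a b : (mdeg a < mdeg b)%N -> mlt a b.
Proof. by rewrite /mlt /= !mkey_deg => ->. Qed.

Lemma mlt_le a b : mlt a b -> (mdeg a <= mdeg b)%N.
Proof.
by rewrite /mlt /= !mkey_deg => /orP[/ltnW//|/andP[/eqP ->]].
Qed.

Lemma mlt_irr a : mlt a a = false. Proof. exact: lexlt_irr. Qed.

Lemma mlt_trans a b g : mlt a b -> mlt b g -> mlt a g.
Proof. exact: lexlt_trans. Qed.

Lemma mlt_total a b : [\/ mlt a b, mlt b a | a = b].
Proof.
have [h|h|h] := lexlt_total s.+1 (mkey a) (mkey b).
- by constructor 1.
- by constructor 2.
constructor 3; apply/ffunP => i; rewrite -!mkey_ord; apply: h.
by rewrite ltnS ltnW.
Qed.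

Lemma mltD g a b : mlt a b -> mlt (madd g a) (madd g b).
Proof.
move=> /(lexltD (mkey g)); rewrite /mlt => h.
by rewrite (eq_lexlt (fun i _ => mkeyD g a i) (fun i _ => mkeyD g b i)).
Qed.

Lemma mlt_ind (P : E -> Prop) :
  (forall a, (forall b, mlt b a -> P b) -> P a) -> forall a, P a.
Proof.
move=> hP a; have := @lexlt_ind s.+1 (fun f => forall a, mkey a = f -> P a).
apply=> // f IH b bf; apply: hP => c cb; apply: (IH (mkey c)) => //.
by rewrite -bf.
Qed.

Lemma mlt_max (F : seq E) (P : E -> Prop) : (exists2 a, a \in F & P a) ->
  exists2 a, a \in F /\ P a & forall b, b \in F -> P b -> b = a \/ mlt b a.
Proof.
elim: F => [|a F IH]; first by case.
have [ex|none] := pselect (exists2 b, b \in F & P b); last first.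
  move=> [b]; rewrite inE => /orP[/eqP ->|bF] Pb; last by case: none; exists b.
  exists a; first by rewrite mem_head.
  move=> c; rewrite inE => /orP[/eqP ->|cF] Pc; first by left.
  by case: none; exists c.
have [m [mF Pm] mmax] := IH ex.
have [Pa|nPa] := pselect (P a); last first.
  move=> _; exists m; first by rewrite inE mF orbT.
  by move=> c; rewrite inE => /orP[/eqP ->|cF] // Pc; apply: mmax.
move=> _; have [am|ma|am] := mlt_total a m.
- exists m; first by rewrite inE mF orbT.
  by move=> c; rewrite inE => /orP[/eqP ->|cF] Pc; [right|apply: mmax].
- exists a; first by rewrite mem_head.
  move=> c; rewrite inE => /orP[/eqP ->|cF] Pc; [by left|right].
  by have [->//|/mlt_trans] := mmax c cF Pc; apply.
- exists m; first by rewrite inE mF orbT.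
  by move=> c; rewrite inE => /orP[/eqP ->|cF] Pc; [left|apply: mmax].
Qed.
End DegLex.

(** * Submodules of a graded module with a complete lattice *)

(** A module over the K-algebra T is a vector space over K through the
    constants of T. *)
Notation "c ** x" := ((c%:A : _) *: x) (at level 40).

Section KScale.
Variables (K : fieldType) (T : algType K) (M : lmodType T).
Implicit Types (c d : K) (t : T) (x y : M).
Lemma kscaleA c d x : c ** (d ** x) = (c * d) ** x.
Proof. by rewrite scalerA -scalerAl mul1r scalerA. Qed.
Lemma kscaleDr c x y : c ** (x + y) = c ** x + c ** y.
Proof. exact: scalerDr. Qed.
Lemma kscaleBr c x y : c ** (x - y) = c ** x - c ** y.
Proof. exact: scalerBr. Qed.
Lemma kscaleDl c d x : (c + d) ** x = c ** x + d ** x.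
Proof. by rewrite scalerDl scalerDl. Qed.
Lemma kscaleBl c d x : (c - d) ** x = c ** x - d ** x.
Proof. by rewrite scalerBl scalerBl. Qed.
Lemma kscale1 x : 1 ** x = x. Proof. by rewrite scale1r scale1r. Qed.
Lemma kscale0 x : 0 ** x = 0. Proof. by rewrite scale0r scale0r. Qed.
Lemma kscaleC t c x : t *: (c ** x) = c ** (t *: x).
Proof. by rewrite !scalerA -scalerAl -scalerAr mulr1 mul1r. Qed.
Lemma kscaleZ t c x : (c *: t) *: x = c ** (t *: x).
Proof. by rewrite scalerA -scalerAl mul1r. Qed.
Lemma kscale_sumr c (I : Type) (r : seq I) (F : I -> M) :
  c ** (\sum_(i <- r) F i) = \sum_(i <- r) c ** F i.
Proof. exact: scaler_sumr. Qed.
Lemma kscaleK c x : c != 0 -> c^-1 ** (c ** x) = x.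
Proof. by move=> c0; rewrite kscaleA mulVf // kscale1. Qed.
Lemma submod_kscale (N : set M) : submodules N ->
  forall c x, N x -> N (c ** x).
Proof. by move=> hN c x; apply: submodZ. Qed.
End KScale.

(** The setting abstracts what is used of the affinoid Verma module. K is the
    fraction field of a discrete valuation ring O with uniformiser w, and M is
    a module over a K-algebra T. The O-submodules A0 of T and Lam of M play the
    role of unit balls, and the elements of A0 preserve Lam; A0 is w-adically
    complete and Lam is w-adically separated. The elements e a of Lam are a
    topological basis with coordinates Phi a. The operators Y g act on them, up
    to terms of smaller degree, like the product of monomials, and the operator
    Dg has the e a as eigenvectors with natural numbers as eigenvalues, each
    eigenvalue occurring finitely often. *)
Section Lattice.
Variables (K : fieldType) (O : set K) (w : K).
Hypotheses (O1 : O 1) (OB : forall a b, O a -> O b -> O (a - b))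
  (OM : forall a b, O a -> O b -> O (a * b)) (w0 : w != 0) (Ow : O w)
  (O_val : forall c, O c -> (exists2 d, O d & c = w * d) \/ (c != 0 /\ O c^-1))
  (O_abs : forall c, exists k, O (w ^+ k * c))
  (O_sep : forall c, (forall k, exists2 d, O d & c = w ^+ k * d) -> c = 0)
  (char0 : forall n, (0 < n)%N -> n%:R != 0 :> K).

Lemma O0 : O 0. Proof. by rewrite -(subrr 1); apply: OB. Qed.
Lemma OD a b : O a -> O b -> O (a + b).
Proof.
by move=> Oa Ob; rewrite -[b]opprK -[- b]sub0r; apply: OB => //; apply: OB O0 _.
Qed.
Lemma On n : O n%:R.
Proof. by elim: n => [|n IH]; [apply: O0 | rewrite -natr1; apply: OD]. Qed.
Lemma OX a k : O a -> O (a ^+ k).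
Proof.
by move=> Oa; elim: k => [|k IH]; rewrite ?expr0 // exprS; apply: OM.
Qed.
Definition small c := exists2 d, O d & c = w * d.
Lemma smallD a b : small a -> small b -> small (a + b).
Proof.
move=> [d Od ->] [e Oe ->]; exists (d + e); last by rewrite mulrDr.
exact: OD.
Qed.
Lemma smallM a b : O a -> small b -> small (a * b).
Proof. by move=> Oa [d Od ->]; exists (a * d); [apply: OM | rewrite mulrCA]. Qed.
Lemma smallN a : small a -> small (- a).
Proof.
by move=> [d Od ->]; exists (- d); [rewrite -sub0r; apply: OB O0 _ | rewrite mulrN].
Qed.
Lemma small0 : small 0. Proof. by exists 0; [exact: O0 | rewrite mulr0]. Qed.
Lemma smallS (I : eqType) (r : seq I) (F : I -> K) :
  (forall i, i \in r -> small (F i)) -> small (\sum_(i <- r) F i).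
Proof.
move=> h; rewrite big_seq; elim/big_rec: _ => [|i x ir]; first exact: small0.
by apply: smallD; apply: h.
Qed.

Variables (T : algType K) (M : lmodType T) (A0 : set T) (Lam : set M).
Hypotheses (A0_1 : A0 1) (A0B : forall a b, A0 a -> A0 b -> A0 (a - b))
  (A0Z : forall c a, O c -> A0 a -> A0 (c *: a))
  (A0_abs : forall t, exists k, A0 (w ^+ k *: t))
  (A0_ser : forall a : nat -> T, (forall k, A0 (a k)) -> exists t, forall k,
     exists2 b, A0 b & t = \sum_(j < k) w ^+ j *: a j + w ^+ k *: b).
Hypotheses (LamD : forall x y, Lam x -> Lam y -> Lam (x + y))
  (A0L : forall a x, A0 a -> Lam x -> Lam (a *: x))
  (Lam_abs : forall x, exists k, Lam (w ^+ k ** x))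
  (Lam_sep : forall x, (forall k, exists2 y, Lam y & x = w ^+ k ** y) -> x = 0).
Variable s : nat.
Local Notation E := {ffun 'I_s -> nat}.
Variables (e : E -> M) (Phi : E -> M -> K).
Hypotheses (Lam_e : forall a, Lam (e a))
  (Phi_lin : forall a c x y, Phi a (c ** x + y) = c * Phi a x + Phi a y)
  (Phi_int : forall a x, Lam x -> O (Phi a x))
  (Phi_e : forall a b, Phi a (e b) = (a == b)%:R)
  (Lam_dense : forall x k, Lam x -> exists (F : seq (K * E)) y,
     Lam y /\ x = \sum_(q <- F) q.1 ** e q.2 + w ^+ k ** y).
Variable Y : E -> T.
Hypotheses (A0_Y : forall g, A0 (Y g))
  (Y_e : forall g a b, (mdeg g + mdeg a <= mdeg b)%N ->
     Phi b (Y g *: e a) = (b == madd g a)%:R).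

Lemma LamZ c x : O c -> Lam x -> Lam (c ** x).
Proof. by move=> Oc Lx; apply: A0L => //; apply: A0Z. Qed.
Lemma LamB x y : Lam x -> Lam y -> Lam (x - y).
Proof.
move=> Lx Ly; apply: LamD => //; rewrite -scaleN1r; apply: A0L => //.
by rewrite -sub0r; apply: A0B => //; rewrite -(subrr 1); apply: A0B.
Qed.
Lemma Lam0 : Lam 0.
Proof. by rewrite -(subrr (e (mzero s))); apply: LamB. Qed.
Lemma LamS (I : eqType) (r : seq I) (F : I -> M) :
  (forall i, i \in r -> Lam (F i)) -> Lam (\sum_(i <- r) F i).
Proof.
move=> h; rewrite big_seq; elim/big_rec: _ => [|i x ir]; first exact: Lam0.
by apply: LamD; apply: h.
Qed.
Lemma A0_0 : A0 0. Proof. by rewrite -(subrr 1); apply: A0B. Qed.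
Lemma A0D a b : A0 a -> A0 b -> A0 (a + b).
Proof.
by move=> Aa Ab; rewrite -[b]opprK -[- b]sub0r; apply: A0B => //; apply: A0B A0_0 _.
Qed.
Lemma PhiD a x y : Phi a (x + y) = Phi a x + Phi a y.
Proof. by have := Phi_lin a 1 x y; rewrite kscale1 mul1r. Qed.
Lemma Phi0 a : Phi a 0 = 0.
Proof. by apply: (addIr (Phi a 0)); rewrite -PhiD !add0r. Qed.
Lemma PhiZ a c x : Phi a (c ** x) = c * Phi a x.
Proof. by have := Phi_lin a c x 0; rewrite !addr0 Phi0 addr0. Qed.
Lemma PhiB a x y : Phi a (x - y) = Phi a x - Phi a y.
Proof.
rewrite PhiD; congr (_ + _).
by rewrite -[- y]add0r -[RHS]mulN1r -PhiZ scaleN1r scaleN1r add0r.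
Qed.
Lemma PhiS a (I : Type) (r : seq I) (F : I -> M) :
  Phi a (\sum_(i <- r) F i) = \sum_(i <- r) Phi a (F i).
Proof.
by elim: r => [|i r IH]; rewrite ?big_nil ?Phi0 // !big_cons PhiD IH.
Qed.

(** The part of x supported on F. *)
Definition proj (F : seq E) x := \sum_(a <- F) Phi a x ** e a.

Lemma Phi_proj a F x : uniq F -> Phi a (proj F x) = Phi a x *+ (a \in F).
Proof.
move=> uF; rewrite PhiS; have [aF|aF] := boolP (a \in F).
  rewrite (bigD1_seq a) //= PhiZ Phi_e eqxx mulr1 big1 ?addr0 // => b ba.
  by rewrite PhiZ Phi_e eq_sym (negPf ba) mulr0.
rewrite big_seq big1 // => b bF; rewrite PhiZ Phi_e.
by case: eqP => [E|_]; rewrite ?mulr0 //; rewrite E bF in aF.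
Qed.

Lemma proj_lin F c x y : proj F (c ** x + y) = c ** proj F x + proj F y.
Proof.
rewrite /proj kscale_sumr -big_split; apply: eq_bigr => a _ /=.
by rewrite Phi_lin kscaleDl kscaleA.
Qed.

(** The truncations of x to large enough finite sets converge to x. *)
Lemma Lam_proj x k : Lam x -> exists F, uniq F /\
  forall F', uniq F' -> {subset F <= F'} ->
    exists2 y, Lam y & x = proj F' x + w ^+ k ** y.
Proof.
move=> Lx; have [F [y [Ly xE]]] := Lam_dense k Lx.
exists (undup (map snd F)); split=> [|F' uF' sF]; first exact: undup_uniq.
set z := \sum_(q <- F) _ in xE.
have zE : proj F' z = z.
  have {}sF q : q \in F -> q.2 \in F'.
    by move=> qF; apply: sF; rewrite mem_undup map_f.
  rewrite /z {xE z}; elim: F sF => [|q F IH] sF.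
    by rewrite big_nil /proj big1 // => a _; rewrite Phi0 kscale0.
  rewrite big_cons proj_lin IH; last by move=> b bF; apply: sF; rewrite inE bF orbT.
  congr (_ ** _ + _); rewrite /proj (bigD1_seq q.2) ?sF ?mem_head //=.
  rewrite Phi_e eqxx kscale1 big1 ?addr0 // => b ba.
  by rewrite Phi_e (negPf ba) kscale0.
exists (y - proj F' y).
  apply: LamB => //; apply: LamS => a _; apply: LamZ => //; exact: Phi_int.
have : proj F' x = z + w ^+ k ** proj F' y by rewrite xE addrC proj_lin zE addrC.
by move=> ->; rewrite kscaleBr -addrA {1}xE; congr (_ + _); rewrite addrC subrK.
Qed.

(** Support and leading monomial of x modulo w. The support of an element of
    the lattice is finite, and leading monomials refer to the
    degree-lexicographic order. *)
Definition in_support x a := ~ small (Phi a x).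
Definition lead x a := in_support x a /\ forall b, in_support x b -> b = a \/ mlt b a.

Lemma small_w c : O c -> small (w * c). Proof. by exists c. Qed.

Lemma lead_exists x : Lam x -> (exists2 y, Lam y & x = w ** y) \/ exists a, lead x a.
Proof.
move=> Lx; have [F [uF /(_ F uF (fun _ h => h)) [y Ly]]] := Lam_proj 1 Lx.
rewrite expr1 => xE.
have supF a : in_support x a -> a \in F.
  move=> sa; apply: contrapT => /negP aF; apply: sa; rewrite xE PhiD PhiZ.
  by rewrite Phi_proj // (negPf aF) add0r; apply/small_w/Phi_int.
have [ex|none] := pselect (exists2 a, a \in F & in_support x a).
  right; have [a [aF sa] amax] := mlt_max ex; exists a; split=> // b sb.
  by apply: amax => //; apply: supF.
left; have /choice[d dP] a : exists d, a \in F -> O d /\ Phi a x = w * d.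
  have [aF|_] := boolP (a \in F); last by exists 0.
  have [d Od dE] : small (Phi a x) by apply: contrapT => sa; apply: none; exists a.
  by exists d.
exists (\sum_(a <- F) d a ** e a + y).
  by apply: LamD => //; apply: LamS => a /dP[Od _]; apply: LamZ.
rewrite kscaleDr kscale_sumr {1}xE; congr (_ + _).
rewrite /proj big_seq [RHS]big_seq; apply: eq_bigr => a /dP[_ ->].
by rewrite kscaleA.
Qed.

(** Modulo w and lower monomials, Y g multiplies the leading monomial by the
    monomial g. *)
Lemma lead_mul g x a b : Lam x -> lead x a -> ~~ mlt b (madd g a) ->
  small (Phi b (Y g *: x) - Phi a x *+ (b == madd g a)).
Proof.
move=> Lx [sa amax] nb.
have degb : (mdeg g + mdeg a <= mdeg b)%N.
  by rewrite -mdegD leqNgt; apply: contra nb; apply: mlt_deg.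
have [F [uF /(_ F uF (fun _ h => h)) [y Ly]]] := Lam_proj 1 Lx.
rewrite expr1 => xE.
have aF : a \in F.
  apply: contrapT => /negP aF; apply: sa; rewrite xE PhiD PhiZ.
  by rewrite Phi_proj // (negPf aF) add0r; apply/small_w/Phi_int.
rewrite {1}xE scalerDr PhiD kscaleC PhiZ addrAC; apply: smallD; last first.
  by apply/small_w/Phi_int/A0L.
rewrite /proj scaler_sumr PhiS.
have -> : Phi a x *+ (b == madd g a) =
    \sum_(c <- F) (Phi a x *+ (b == madd g a)) *+ (c == a).
  by rewrite (bigD1_seq a) //= eqxx big1 ?addr0 // => c /negPf ->.
rewrite -sumrB; apply: smallS => c cF; rewrite kscaleC PhiZ.
have [sc|nsc] := pselect (small (Phi c x)).
  have /negPf -> : c != a by apply: contra_notN sa => /eqP <-.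
  rewrite subr0 mulrC; apply: smallM => //; exact/Phi_int/A0L.
have [->|lt] := amax c nsc; first by rewrite Y_e // eqxx mulr_natr subrr; apply: small0.
have /negPf -> : c != a by apply: contraTneq lt => ->; rewrite mlt_irr.
rewrite Y_e; last by apply: leq_trans degb; rewrite leq_add2l; apply: mlt_le.
have /negPf -> : b != madd g c.
  by apply: contraNneq nb => ->; apply: mltD.
by rewrite mulr0 subr0; apply: small0.
Qed.

(** One step of the division algorithm. The leading coefficient of x is a unit
    of O because it is not a multiple of w. *)
Lemma cancel_lead z b x a : Lam z -> lead z b -> Lam x -> lead x a ->
  (forall i, (a i <= b i)%N) -> exists g u, O u /\
    forall c, in_support (z - u ** (Y g *: x)) c -> mlt c b.
Proof.
move=> Lz lz Lx lx ab; pose g : E := [ffun i => (b i - a i)%N].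
have gb : madd g a = b by apply/ffunP => i; rewrite !ffunE subnK.
have [small_a|[a0 Oa]] := O_val (Phi_int a Lx); first by case: lx.
exists g, (Phi b z / Phi a x); have Ou : O (Phi b z / Phi a x).
  by apply: OM => //; apply: Phi_int.
split=> // c sc; apply: contrapT => /negP nc; apply: sc.
have := @lead_mul g x a c Lx lx; rewrite gb => /(_ nc).
rewrite PhiB PhiZ; set q := Phi c _; have [->|cb] := eqVneq c b.
  rewrite mulr1n => h; have /smallN := smallM Ou h.
  by rewrite mulrBr divfK // opprB.
rewrite mulr0n subr0 => h; apply: smallD; last by apply/smallN/smallM.
apply: contrapT => sc; have [E|lt] := lz.2 c sc; first by rewrite E eqxx in cb.
by rewrite lt in nc.
Qed.

Lemma unif_exp_neq0 k : w ^+ k != 0. Proof. exact: expf_neq0. Qed.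

(** A Groebner basis modulo w: by Dickson's lemma there are finitely many
    elements of N whose leading monomials divide those of all the others, and
    division by them terminates because the monomials are well ordered. *)
Lemma fg_mod_unif (N : set M) : submodules N -> exists B : seq M,
  (forall v, v \in B -> N v /\ Lam v) /\
  forall z, N z -> Lam z -> exists u : nat -> T, (forall i, A0 (u i)) /\
    exists2 z', N z' /\ Lam z' & z = \sum_(i < size B) u i *: B`_i + w ** z'.
Proof.
move=> hN; have NZ := submod_kscale hN.
pose P (t : M * E) := [/\ N t.1, Lam t.1 & lead t.1 t.2].
have [BB [BP hB]] := dickson s P (fun t => mkey t.2).
pose B := map fst BB.
exists B; split=> [v /mapP[t tB ->]|]; first by have [] := BP t tB.
pose gen z := exists u : nat -> T, (forall i, A0 (u i)) /\
    exists2 z', N z' /\ Lam z' & z = \sum_(i < size B) u i *: B`_i + w ** z'.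
have gen_add z t v : gen z -> A0 t -> v \in B -> gen (z + t *: v).
  move=> [u [Au [z' hz' ->]]] At vB.
  exists (fun i => u i + t *+ (i == index v B)); split.
    by move=> i; case: eqP => _; rewrite ?addr0 //; apply: A0D.
  exists z' => //; rewrite addrAC; congr (_ + _).
  under [RHS]eq_bigr do rewrite scalerDl.
  rewrite big_split /=; congr (_ + _).
  have iv : (index v B < size B)%N by rewrite index_mem.
  rewrite (bigD1 (Ordinal iv)) //= eqxx nth_index // big1 ?addr0 // => i /eqP hi.
  by case: eqP => [E|_]; [case: hi; apply: val_inj | rewrite scale0r].
have gen_w y : N (w ** y) -> Lam y -> gen (w ** y).
  move=> Nwy Ly; exists (fun=> 0); split=> [i|]; first exact: A0_0.
  exists y; first by split=> //; rewrite -(kscaleK y w0); apply: NZ.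
  by rewrite big1 ?add0r // => i _; rewrite scale0r.
have key : forall b z, N z -> Lam z -> lead z b -> gen z.
  elim/mlt_ind => b IH z Nz Lz lz.
  have [|[x a] xB ab] := hB (z, b); first by split.
  have [/= Nx Lx lx] := BP _ xB.
  have {}ab i : (a i <= b i)%N by have := ab i (ltn_ord i); rewrite !mkey_ord.
  have [g [u [Ou hs]]] := cancel_lead Lz lz Lx lx ab.
  set z' := z - _ in hs.
  have Nz' : N z' by apply: (submodB hN) => //; apply: NZ; apply: submodZ.
  have Lz' : Lam z' by apply: LamB => //; apply: LamZ => //; apply: A0L.
  have -> : z = z' + (u *: Y g) *: x by rewrite kscaleZ subrK.
  apply: gen_add; last 2 first.
  - exact: A0Z.
  - by apply/mapP; exists (x, a).
  have [[y Ly z'E]|[c lc]] := lead_exists Lz'.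
    by rewrite z'E; apply: gen_w => //; rewrite -z'E.
  by apply: (IH c) => //; apply: hs; case: lc.
move=> z Nz Lz; have [[y Ly zE]|[b lb]] := lead_exists Lz; last exact: (key b).
by have := gen_w y; rewrite -zE; apply.
Qed.

Definition closure_of (N : set M) : set M := [set x |
  forall k, exists2 n, N n & exists2 y, Lam y & x = n + w ^+ k ** y].

(** Applying fg_mod_unif repeatedly to the remainders writes an element of the
    closure as a combination of the finitely many generators B, with
    coefficients that are w-adic series of elements of A0. Since A0 is complete
    these series have sums, so the element lies in N; this is where the
    finiteness of B is essential. *)
Lemma submodule_closed (N : set M) : submodules N -> closure_of N `<=` N.
Proof.
move=> hN; have NZ := submod_kscale hN.
have [B [BN hB]] := fg_mod_unif hN.
suff key x : Lam x -> closure_of N x -> N x.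
  move=> x cx; have [k Lk] := Lam_abs x.
  rewrite -(kscaleK x (unif_exp_neq0 k)); apply: (NZ); apply: key => // j.
  have [n Nn [y Ly ->]] := cx j; exists (w ^+ k ** n); first exact: NZ.
  exists (w ^+ k ** y); first by apply: LamZ => //; apply: OX.
  by rewrite kscaleDr !kscaleA mulrC.
move=> Lx cx.
pose G z := Lam z /\ closure_of N z.
(* One step: f z gives the coefficients and the next remainder. *)
have /choice[f fP] z : exists uz : (nat -> T) * M, G z ->
    [/\ G uz.2, forall i, A0 (uz.1 i)
      & z = \sum_(i < size B) uz.1 i *: B`_i + w ** uz.2].
  have [[Lz cz]|] := pselect (G z); last by exists (fun=> 0, 0).
  have [n Nn [y Ly zE]] := cz 1; rewrite expr1 in zE.
  have Ln : Lam n by rewrite -(addrK (w ** y) n) -zE; apply: LamB => //; apply: LamZ.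
  have [u [Au [z' [Nz' Lz'] nE]]] := hB n Nn Ln.
  exists (u, z' + y) => _; split=> //=; last by rewrite kscaleDr addrA -nE.
  split; first exact: LamD.
  move=> k; have [n' Nn' [y' Ly' zE']] := cz k.+1.
  exists (z' + w^-1 ** (n' - n)).
    by apply: (submodD hN) => //; apply: NZ; apply: (submodB hN).
  exists y' => //; rewrite -addrA; congr (_ + _).
  have yE : w ** y = (n' - n) + w ^+ k.+1 ** y'.
    by rewrite addrAC -zE' zE addrC addKr.
  by rewrite -(kscaleK y w0) yE kscaleDr kscaleA exprS mulKf.
pose xs k := iter k (fun z => (f z).2) x.
have Gxs k : G (xs k) by elim: k => [//|k IH]; have [] := fP _ IH.
pose us i k := (f (xs k)).1 i.
have Aus i k : A0 (us i k) by have [_ h _] := fP _ (Gxs k); apply: h.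
have /choice[t tP] i := A0_ser (Aus i).
have xE k : x = \sum_(i < size B) (\sum_(j < k) w ^+ j *: us i j) *: B`_i + w ^+ k ** xs k.
  elim: k => [|k IH].
    rewrite expr0 kscale1 big1 ?add0r // => i _.
    by rewrite big_ord0 scale0r.
  have [_ _ E] := fP _ (Gxs k).
  rewrite [LHS]IH {1}E kscaleDr kscaleA -exprSr addrA; congr (_ + _).
  rewrite kscale_sumr -big_split; apply: eq_bigr => i _ /=.
  by rewrite big_ord_recr scalerDl /= kscaleZ.
suff -> : x = \sum_(i < size B) t i *: B`_i.
  apply: (submod_sum hN) => i _; apply: (submodZ hN).
  by have [] := BN B`_i (mem_nth _ (ltn_ord i)).
apply/eqP; rewrite -subr_eq0; apply/eqP/Lam_sep => k.
have /choice[b bP] i : exists b, A0 b /\ t i = \sum_(j < k) w ^+ j *: us i j + w ^+ k *: b.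
  by have [b] := tP i k; exists b.
exists (xs k - \sum_(i < size B) b i *: B`_i).
  apply: LamB; first by case: (Gxs k).
  rewrite -(big_mkord xpredT (fun i => b i *: B`_i)); apply: LamS => i.
  rewrite mem_index_iota /= => iB; apply: A0L; first by case: (bP i).
  by have [] := BN B`_i (mem_nth _ iB).
have -> : \sum_(i < size B) t i *: B`_i =
    \sum_(i < size B) (\sum_(j < k) w ^+ j *: us i j) *: B`_i
    + w ^+ k ** \sum_(i < size B) b i *: B`_i.
  rewrite kscale_sumr -big_split; apply: eq_bigr => i _ /=.
  by have [_ {1}->] := bP i; rewrite scalerDl kscaleZ.
by rewrite {1}(xE k) kscaleBr opprD addrACA subrr add0r.
Qed.

Variables (ht : 'I_s -> nat) (Dg : T).
Hypothesis ht_gt0 : forall i, (0 < ht i)%N.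
Definition wdeg (a : E) := (\sum_i ht i * a i)%N.
Hypothesis Dg_e : forall a, Dg *: e a = (wdeg a)%:R ** e a.

Definition upto D : seq E := undup
  [seq a <- [seq ([ffun i => val (f i)] : E) | f : {ffun 'I_s -> 'I_D.+1}]
    | (wdeg a <= D)%N].

Lemma upto_uniq D : uniq (upto D). Proof. exact: undup_uniq. Qed.

Lemma mem_upto D a : (a \in upto D) = (wdeg a <= D)%N.
Proof.
rewrite mem_undup mem_filter; have [aD /=|//] := leqP.
have aiD i : (a i < D.+1)%N.
  rewrite ltnS; apply: leq_trans aD; rewrite /wdeg (bigD1 i) //=.
  by rewrite (leq_trans _ (leq_addr _ _)) // leq_pmull.
apply/mapP; exists [ffun i => Ordinal (aiD i)]; first by rewrite mem_enum.
by apply/ffunP => i; rewrite !ffunE.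
Qed.

Definition ofdeg d := [seq a <- upto d | wdeg a == d].
Lemma ofdeg_uniq d : uniq (ofdeg d). Proof. exact/filter_uniq/upto_uniq. Qed.
Lemma mem_ofdeg d a : (a \in ofdeg d) = (wdeg a == d).
Proof.
by rewrite mem_filter mem_upto; case: eqP => //= ->; rewrite leqnn.
Qed.

Lemma proj_upto D x : proj (upto D) x = \sum_(d < D.+1) proj (ofdeg d) x.
Proof.
transitivity (\sum_(a <- upto D) \sum_(d < D.+1 | wdeg a == d) Phi a x ** e a).
  rewrite /proj big_seq [RHS]big_seq; apply: eq_bigr => a.
  rewrite mem_upto -ltnS => aD; rewrite (bigD1 (Ordinal aD)) //= big1 ?addr0 //.
  move=> i /andP[/eqP ai /eqP]; case; exact: val_inj.
rewrite (exchange_big_dep xpredT) //=; apply: eq_bigr => d _.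
rewrite -big_filter; apply: perm_big; apply: uniq_perm.
- exact/filter_uniq/upto_uniq.
- exact: ofdeg_uniq.
move=> a; rewrite mem_filter mem_upto mem_ofdeg; case: eqP => //= ->.
by rewrite -ltnS ltn_ord.
Qed.

Lemma Lam_upto x k : Lam x -> exists D0, forall D, (D0 <= D)%N ->
  exists2 y, Lam y & x = proj (upto D) x + w ^+ k ** y.
Proof.
move=> Lx; have [F [uF hF]] := Lam_proj k Lx.
exists (\max_(a <- F) wdeg a) => D hD; apply: hF; first exact: upto_uniq.
move=> a aF; rewrite mem_upto; apply: leq_trans hD.
exact: (@leq_bigmax_seq _ F xpredT wdeg a).
Qed.

(** The value in degree n of a polynomial in n that vanishes at all the
    integers from 0 to d + m except d. *)
Definition degval (n d m : nat) : K :=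
  (\prod_(i < d) (n%:R - i%:R)) * \prod_(i < m) (n%:R - d.+1%:R - i%:R).

(** The operator acting on degree n by the quotient of degval n d m by degval d
    d m. It is thus the projection to degree d, as far as degrees up to d + m
    are concerned. *)
Definition degop (T' : algType K) (Dg' : T') (d m : nat) : T' :=
  (degval d d m)^-1 *: ((\prod_(i < d) (Dg' - i%:R%:A)) *
                        \prod_(i < m) (Dg' - (d.+1%:R + i%:R)%:A)).

Lemma degval_diag d m : degval d d m = (d`!)%:R * ((-1) ^+ m * (m`!)%:R).
Proof.
rewrite /degval ffact_prodE ffactnn -neg_ffact; congr (_ * _).
by apply: eq_bigr => i _; rewrite -natr1 opprD addrA subrr sub0r.
Qed.

Lemma degval_neq0 d m : degval d d m != 0.
Proof.
rewrite degval_diag !mulf_neq0 ?char0 ?fact_gt0 //.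
by rewrite expf_neq0 // oppr_eq0 oner_eq0.
Qed.

Lemma degval_off n d m : (n <= d + m)%N -> n != d -> degval n d m = 0.
Proof.
move=> ndm nd; rewrite /degval ffact_prodE.
have [lt|gt|E] := ltngtP n d; last by rewrite E eqxx in nd.
  by rewrite ffact_small ?mul0r.
rewrite (eq_bigr (fun i : 'I_m => (n - d.+1)%:R - i%:R)) => [|i _]; last by rewrite natrB.
by rewrite ffact_prodE [X in _ * X%:R]ffact_small ?mulr0 // ltn_subLR // addSn ltnS.
Qed.

(** In degrees n greater than d the quotient is, up to sign, a product of two
    binomial coefficients. *)
Lemma degval_int n d m : O (degval n d m / degval d d m).
Proof.
have [->|nd] := eqVneq n d; first by rewrite divff ?degval_neq0.
have [lt|le] := ltnP n d.
  by rewrite degval_off ?mul0r ?(leq_trans (ltnW lt)) ?leq_addr //; apply: O0.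
have dn : (d < n)%N by rewrite ltn_neqAle eq_sym nd.
rewrite degval_diag /degval ffact_prodE.
rewrite (eq_bigr (fun i : 'I_m => (n - d.+1)%:R - i%:R)) => [|i _]; last by rewrite natrB.
rewrite ffact_prodE -!bin_ffact !natrM.
have d0 : (d`!)%:R != 0 :> K by rewrite char0 ?fact_gt0.
have m0 : (m`!)%:R != 0 :> K by rewrite char0 ?fact_gt0.
set u := 'C(n, d)%:R; set v := 'C(_, m)%:R.
have s0 : (-1) ^+ m != 0 :> K by rewrite expf_neq0 // oppr_eq0 oner_eq0.
have -> : u * (d`!)%:R * (v * (m`!)%:R) /
    ((d`!)%:R * ((-1) ^+ m * (m`!)%:R)) = u * v * (-1) ^+ m :> K.
  have ss : (-1) ^+ m * (-1) ^+ m = 1 :> K by rewrite -exprMn mulrNN mulr1 expr1n.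
  apply: (mulIf (mulf_neq0 d0 (mulf_neq0 s0 m0))); rewrite divfK ?mulf_neq0 //.
  transitivity ((-1) ^+ m * (-1) ^+ m * (u * (d`!)%:R * (v * (m`!)%:R))).
    by rewrite ss mul1r.
  by ring.
apply: OM; first by apply: OM; apply: On.
by apply: OX; rewrite -sub0r; apply: OB O0 _.
Qed.

Lemma degop_e a d m :
  degop Dg d m *: e a = (degval (wdeg a) d m / degval d d m) ** e a.
Proof.
have E k (c : 'I_k -> K) : (\prod_(i < k) (Dg - (c i)%:A)) *: e a =
    (\prod_(i < k) ((wdeg a)%:R - c i)) ** e a.
  elim: k c => [|k IH] c; first by rewrite !big_ord0 kscale1 scale1r.
  rewrite !big_ord_recr /= -scalerA scalerBl Dg_e -kscaleBl kscaleC IH.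
  by rewrite kscaleA mulrC.
rewrite kscaleZ -scalerA !E kscaleC E !kscaleA; congr (_ ** _).
rewrite -mulrA [LHS]mulrC; congr (_ / _); rewrite mulrC; congr (_ * _).
by apply: eq_bigr => i _; rewrite opprD addrA.
Qed.

(** The denominator of degop may be divisible by w, so degop need not lie in
    A0; but it takes integral values on the basis e, and on what is
    sufficiently divisible by w the denominator does not matter. *)
Lemma degop_Lam d m y : Lam y -> Lam (degop Dg d m *: y).
Proof.
move=> Ly; have [j Aj] := A0_abs (degop Dg d m).
have [F [uF /(_ F uF (fun _ h => h)) [z Lz ->]]] := Lam_proj j Ly.
rewrite scalerDr kscaleC; apply: LamD; last first.
  by rewrite -kscaleZ; apply: A0L.
rewrite scaler_sumr; apply: LamS => a _; rewrite kscaleC degop_e.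
apply: LamZ; first exact: Phi_int.
by apply: LamZ => //; apply: degval_int.
Qed.

Lemma degop_proj d m x :
  degop Dg d m *: proj (upto (d + m)) x = proj (ofdeg d) x.
Proof.
rewrite /proj scaler_sumr /ofdeg.
transitivity (\sum_(a <- upto (d + m) | wdeg a == d) Phi a x ** e a).
  rewrite [RHS]big_mkcond big_seq [RHS]big_seq; apply: eq_bigr => a.
  rewrite mem_upto => adm; rewrite kscaleC degop_e.
  have [->|ad] := eqVneq; first by rewrite divff ?degval_neq0 // kscale1.
  by rewrite degval_off // mul0r kscale0 scaler0.
rewrite -big_filter; apply: perm_big; apply: uniq_perm.
- exact/filter_uniq/upto_uniq.
- exact: ofdeg_uniq.
move=> a; rewrite mem_filter mem_upto mem_ofdeg.
by case: eqP => //= ->; rewrite leq_addr.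
Qed.

Lemma projZ F c x : proj F (c ** x) = c ** proj F x.
Proof.
rewrite /proj kscale_sumr; apply: eq_bigr => a _.
by rewrite PhiZ kscaleA.
Qed.

(** The component of z in degree d is the limit of degop Dg d m applied to z as
    m grows, and N is closed. *)
Lemma submodule_graded (N : set M) d x : submodules N -> N x ->
  N (proj (ofdeg d) x).
Proof.
move=> hN; have NZ := submod_kscale hN.
suff key z : Lam z -> N z -> N (proj (ofdeg d) z).
  move=> Nx; have [k Lk] := Lam_abs x.
  rewrite -(kscaleK (proj _ x) (unif_exp_neq0 k)) -projZ; apply: (NZ).
  by apply: key => //; apply: NZ.
move=> Lz Nz; apply: (submodule_closed hN) => k.
have [D0 hD] := Lam_upto k Lz.
have [|y Ly zE] := hD (d + D0)%N; first exact: leq_addl.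
exists (degop Dg d D0 *: z); first exact: submodZ.
exists (- (degop Dg d D0 *: y)).
  by rewrite -[- _]add0r; apply: LamB; [apply: Lam0 | apply: degop_Lam].
rewrite [in degop _ _ _ *: z]zE scalerDr degop_proj kscaleC -addrA -kscaleDr subrr.
by rewrite scaler0 addr0.
Qed.

Lemma submodule_upto (N : set M) D x : submodules N -> N x ->
  N (proj (upto D) x).
Proof.
move=> hN Nx; rewrite proj_upto; apply: (submod_sum hN) => d _.
exact: submodule_graded.
Qed.

Hypothesis cyclic_e : forall x, exists t, x = t *: e (mzero s).

Lemma ofdeg0 : ofdeg 0%N = [:: mzero s].
Proof.
apply: perm_small_eq => //; apply: uniq_perm => //; first exact: ofdeg_uniq.
move=> a; rewrite mem_ofdeg inE; apply/eqP/eqP => [a0|->]; last first.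
  by rewrite /wdeg big1 // => i _; rewrite ffunE muln0.
apply/ffunP => i; rewrite ffunE; apply/eqP; rewrite -leqn0 -a0 /wdeg.
rewrite (bigD1 i) //=; apply: leq_trans (leq_addr _ _).
exact: leq_pmull.
Qed.

(** The largest proper submodule consists of the vectors all of whose
    translates have coordinate 0 on the generator: the component in degree 0 of
    a vector of N' is a multiple of the generator and belongs to N'. *)
Lemma unique_simple_quotient : has_unique_simple_quotient M.
Proof.
pose N : set M := [set x | forall t, Phi (mzero s) (t *: x) = 0].
apply: (@largest_proper_submodule _ _ N (e (mzero s))).
- split=> [t|c x y Nx Ny t]; first by rewrite /= scaler0 Phi0.
  by rewrite scalerDr scalerA PhiD Nx Ny addr0.
- by move=> /(_ 1); rewrite scale1r Phi_e eqxx => /eqP; rewrite oner_eq0.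
move=> N' hN'; have [sub|nsub] := pselect (N' `<=` N); first by right.
left; move: nsub => /existsNP[x] /not_implyP[N'x] /existsNP[t /eqP c0].
apply/seteqP; split=> // y _; have [t' ->] := cyclic_e y.
apply: (submodZ hN').
rewrite -(kscaleK (e _) c0); apply: (submod_kscale hN').
have -> : Phi (mzero s) (t *: x) ** e (mzero s) = proj (ofdeg 0%N) (t *: x).
  by rewrite ofdeg0 /proj big_seq1.
by apply: submodule_graded => //; apply: submodZ.
Qed.

Variables (T0 : algType K) (M0 : lmodType T0) (theta : {lrmorphism T0 -> T})
  (can : {additive M0 -> M}) (e0 : E -> M0) (Dg0 : T0).
Hypotheses (canZ : forall t m, can (t *: m) = theta t *: can m)
  (can_e : forall a, can (e0 a) = e a)
  (e0_span : forall m, exists F : seq (K * E), m = \sum_(q <- F) q.1 ** e0 q.2)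
  (theta_Dg : theta Dg0 = Dg)
  (A0_theta : forall a k, A0 a -> exists t0, exists2 b, A0 b &
     a = theta t0 + w ^+ k *: b).

Lemma can_kscale c m : can (c ** m) = c ** can m.
Proof. by rewrite canZ linearZ rmorph1. Qed.

Definition proj0 F m := \sum_(a <- F) Phi a (can m) ** e0 a.

Lemma can_proj0 F m : can (proj0 F m) = proj F (can m).
Proof.
rewrite raddf_sum; apply: eq_bigr => a _ /=.
by rewrite can_kscale can_e.
Qed.

Lemma proj0_upto m : exists D0, forall D, (D0 <= D)%N -> proj0 (upto D) m = m.
Proof.
have [F mE] := e0_span m; exists (\max_(q <- F) wdeg q.2) => D hD.
have {hD} : forall q, q \in F -> q.2 \in upto D.
  move=> q qF; rewrite mem_upto; apply: leq_trans hD.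
  exact: (@leq_bigmax_seq _ F xpredT (fun q => wdeg q.2) q).
have projD m1 m2 : proj0 (upto D) (m1 + m2) = proj0 (upto D) m1 + proj0 (upto D) m2.
  rewrite /proj0 -big_split; apply: eq_bigr => a _ /=.
  by rewrite raddfD PhiD kscaleDl.
rewrite mE {mE}; elim: F => [|q F IH] FD.
  by rewrite big_nil /proj0 big1 // => a _; rewrite raddf0 Phi0 kscale0.
rewrite big_cons projD IH; last by move=> b bF; apply: FD; rewrite inE bF orbT.
congr (_ + _); rewrite /proj0 (bigD1_seq q.2) ?upto_uniq ?FD ?mem_head //=.
rewrite can_kscale can_e PhiZ Phi_e eqxx mulr1 big1 ?addr0 // => b ba.
by rewrite PhiZ Phi_e (negPf ba) mulr0 kscale0.
Qed.

(** The coordinates of can m determine m. *)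
Lemma can_inj : injective can.
Proof.
move=> m m' mm'; have [D hD] := proj0_upto m; have [D' hD'] := proj0_upto m'.
rewrite -(hD (maxn D D')) ?leq_maxl // -(hD' (maxn D D')) ?leq_maxr //.
by rewrite /proj0 mm'.
Qed.

Lemma theta_degop d m : theta (degop Dg0 d m) = degop Dg d m.
Proof.
rewrite /degop linearZ rmorphM !rmorph_prod; congr (_ *: (_ * _)).
  by apply: eq_bigr => i _; rewrite rmorphB /= theta_Dg linearZ rmorph1.
by apply: eq_bigr => i _; rewrite rmorphB /= theta_Dg linearZ rmorph1.
Qed.

Lemma classical_graded (N0 : set M0) d m : submodules N0 -> N0 m ->
  N0 (proj0 (ofdeg d) m).
Proof.
move=> hN Nm; have [D0 hD] := proj0_upto m.
suff -> : proj0 (ofdeg d) m = degop Dg0 d D0 *: m by apply: (submodZ hN).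
apply: can_inj; rewrite can_proj0 canZ theta_degop -(degop_proj d D0).
by rewrite -can_proj0 hD ?leq_addl.
Qed.

Lemma preim_submod (N : set M) : submodules N -> submodules (can @^-1` N).
Proof.
move=> [N0 NZ]; split=> [|t x y Nx Ny]; first by rewrite /= raddf0.
by rewrite /= raddfD canZ; apply: NZ.
Qed.

(** An element of N1 is the limit of its truncations, which belong to N1 by
    homogeneity and come from M0; hence it is in the closure of N2. *)
Lemma preim_sub (N1 N2 : set M) : submodules N1 -> submodules N2 ->
  can @^-1` N1 `<=` can @^-1` N2 -> N1 `<=` N2.
Proof.
move=> h1 h2 sub.
suff key x : Lam x -> N1 x -> N2 x.
  move=> x Nx; have [k Lk] := Lam_abs x.
  rewrite -(kscaleK x (unif_exp_neq0 k)); apply: (submod_kscale h2); apply: key => //.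
  exact: (submod_kscale h1).
move=> Lx Nx; apply: (submodule_closed h2) => k.
have [D /(_ D (leqnn _)) [y Ly xE]] := Lam_upto k Lx.
exists (proj (upto D) x); last by exists y.
pose m := \sum_(a <- upto D) Phi a x ** e0 a.
have mE : can m = proj (upto D) x.
  by rewrite raddf_sum; apply: eq_bigr => a _; rewrite /= can_kscale can_e.
rewrite -mE; apply: sub; rewrite /= mE.
exact: submodule_upto.
Qed.

(** The closure of the image of N0. *)
Definition completion_of (N0 : set M0) : set M := [set x |
  forall k, exists2 n, N0 n & exists2 y, Lam y & x = can n + w ^+ k ** y].

Lemma completion_submod (N0 : set M0) : submodules N0 -> submodules (completion_of N0).
Proof.
move=> hN.
have cD x y : completion_of N0 x -> completion_of N0 y -> completion_of N0 (x + y).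
  move=> cx cy k; have [n Nn [x' Lx ->]] := cx k; have [n' Nn' [y' Ly ->]] := cy k.
  exists (n + n'); first exact: (submodD hN).
  exists (x' + y'); first exact: LamD.
  by rewrite raddfD kscaleDr addrACA.
have cZ c x : completion_of N0 x -> completion_of N0 (c ** x).
  move=> cx k; have [j Oj] := O_abs c.
  have [n Nn [x' Lx ->]] := cx (j + k)%N.
  exists (c ** n); first exact: (submod_kscale hN).
  exists ((w ^+ j * c) ** x'); first exact: LamZ.
  by rewrite kscaleDr can_kscale !kscaleA exprD; congr (_ + _ ** _); ring.
have cA a x : A0 a -> completion_of N0 x -> completion_of N0 (a *: x).
  move=> Aa cx k; have [n Nn [x' Lx ->]] := cx k.
  have [j Lj] := Lam_abs (can n).
  have [t0 [b Ab aE]] := A0_theta (k + j)%N Aa.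
  exists (t0 *: n); first exact: (submodZ hN).
  exists (b *: (w ^+ j ** can n) + a *: x'); first by apply: LamD; apply: A0L.
  rewrite scalerDr {1}aE scalerDl canZ -addrA; congr (_ + _).
  by rewrite kscaleDr kscaleC kscaleZ kscaleA -exprD kscaleC.
split=> [k|t x y cx cy].
  exists 0; first by case: hN.
  by exists 0; rewrite ?raddf0 ?scaler0 ?addr0 //; apply: Lam0.
apply: (cD) => //; have [k Ak] := A0_abs t.
rewrite -(kscaleK (t *: x) (unif_exp_neq0 k)) -[w ^+ k ** _]kscaleZ.
by apply: (cZ); apply: (cA).
Qed.

(** By homogeneity it suffices to look at one degree at a time. There the
    components of elements of N0 form a subspace of a finite-dimensional space,
    and such a subspace is closed. *)
Lemma preim_completion (N0 : set M0) : submodules N0 ->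
  can @^-1` (completion_of N0) = N0.
Proof.
move=> hN; apply/seteqP; split=> [m cm|m Nm k]; last first.
  by exists m => //; exists 0; rewrite ?scaler0 ?addr0 //; apply: Lam0.
suff key d : N0 (proj0 (ofdeg d) m).
  have [D /(_ D (leqnn _)) <-] := proj0_upto m.
  suff -> : proj0 (upto D) m = \sum_(d < D.+1) proj0 (ofdeg d) m.
    by apply: (submod_sum hN).
  apply: can_inj; rewrite can_proj0 proj_upto raddf_sum.
  by apply: eq_bigr => d _; rewrite /= can_proj0.
pose F := ofdeg d; pose r := size F.
pose el (i : nat) := nth (mzero s) F i.
have projE x : proj0 F x = \sum_(i < r) Phi (el i) (can x) ** e0 (el i).
  by rewrite /proj0 (big_nth (mzero s)) big_mkord.
pose S : set 'rV[K]_r := [set v | N0 (\sum_(i < r) v 0 i ** e0 (el i))].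
have vS x : N0 x -> S (\row_i Phi (el i) (can x)).
  move=> Nx; rewrite /S /=.
  under eq_bigr do rewrite mxE.
  by rewrite -projE; apply: classical_graded.
suff : S (\row_i Phi (el i) (can m)).
  by rewrite /S /=; under eq_bigr do rewrite mxE; rewrite -projE.
apply: (subspace_closed OB OM O1 w0 Ow O_abs O_sep).
- rewrite /S /= big1; first by case: hN.
  by move=> i _; rewrite mxE kscale0.
- move=> c u v Su Sv; rewrite /S /=.
  suff -> : \sum_(i < r) (c *: u + v) 0 i ** e0 (el i) =
      c%:A *: (\sum_(i < r) u 0 i ** e0 (el i)) + \sum_(i < r) v 0 i ** e0 (el i).
    by case: hN => _; apply.
  rewrite kscale_sumr -big_split; apply: eq_bigr => i _ /=.
  by rewrite !mxE kscaleDl kscaleA.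
move=> k; have [n Nn [y Ly mE]] := cm k.
exists (\row_i Phi (el i) (can n)); first exact: vS.
move=> i; exists (Phi (el i) y); first exact: Phi_int.
by rewrite !mxE mE PhiD PhiZ addrC addKr.
Qed.

Lemma submodule_correspondence : exists Psi : set M -> set M0,
  [/\ set_bij (submodules (M := M)) (submodules (M := M0)) Psi,
      forall N, submodules N -> Psi N = can @^-1` N
    & forall N N', submodules N -> submodules N' ->
        (N `<=` N' <-> Psi N `<=` Psi N')].
Proof.
exists (fun N => can @^-1` N); split=> //; last first.
  move=> N N' hN hN'; split=> [sub x|]; [exact: sub | exact: preim_sub].
split.
- by move=> N; apply: preim_submod.
- move=> N N'; rewrite !inE => hN hN' E; apply/seteqP; split.
    by apply: preim_sub => //; rewrite E.
  by apply: preim_sub => //; rewrite E.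
- move=> N0 hN; exists (completion_of N0); first exact: completion_submod.
  exact: preim_completion.
Qed.

Theorem lattice_module_submodules :
  (exists Psi : set M -> set M0,
    [/\ set_bij (submodules (M := M)) (submodules (M := M0)) Psi,
        forall N, submodules N -> Psi N = can @^-1` N
      & forall N N', submodules N -> submodules N' ->
          (N `<=` N' <-> Psi N `<=` Psi N')]) /\
  has_unique_simple_quotient M.
Proof.
by split; [apply: submodule_correspondence | apply: unique_simple_quotient].
Qed.

End Lattice.

(** * Ordered monomials span an enveloping algebra *)

Section EnvSpan.
Variables (k : comNzRingType) (L : lieAlg k) (U : envAlg L).
Variables (I : finType) (x : I -> L).
Hypothesis x_span : forall z, exists c : I -> k, z = \sum_i c i *: x i.
Local Notation X := (fun i => env_in U (x i)).

Lemma env_in_span z : lspan (range X) (env_in U z).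
Proof.
have [c ->] := x_span z; rewrite raddf_sum /=.
apply: (submod_sum (lspan_submod _)) => i _; rewrite linearZ /=.
by apply: (submodZ (lspan_submod _)); apply: lspan_gen; exists i.
Qed.

Lemma env_comm i j : lspan (range X) (X i * X j - X j * X i).
Proof. by rewrite -env_lie; apply: env_in_span. Qed.

Lemma env_words u : words X setT u.
Proof.
apply: (env_ind (S := words X setT)) u => [|z]; last first.
  apply: lspan_sub (env_in_span z) => _ [i _ <-].
  by exists [:: i] => //; rewrite wprod_cons wprod_nil mulr1.
have hW := words_submod X setT; split.
- by rewrite -(wprod_nil X); apply: words_gen.
- by case: hW.
- by move=> a b; apply: wordsM.
Qed.
End EnvSpan.

Lemma words_size (k : comNzRingType) (A : algType k) (I : eqType) (x : I -> A) u :
  words x setT u -> exists n, words x [set w | (size w < n)%N] u.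
Proof.
elim=> [|r _ y [w _ <-] _ [n hn]]; first by exists 0%N; constructor.
exists (maxn n (size w).+1); have hW := words_submod x.
have [_ SZ] := hW [set w0 | (size w0 < maxn n (size w).+1)%N].
apply: SZ; first by apply: words_gen; rewrite /= leq_max leqnn orbT.
by apply: words_sub hn => v /= vn; rewrite leq_max vn.
Qed.

Section OneFamily.
Variables (k : comNzRingType) (L : lieAlg k) (U : envAlg L).
Variables (t : nat) (b : 'I_t -> L).
Hypothesis b_span : forall z, exists c : 'I_t -> k, z = \sum_i c i *: b i.
Local Notation B := (fun i => env_in U (b i)).

Lemma pbw_span1 u : lspan (range (mon B)) u.
Proof.
have [n hn] := words_size (env_words b_span u).
have := normal_words (env_comm U b_span) (nf := fun w => mword (mcont w)) (@mcontK t) hn.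
by apply: lspan_sub => _ [_ [w _ <-] <-]; exists (mcont w).
Qed.
End OneFamily.

Section TwoFamilies.
Variables (k : comNzRingType) (L : lieAlg k) (U : envAlg L).
Variables (s t : nat) (y : 'I_s -> L) (b : 'I_t -> L).
Definition both (T : Type) (f : 'I_s -> T) (h : 'I_t -> T) (i : 'I_s + 'I_t) :=
  match i with inl j => f j | inr j => h j end.
Local Notation x := (both y b).
Hypothesis x_span : forall z, exists c : 'I_s + 'I_t -> k, z = \sum_i c i *: x i.
Local Notation Y := (fun i => env_in U (y i)).
Local Notation B := (fun i => env_in U (b i)).
Local Notation X := (fun i => env_in U (x i)).
Local Notation E := ({ffun 'I_s -> nat} * {ffun 'I_t -> nat})%type.

(** Words in which the letters from the first family come first; these normal
    forms separate a monomial in y from a monomial in b. *)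
Definition word2 (ab : E) : seq ('I_s + 'I_t) :=
  map inl (mword ab.1) ++ map inr (mword ab.2).
Definition mon2 (ab : E) : U := mon Y ab.1 * mon B ab.2.

Lemma mon2E ab : mon2 ab = wprod X (word2 ab).
Proof. by rewrite /word2 wprod_cat !wprod_map. Qed.

Lemma size_word2 ab : size (word2 ab) = (mdeg ab.1 + mdeg ab.2)%N.
Proof. by rewrite size_cat !size_map !size_mword. Qed.

Definition cont2 (w : seq ('I_s + 'I_t)) : E :=
  ([ffun i => count_mem (inl i) w], [ffun i => count_mem (inr i) w]).

Lemma count_word2 ab i : count_mem i (word2 ab) = both ab.1 ab.2 i.
Proof.
rewrite count_cat !count_map; case: i => i /=.
  rewrite [X in (_ + X)%N](@eq_count _ _ pred0) ?count_pred0 ?addn0 //.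
  by rewrite -(count_mword ab.1); apply: eq_count => j /=; rewrite (inj_eq (@inl_inj _ _)).
rewrite [X in (X + _)%N](@eq_count _ _ pred0) ?count_pred0 ?add0n //.
by rewrite -(count_mword ab.2); apply: eq_count => j /=; rewrite (inj_eq (@inr_inj _ _)).
Qed.

Lemma cont2K w : perm_eq w (word2 (cont2 w)).
Proof. by apply/perm_count => i; rewrite count_word2; case: i => i /=; rewrite ffunE. Qed.

Lemma word2_inj a c : perm_eq (word2 a) (word2 c) -> a = c.
Proof.
move=> /perm_count h; case: a c h => [a1 a2] [c1 c2] h; congr (_, _).
  by apply/ffunP => i; have := h (inl i); rewrite !count_word2.
by apply/ffunP => i; have := h (inr i); rewrite !count_word2.
Qed.

Lemma pbw_span_lt n u : words X [set w | (size w < n)%N] u ->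
  lspan (mon2 @` [set ab | (mdeg ab.1 + mdeg ab.2 < n)%N]) u.
Proof.
move=> hn.
have := normal_words (env_comm U x_span) (nf := fun w => word2 (cont2 w)) cont2K hn.
apply: lspan_sub => _ [_ [w wn <-] <-]; exists (cont2 w); last by rewrite mon2E.
by move: wn; rewrite /= (perm_size (cont2K w)) size_word2.
Qed.

Lemma pbw_span u : lspan (range mon2) u.
Proof.
have [n /pbw_span_lt] := words_size (env_words x_span u).
by apply: lspan_sub => _ [ab _ <-]; exists ab.
Qed.

(** Sorting the product of two monomials in y produces, besides their product,
    only terms of smaller total degree. As y need not span a subalgebra,
    letters b may occur in them. *)
Lemma monM_straighten g a :
  lspan (mon2 @` [set ab | (mdeg ab.1 + mdeg ab.2 < mdeg g + mdeg a)%N])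
  (mon Y g * mon Y a - mon Y (madd g a)).
Proof.
have := straighten (env_comm U x_span)
  (perm_map (@inl 'I_s 'I_t) (mwordD g a)).
rewrite map_cat wprod_cat !wprod_map size_cat !size_map !size_mword.
exact: pbw_span_lt.
Qed.
End TwoFamilies.

(** * Linear forms on enveloping algebras and on base changes *)

(** Subtracting constants makes the functions vanish at the unit without
    changing their derivatives there. *)
Lemma lie_dual (R : idomainType) (G : hopfAlg R) (g : lieOf G) (I : finType)
    (x : I -> g) :
  (forall c, \sum_i c i *: x i = 0 -> forall i, c i = 0) ->
  exists2 c : R, c != 0 & exists f : I -> G,
    (forall i, counit (f i) = 0) /\ forall i j, lie_ev (x i) (f j) = c *+ (i == j).
Proof.
move=> xf.
have evS (c : I -> R) a : lie_ev (\sum_i c i *: x i) a = \sum_i c i * lie_ev (x i) a.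
  elim/big_rec2: _ => [|i u v _ <-]; first exact: lie_ev0.
  by rewrite lie_evD lie_evZ.
have [i||c c0 [f fE]] := @dual_family R G #|I| (fun i => lie_ev (x (enum_val i))).
- exact: ev_lin.
- move=> c cE i; rewrite -(enum_valK i).
  apply: (xf (fun j => c (enum_rank j))); apply: lie_ev_inj => a.
  rewrite evS lie_ev0 -[RHS](cE a) (reindex (@enum_val _ I)) /=; last first.
    exact/onW_bij/enum_val_bij.
  by apply: eq_bigr => j _; rewrite enum_valK.
exists c => //; exists (fun i => f (enum_rank i) - (counit (f (enum_rank i)) : R)%:A).
have epsA (r : R) : counit (r%:A : G) = r.
  by rewrite linearZ rmorph1; apply: mulr1.
split=> [i|i j]; first by rewrite raddfB /= epsA subrr.
rewrite raddfB /= evZ ev_one mulr0 subr0.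
by have := fE (enum_rank i) (enum_rank j); rewrite enum_rankK (inj_eq enum_rank_inj).
Qed.

Lemma pbw_free2 (R : idomainType) (G : hopfAlg R) (g : lieOf G) (s t : nat)
    (y : 'I_s -> g) (b : 'I_t -> g) (U : envAlg g) :
  (forall n : nat, (0 < n)%N -> n%:R != 0 :> R) ->
  (forall c, \sum_i c i *: both y b i = 0 -> forall i, c i = 0) ->
  free_on (@mon2 R g U s t y b).
Proof.
move=> char0 xf; have [c c0 [f [f0 fE]]] := lie_dual xf.
move=> S d us E; apply: (pbw_free char0 c0 f0 fE (U := U) (@word2_inj s t) us).
by rewrite -[RHS]E; apply: eq_bigr => ab _; rewrite mon2E.
Qed.

Section AlgFracFunctional.
Variables (R : idomainType) (A : algType R) (B : algFrac A).
Local Notation K := {fraction R}.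

Lemma algFrac_frac p (pi : R) (hR : complete_dvr_mixed p pi) (t : B) :
  exists k a, tofrac pi ^+ k *: t = af_in B a.
Proof.
have pX k : tofrac pi ^+ k = tofrac (pi ^+ k) :> K by rewrite tofracXn.
apply: (algFrac_ind (S := [set t : B | exists k a,
  tofrac pi ^+ k *: t = af_in B a])) t; last first.
  by move=> a; exists 0%N, a; rewrite expr0 scale1r.
split.
- by exists 0%N, 1; rewrite expr0 scale1r rmorph1.
- move=> c x y [k [a xa]] [l [a' ya]]; have [m [r cr]] := frac_denom hR c.
  exists (m + k + l)%N, ((pi ^+ l * r) *: a + pi ^+ (m + k) *: a').
  rewrite rmorphD !af_in_lin -xa -ya scalerDr !scalerA; congr (_ *: _ + _ *: _).
    by rewrite tofracM -cr -pX [in LHS]addnC !exprD !mulrA [_ * c * _]mulrAC.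
  by rewrite -pX -exprD.
- move=> x y [k [a xa]] [l [a' ya]]; exists (k + l)%N, (a * a').
  by rewrite rmorphM -xa -ya -scalerAl -scalerAr scalerA exprD.
Qed.

Definition frac_maps : set (A -> K^o) := [set f |
  forall r x y, f (r *: x + y) = tofrac r * f x + f y].

Fact frac_maps_submod : submodules frac_maps.
Proof.
split=> [r x y|c f h hf hh r x y] /=; first by rewrite (mulr0 (tofrac r)) addr0.
suff E : c * f (r *: x + y) + h (r *: x + y) =
  tofrac r * (c * f x + h x) + (c * f y + h y) :> K by exact: E.
by rewrite hf hh mulrDr mulrCA addrACA -mulrDr.
Qed.

(** A acts by right translation on the linear forms with values in K; by the
    universal property so does its base change B, and the extension of phi maps
    b to the value at 1 of its translate by b. *)
Lemma algFrac_functional (phi : {linear A -> R^o}) :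
  exists psi : {linear B -> K^o}, forall a, psi (af_in B a) = tofrac (phi a : R).
Proof.
(* A nonzero form is required for the algebra of endomorphisms. *)
have [[a0 phia0]|none] := pselect (exists a, (phi a : R) != 0); last first.
  have z_lin : linear (fun _ : B => 0 : K^o).
    by move=> r x y /=; rewrite scaler0 addr0.
  pose z : {linear B -> K^o} := HB.pack (fun _ : B => 0 : K^o)
    (GRing.isLinear.Build _ _ _ _ (fun _ : B => 0 : K^o) z_lin).
  exists z => a; apply/esym/eqP; rewrite /z /= tofrac_eq0.
  by apply/negPn/negP => h; apply: none; exists a.
pose V := submod frac_maps_submod.
pose mkV f (hf : frac_maps f) : V := exist _ f (asboolT hf).
have fm f (v : V) : submod_val v = f -> frac_maps f.
  by move=> <-; apply: submod_in.
have phi_frac : frac_maps (fun a => tofrac (phi a : R) : K^o).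
  by move=> r x y; rewrite linearP rmorphD rmorphM.
pose v0 := mkV _ phi_frac.
have v0_neq0 : v0 <> 0.
  move=> /(congr1 (fun v : V => submod_val v a0)) /= /eqP.
  by rewrite /submod_val raddf0 /= tofrac_eq0 (negPf phia0).
pose W := endo v0_neq0.
have trP (c : A) (v : V) : frac_maps (fun x => submod_val v (x * c)).
  by move=> r x y; rewrite mulrDl -scalerAl (fm _ v erefl).
pose ev (v : V) (x : A) : K := submod_val v x.
have Vext v v' : ev v =1 ev v' -> v = v'.
  by move=> h; apply: val_inj; apply/funext.
have evP r v v' x : ev (r *: v + v') x = r * ev v x + ev v' x.
  by rewrite /ev linearP.
have evD v v' x : ev (v + v') x = ev v x + ev v' x.
  by have := evP 1 v v' x; rewrite scale1r mul1r.
have ev00 x : ev 0 x = 0.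
  by have := evP (-1) v0 v0 x; rewrite scaleN1r addNr mulN1r addNr.
have evN v x : ev (- v) x = - ev v x.
  by have := evP (-1) v 0 x; rewrite scaleN1r addr0 mulN1r ev00 addr0.
have evZ r v x : ev (r *: v) x = r * ev v x.
  by have := evP r v 0 x; rewrite ev00 !addr0.
have evA v r x y : ev v (r *: x + y) = tofrac r * ev v x + ev v y.
  exact: (fm _ v erefl).
have ev0 v : ev v 0 = 0.
  by have := evA v (-1) 0 0; rewrite scaler0 addr0 rmorphN rmorph1 mulN1r addNr.
pose tr (c : A) (v : V) := mkV _ (trP c v).
have trE c v x : ev (tr c v) x = ev v (x * c) by [].
have tr_lin c : linear (tr c).
  by move=> r v v'; apply: Vext => x; rewrite evP !trE evP.
pose rh (c : A) : W := mk_endo v0_neq0 (tr_lin c).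
have rhE c v : endo_fun (rh c) v = tr c v by [].
have rhB : zmod_morphism rh.
  move=> c d; apply: endo_ext => v; apply: Vext => x.
  rewrite endoD endoN evD evN !rhE !trE mulrBr addrC -[- (x * d)]scaleN1r evA.
  by rewrite rmorphN rmorph1 mulN1r addrC.
have rhM : monoid_morphism rh.
  split=> [|c d]; apply: endo_ext => v; apply: Vext => x.
    by rewrite endo_1E rhE trE mulr1.
  by rewrite endo_mulE !rhE !trE mulrA.
pose rho : {rmorphism A -> W} := HB.pack rh (GRing.isZmodMorphism.Build _ _ rh rhB)
    (GRing.isMonoidMorphism.Build _ _ rh rhM).
have rho_lin : frac_linear rho.
  move=> r c; apply: endo_ext => v; apply: Vext => x.
  rewrite endoZ evZ !rhE !trE -scalerAr.
  by have := evA v r (x * c) 0; rewrite addr0 ev0 addr0.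
have [F [hF _]] := af_univ B rho_lin.
pose psi (b : B) : K^o := ev (endo_fun (F b) v0) 1.
have psi_lin : linear psi.
  by move=> r x y; rewrite /psi linearP endoD endoZ evP.
pose Psi : {linear B -> K^o} :=
  HB.pack psi (GRing.isLinear.Build _ _ _ _ psi psi_lin).
exists Psi => a; rewrite -[Psi _]/(ev (endo_fun (F (af_in B a)) v0) 1) hF.
rewrite -[rho a]/(rh a) rhE trE mul1r.
by [].
Qed.
End AlgFracFunctional.

(** * Modules induced from a character *)

Section CharInduced.
Variables (K : fieldType) (S T : algType K) (j : {lrmorphism S -> T}).
Variables (chi : {lrmorphism S -> K^o}) (I : inducedMod j (charMod chi)).

Definition ivec : I := im_tens I 1 (1 : K).

Lemma ind_tens t (c : K) : im_tens I t c = (t * c%:A) *: ivec.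
Proof.
have [_ _ b3] := im_balanced I.
rewrite /ivec -im_scale mulr1 -(rmorph1 j) -linearZ b3; congr (im_tens I t _).
have : (chi c%:A : K) * 1 = c by rewrite linearZ rmorph1 mulr1; apply: mulr1.
by move=> /esym.
Qed.

Lemma ind_gen x : exists t, x = t *: ivec.
Proof.
apply: (inducedMod_ind (I := I) (P := [set x | exists t, x = t *: ivec])) x.
  split; first by exists 0; rewrite scale0r.
  by move=> _ _ [t ->] [t' ->]; exists (t - t'); rewrite scalerBl.
by move=> t c; exists (t * (c : K)%:A); rewrite ind_tens.
Qed.

Lemma ind_char s : j s *: ivec = (chi s : K) ** ivec.
Proof.
have [_ _ b3] := im_balanced I.
rewrite -[j s *: ivec]im_scale mulr1 -[j s]mul1r b3 ind_tens mul1r.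
congr (_%:A *: _); exact: mulr1.
Qed.

(** A linear form on T that transforms under the right action of S by the
    character factors through the induced module. *)
Lemma ind_functional (psi : {linear T -> K^o}) :
  (forall t s, (psi (t * j s) : K) = (psi t : K) * chi s) ->
  exists Phi : I -> K, (forall c x y, Phi (c ** x + y) = c * Phi x + Phi y) /\
    forall t, Phi (t *: ivec) = psi t.
Proof.
move=> psij.
have psiZ c t : (psi (c *: t) : K) = c * psi t by rewrite linearZ.
have psiD t t' : (psi (t + t') : K) = (psi t : K) + psi t' by rewrite raddfD.
have bal : balanced j (fun (t : T) (n : charMod chi) => (n : K) * psi t).
  split=> [t t' n|t n n'|t s n].
  - by rewrite psiD mulrDr.
  - exact: mulrDl.
  - by rewrite psij -[s *: n]/((chi s : K) * (n : K)) mulrA mulrC mulrA.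
have [F [hF _]] := im_univ I bal.
have FE t : F (t *: ivec) = psi t by rewrite -[t *: _]im_scale mulr1 hF mul1r.
exists F; split=> // c x y; rewrite raddfD; congr (_ + _).
have [t ->] := ind_gen x.
by rewrite scalerA -scalerAl mul1r !FE psiZ.
Qed.
End CharInduced.

(** If the value at s were not integral it would be the inverse of some pi r.
    Then the character would vanish on 1 - pi r s, which is invertible by the
    geometric series. *)
Lemma cpl_char_integral (R : idomainType) (p : nat) (pi : R)
    (hR : complete_dvr_mixed p pi) (U : algType R) (C : adicCompletion pi U)
    (B : algFrac C) (chi : {lrmorphism B -> {fraction R}^o}) (s : C) :
  exists r, (chi (af_in B s) : {fraction R}) = tofrac r.
Proof.
have [[r rE]|[r rE]] := frac_val hR (chi (af_in B s)); first by exists r.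
have [t tE] := cpl_geometric (r *: s).
have chiM x y : (chi (x * y) : {fraction R}) = (chi x : {fraction R}) * chi y.
  by rewrite rmorphM.
have chiZ c x : (chi (c *: x) : {fraction R}) = c * chi x by rewrite linearZ.
have chiB x y : (chi (x - y) : {fraction R}) = (chi x : {fraction R}) - chi y.
  by rewrite raddfB.
have chi1 : (chi 1 : {fraction R}) = 1 by rewrite rmorph1.
have := congr1 (fun x => chi (af_in B x) : {fraction R}) tE.
rewrite rmorphM chiM rmorphB rmorph1 !af_in_lin chiB chi1 !chiZ.
rewrite mulrA rE subrr mulr0.
by move/eqP; rewrite eq_sym oner_eq0.
Qed.

(** Linear forms on the completion are continuous, and U is dense. *)
Lemma cpl_linear_eq0 (R : idomainType) (p : nat) (pi : R)
    (hR : complete_dvr_mixed p pi) (U : algType R) (C : adicCompletion pi U)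
    (f : C -> R^o) : linear f -> (forall u, f (cpl_in C u) = 0) -> forall x, f x = 0.
Proof.
move=> fl f0 x; apply: (dvr_sep hR) => k.
have [u [y ->]] := cpl_dense x k; exists (f y).
by rewrite addrC fl f0 addr0.
Qed.

(** * The lattice and the coordinates of the affinoid Verma module *)

Lemma linear_lspan0 (R : comNzRingType) (V : lmodType R) (f : V -> R^o) (S : set V) :
  linear f -> (forall x, S x -> f x = 0) -> forall x, lspan S x -> f x = 0.
Proof.
move=> fl f0 x; elim=> [|r x' y Sx _ IH]; last by rewrite fl f0 // IH scaler0 addr0.
exact: lin0 fl.
Qed.

Lemma sum_mword s (ht : 'I_s -> nat) a : (\sum_(i <- mword a) ht i)%N = wdeg ht a.
Proof.
rewrite big_flatten big_map big_enum /=; apply: eq_bigr => i _.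
by rewrite big_nseq iter_addn_0.
Qed.

Section Verma.
Variables (R : idomainType) (p : nat) (pi : R).
Hypothesis hR : complete_dvr_mixed p pi.
Variables (G : hopfAlg R) (D : triangular G) (lam : {linear tr_h D -> R^o}).
Variables (Ugh : affEnv pi (tr_g D)) (Mh : affVerma lam Ugh).
Variables (H : tr_bp D) (s t : nat) (y : 'I_s -> tr_g D) (ht : 'I_s -> nat)
  (b : 'I_t -> tr_bp D).
Local Notation x := (both y (fun i => tr_bp_in D (b i))).
Hypotheses (Hy : forall i, lbr (tr_bp_in D H) (y i) = - (ht i)%:R *: y i)
  (b_span : forall z, exists c : 'I_t -> R, z = \sum_i c i *: b i)
  (x_span : forall z, exists c : 'I_s + 'I_t -> R, z = \sum_i c i *: x i)
  (x_free : forall c : 'I_s + 'I_t -> R, \sum_i c i *: x i = 0 -> forall i, c i = 0).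

Local Notation K := {fraction R}.
Local Notation U := (ae_env Ugh).
Local Notation C := (ae_cpl Ugh).
Local Notation Ub := (ae_env (av_Eb Mh)).
Local Notation Cb := (ae_cpl (av_Eb Mh)).
Local Notation jc := (aem_cpl (av_map Mh)).
Local Notation j := (aem_map (av_map Mh)).
Local Notation chi := (av_chi Mh).
Local Notation E := {ffun 'I_s -> nat}.
Local Notation Y := (fun i => env_in U (y i)).
Local Notation B := (fun i => env_in U (tr_bp_in D (b i))).
Local Notation Bb := (fun i => env_in Ub (b i)).
Local Notation monYB := (mon2 U y (fun i => tr_bp_in D (b i))).

(** The character of the Borel subalgebra on the integral completion. *)
Definition int_char (z : Cb) : R := sval (cid (cpl_char_integral hR chi z)).

Lemma int_charE z : (chi (af_in (av_Eb Mh) z) : K) = tofrac (int_char z).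
Proof. exact: svalP (cid (cpl_char_integral hR chi z)). Qed.

Lemma int_char_eq z r : (chi (af_in (av_Eb Mh) z) : K) = tofrac r -> int_char z = r.
Proof. by rewrite int_charE => /eqP; rewrite tofrac_eq => /eqP. Qed.

Lemma int_char_lin : linear (int_char : Cb -> R^o).
Proof.
move=> r z z'; apply: int_char_eq; rewrite rmorphD af_in_lin.
have chiD u v : (chi (u + v) : K) = (chi u : K) + chi v by rewrite raddfD.
have chiZ c u : (chi (c *: u) : K) = c * chi u by rewrite linearZ.
by rewrite chiD chiZ !int_charE -tofracM -tofracD.
Qed.

Lemma int_char_linE r z z' : int_char (r *: z + z') = r * int_char z + int_char z'.
Proof. exact: int_char_lin. Qed.

Lemma int_charM z z' : int_char (z * z') = int_char z * int_char z'.
Proof.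
apply: int_char_eq; rewrite rmorphM tofracM -!int_charE.
exact: (rmorphM chi).
Qed.

Lemma int_char1 : int_char 1 = 1.
Proof. by apply: int_char_eq; rewrite !rmorph1. Qed.

Lemma dvr_natr_neq0 n : (0 < n)%N -> n%:R != 0 :> R. Proof. exact: (dvr_char0 hR). Qed.

Lemma cpl_coord_exists (a : E) : exists cpl_coord : {linear C -> R^o}, forall ab,
  cpl_coord (cpl_in C (monYB ab)) = (ab.1 == a)%:R * int_char (cpl_in Cb (mon Bb ab.2)).
Proof.
have ff := pbw_free2 (U := U) dvr_natr_neq0 x_free.
have [phi0 phi0E] := basis_functional
  (fun ab => (ab.1 == a)%:R * int_char (cpl_in Cb (mon Bb ab.2)))
  (pbw_span x_span (U := U)) ff.
have [cpl_coord cpl_coordE] := cpl_functional hR C phi0.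
by exists cpl_coord => ab; rewrite cpl_coordE phi0E.
Qed.

(** The coordinate along the monomial with exponents a of the image in the
    Verma module. An ordered monomial contributes only if its factor in y has
    the exponents a, and then by the value of the character on its factor from
    the Borel subalgebra. This is extended by linearity and continuity. *)
Definition cpl_coord a := sval (cid (cpl_coord_exists a)).

Lemma cpl_coordE a ab :
  cpl_coord a (cpl_in C (monYB ab)) = (ab.1 == a)%:R * int_char (cpl_in Cb (mon Bb ab.2)).
Proof. exact: (svalP (cid (cpl_coord_exists a))). Qed.

Lemma bcpl_word (w : seq 'I_t) : jc (cpl_in Cb (wprod Bb w)) = cpl_in C (wprod B w).
Proof.
rewrite !rmorph_wprod; apply: eq_bigr => i _ /=.
exact: aem_cplP.
Qed.

Lemma cpl_coord_lin a r u v :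
  (cpl_coord a (r *: u + v) : R) = r * cpl_coord a u + cpl_coord a v.
Proof. by rewrite linearP. Qed.

Lemma cpl_coord_mon_char a a' z :
  cpl_coord a (cpl_in C (mon Y a') * jc z) = (a' == a)%:R * int_char z.
Proof.
pose f z : R^o :=
  (cpl_coord a (cpl_in C (mon Y a') * jc z) : R) - (a' == a)%:R * int_char z.
have f_lin : linear f.
  move=> r u v; rewrite /f linearP mulrDr -scalerAr cpl_coord_lin int_char_linE.
  by rewrite -[RHS]/(r * _ + _) mulrDr mulrBr opprD addrACA mulrCA.
apply/eqP; rewrite -subr_eq0; apply/eqP; apply: (cpl_linear_eq0 hR f_lin) => u.
apply: (linear_lspan0 (f := fun u => f (cpl_in Cb u)) _ _ (pbw_span1 b_span u)).
  by move=> r v v'; rewrite linearP f_lin.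
move=> _ [be _ <-]; rewrite /f bcpl_word -rmorphM -[mon Y a' * _]/(monYB (a', be)).
by rewrite cpl_coordE subrr.
Qed.

(** By construction this holds for monomials, and both sides are linear and
    continuous in c and in z. *)
Lemma cpl_coord_char a c z : cpl_coord a (c * jc z) = (cpl_coord a c : R) * int_char z.
Proof.
pose f c : R^o := (cpl_coord a (c * jc z) : R) - (cpl_coord a c : R) * int_char z.
have f_lin : linear f.
  move=> r u v; rewrite /f mulrDl -scalerAl !cpl_coord_lin -[RHS]/(r * _ + _).
  by rewrite mulrDl mulrBr opprD addrACA mulrA.
apply/eqP; rewrite -subr_eq0; apply/eqP; apply: (cpl_linear_eq0 hR f_lin) => u.
apply: (linear_lspan0 (f := fun u => f (cpl_in C u)) _ _ (pbw_span x_span u)).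
  by move=> r v v'; rewrite linearP f_lin.
move=> _ [[a' be] _ <-]; rewrite /f cpl_coordE /=.
have -> : cpl_in C (monYB (a', be)) = cpl_in C (mon Y a') * jc (cpl_in Cb (mon Bb be)).
  by rewrite bcpl_word -rmorphM.
by rewrite -mulrA -rmorphM cpl_coord_mon_char int_charM mulrA subrr.
Qed.

Lemma aff_coord_exists a : exists aff_coord : {linear Ugh -> K^o},
  forall c, aff_coord (af_in Ugh c) = tofrac (cpl_coord a c : R).
Proof. exact: algFrac_functional. Qed.

(** The same coordinate after inverting pi, and below on the Verma module
    itself. *)
Definition aff_coord a := sval (cid (aff_coord_exists a)).
Lemma aff_coordE a c : aff_coord a (af_in Ugh c) = tofrac (cpl_coord a c : R).
Proof. exact: (svalP (cid (aff_coord_exists a))). Qed.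

Lemma aff_coord_char a u z : (aff_coord a (u * j z) : K) = (aff_coord a u : K) * chi z.
Proof.
have [k [c uE]] := algFrac_frac hR u; have [l [d zE]] := algFrac_frac hR z.
have pZ q v : (aff_coord a (q *: v) : K) = q * aff_coord a v by rewrite linearZ.
have cZ q v : (chi (q *: v) : K) = q * chi v by rewrite linearZ.
have jZ q v : j (q *: v) = q *: j v by rewrite linearZ.
apply: (mulfI (expf_neq0 (k + l) (unifK_neq0 hR))).
rewrite -pZ exprD -scalerA [in RHS]mulrACA -cZ -pZ uE zE.
rewrite int_charE aff_coordE -tofracM -cpl_coord_char.
by rewrite -aff_coordE rmorphM -aem_mapP -zE jZ -uE -scalerAl -scalerAr.
Qed.

Notation v := (ivec (av_mod Mh)).

Lemma verma_coord_exists a : exists verma_coord : Mh -> K,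
  (forall c u w, verma_coord (c ** u + w) = c * verma_coord u + verma_coord w) /\
  forall u, verma_coord (u *: v) = aff_coord a u.
Proof. exact: ind_functional (aff_coord_char a). Qed.

Definition verma_coord a := sval (cid (verma_coord_exists a)).
Lemma verma_coord_lin a c u w :
  verma_coord a (c ** u + w) = c * verma_coord a u + verma_coord a w.
Proof. exact: (svalP (cid (verma_coord_exists a))).1. Qed.
Lemma verma_coordE a u : verma_coord a (u *: v) = aff_coord a u.
Proof. exact: (svalP (cid (verma_coord_exists a))).2. Qed.

Definition env_aff (u : U) : Ugh := af_in Ugh (cpl_in C u).
Definition verma_basis a : Mh := env_aff (mon Y a) *: v.

Lemma verma_coord_env a u :
  verma_coord a (env_aff u *: v) = tofrac (cpl_coord a (cpl_in C u) : R).
Proof. by rewrite verma_coordE aff_coordE. Qed.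

Lemma cpl_coord_mon a a' : cpl_coord a (cpl_in C (mon Y a')) = (a' == a)%:R.
Proof.
have := cpl_coord_mon_char a a' 1.
by rewrite rmorph1 mulr1 int_char1 mulr1.
Qed.

Lemma verma_coord_basis a a' : verma_coord a (verma_basis a') = (a == a')%:R.
Proof. by rewrite verma_coord_env cpl_coord_mon rmorph_nat eq_sym. Qed.
Lemma char_vec w :
  env_aff (wprod B w) *: v = tofrac (int_char (cpl_in Cb (wprod Bb w))) ** v.
Proof. by rewrite -int_charE -ind_char aem_mapP bcpl_word. Qed.

Lemma mon2_vec ab : env_aff (monYB ab) *: v =
  tofrac (int_char (cpl_in Cb (mon Bb ab.2))) ** verma_basis ab.1.
Proof. by rewrite /env_aff !rmorphM -scalerA -/(env_aff _) char_vec kscaleC. Qed.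

Lemma env_aff_lin r u u' : env_aff (r *: u + u') = tofrac r *: env_aff u + env_aff u'.
Proof. by rewrite /env_aff linearP rmorphD af_in_lin. Qed.

Lemma env_aff_span u : exists F : seq (K * E),
  env_aff u *: v = \sum_(q <- F) q.1 ** verma_basis q.2.
Proof.
elim: (pbw_span x_span u) => [|r _ u' [ab _ <-] _ [F IH]].
  exists [::]; rewrite big_nil /env_aff raddf0 /= raddf0 /=.
  exact: scale0r.
exists ((tofrac (r * int_char (cpl_in Cb (mon Bb ab.2))), ab.1) :: F).
by rewrite big_cons /= -IH env_aff_lin scalerDl kscaleZ mon2_vec kscaleA tofracM.
Qed.

(** The integral form of the Verma module: the orbit of the highest weight
    vector under the completion over R. The sets int_ops and ints are the
    integral operators and scalars. *)
Definition verma_lattice : set Mh := [set z | exists c : C, z = af_in Ugh c *: v].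
Definition int_ops : set Ugh := range (af_in Ugh).
Definition ints : set K := range (@tofrac R).
Local Notation w := (tofrac pi : K).

Lemma frac_unifX k : w ^+ k = tofrac (pi ^+ k). Proof. by rewrite tofracXn. Qed.

Lemma ints1 : ints 1. Proof. by exists 1; rewrite ?tofrac1. Qed.
Lemma intsB a a' : ints a -> ints a' -> ints (a - a').
Proof. by move=> [r _ <-] [r' _ <-]; exists (r - r'); rewrite ?tofracB. Qed.
Lemma intsM a a' : ints a -> ints a' -> ints (a * a').
Proof. by move=> [r _ <-] [r' _ <-]; exists (r * r'); rewrite ?tofracM. Qed.
Lemma ints_unif : ints w. Proof. by exists pi. Qed.
Lemma ints_val c : ints c -> (exists2 d, ints d & c = w * d) \/ (c != 0 /\ ints c^-1).
Proof.
move=> [r _ <-]; have [rU|[r' ->]] := dvr_unit_or hR r.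
  right; split; first by rewrite tofrac_eq0; apply: contraTneq rU => ->; rewrite unitr0.
  exists r^-1 => //; apply: (mulfI (_ : tofrac r != 0)).
    by rewrite tofrac_eq0; apply: contraTneq rU => ->; rewrite unitr0.
  rewrite divff -?tofracM ?divrr ?tofrac1 // tofrac_eq0.
  by apply: contraTneq rU => ->; rewrite unitr0.
by left; exists (tofrac r'); [exists r' | rewrite tofracM].
Qed.
Lemma ints_absorb c : exists k, ints (w ^+ k * c).
Proof. by have [k [r rE]] := frac_denom hR c; exists k; rewrite rE; exists r. Qed.
Lemma ints_sep c : (forall k, exists2 d, ints d & c = w ^+ k * d) -> c = 0.
Proof.
move=> h; have [_ [r _ <-]] := h 0%N; rewrite expr0 mul1r => cE.
rewrite cE (dvr_sep hR (x := r)) ?tofrac0 // => k.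
have [_ [r' _ <-]] := h k; rewrite cE frac_unifX -tofracM => /eqP.
by rewrite tofrac_eq => /eqP ->; exists r'.
Qed.
Lemma fracK_char0 n : (0 < n)%N -> n%:R != 0 :> K.
Proof. by move=> n0; rewrite -(rmorph_nat (@tofrac R)) tofrac_eq0 dvr_natr_neq0. Qed.

Lemma int_ops1 : int_ops 1. Proof. by exists 1; rewrite ?rmorph1. Qed.
Lemma int_opsB a a' : int_ops a -> int_ops a' -> int_ops (a - a').
Proof. by move=> [r _ <-] [r' _ <-]; exists (r - r'); rewrite ?rmorphB. Qed.
Lemma int_opsZ c a : ints c -> int_ops a -> int_ops (c *: a).
Proof. by move=> [r _ <-] [a' _ <-]; exists (r *: a'); rewrite ?af_in_lin. Qed.
Lemma int_ops_absorb u : exists k, int_ops (w ^+ k *: u).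
Proof. by have [k [c cE]] := algFrac_frac hR u; exists k; rewrite cE; exists c. Qed.
Lemma int_ops_series (a : nat -> Ugh) : (forall k, int_ops (a k)) -> exists u, forall k,
  exists2 a', int_ops a' & u = \sum_(i < k) w ^+ i *: a i + w ^+ k *: a'.
Proof.
move=> Aa; have /choice[c cE] k : exists c, af_in Ugh c = a k.
  by have [c _ <-] := Aa k; exists c.
have [z hz] := cpl_complete c; exists (af_in Ugh z) => k.
have [z' ->] := hz k; exists (af_in Ugh z'); first by exists z'.
rewrite rmorphD rmorph_sum af_in_lin frac_unifX; congr (_ + _).
by apply: eq_bigr => i _; rewrite af_in_lin frac_unifX cE.
Qed.

Lemma verma_latticeD u u' : verma_lattice u -> verma_lattice u' -> verma_lattice (u + u').
Proof. by move=> [c ->] [c' ->]; exists (c + c'); rewrite rmorphD scalerDl. Qed.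
Lemma int_ops_lattice a u : int_ops a -> verma_lattice u -> verma_lattice (a *: u).
Proof. by move=> [c _ <-] [c' ->]; exists (c * c'); rewrite rmorphM scalerA. Qed.
Lemma verma_lattice_absorb u : exists k, verma_lattice (w ^+ k ** u).
Proof.
have [z ->] := ind_gen u; have [k [c cE]] := algFrac_frac hR z.
by exists k; exists c; rewrite -cE; apply: esym (kscaleZ _ _ _).
Qed.
Lemma verma_lattice_basis a : verma_lattice (verma_basis a).
Proof. by exists (cpl_in C (mon Y a)). Qed.
Lemma verma_coord_int a u : verma_lattice u -> ints (verma_coord a u).
Proof. by move=> [c ->]; rewrite verma_coordE aff_coordE; exists (cpl_coord a c). Qed.
Lemma verma_lattice_dense u k : verma_lattice u -> exists (F : seq (K * E)) u',
  verma_lattice u' /\ u = \sum_(q <- F) q.1 ** verma_basis q.2 + w ^+ k ** u'.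
Proof.
move=> [c ->]; have [a [c' ->]] := cpl_dense c k; have [F FE] := env_aff_span a.
exists F, (af_in Ugh c' *: v); split; first by exists c'.
rewrite rmorphD scalerDl -[af_in _ (cpl_in _ _)]/(env_aff a) FE.
by rewrite af_in_lin kscaleZ frac_unifX.
Qed.

(** Modulo the left ideal generated by the elements b i - chi (b i), which
    annihilates the highest weight vector, the factor from the Borel subalgebra
    of an ordered monomial can be evaluated letter by letter from the right. *)
Lemma left_ideal_form (u : U) : exists (n : U) (q : 'I_t -> U),
  lspan (range (mon Y)) n /\
  u = n + \sum_i q i * (B i - (int_char (cpl_in Cb (Bb i)))%:A).
Proof.
pose S (u : U) := exists (n : U) (q : 'I_t -> U), lspan (range (mon Y)) n /\
  u = n + \sum_i q i * (B i - (int_char (cpl_in Cb (Bb i)))%:A).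
have hL := lspan_submod (range (mon Y)).
have SP r u1 u2 : S u1 -> S u2 -> S (r *: u1 + u2).
  move=> [n1 [q1 [hn1 ->]]] [n2 [q2 [hn2 ->]]].
  exists (r *: n1 + n2), (fun i => r *: q1 i + q2 i); split.
    by case: hL => _; apply.
  rewrite scalerDr scaler_sumr addrACA -big_split; congr (_ + _).
  by apply: eq_bigr => i _ /=; rewrite mulrDl scalerAl.
have key a w : S (mon Y a * wprod B w).
  elim/last_ind: w => [|w i IH].
    exists (mon Y a), (fun=> 0); split; first by apply: lspan_gen; exists a.
    by rewrite wprod_nil mulr1 big1 ?addr0 // => i _; rewrite mul0r.
  rewrite -cats1 wprod_cat wprod_cons wprod_nil mulr1 mulrA.
  set z := _ * wprod _ _; set l := int_char (cpl_in Cb (Bb i)).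
  have -> : z * B i = l *: z + z * (B i - l%:A).
    by rewrite mulrBr -scalerAr mulr1 addrC subrK.
  apply: (SP) IH _; exists 0, (fun k => z *+ (k == i)); split; first by case: hL.
  rewrite add0r (bigD1 i) //= eqxx big1 ?addr0 // => k /negPf ->.
  by rewrite mulr0n mul0r.
have S0 : S 0.
  exists 0, (fun=> 0); split; first by case: hL.
  by rewrite add0r big1 // => i _; rewrite mul0r.
elim: (pbw_span x_span u) => [//|r _ u' [ab _ <-] _ IH].
by apply: (SP) => //; apply: key.
Qed.

Lemma verma_coord_scale a c u : verma_coord a (c ** u) = c * verma_coord a u.
Proof.
have Phi0 : verma_coord a 0 = 0 by rewrite -(scale0r v) verma_coordE raddf0.
by have := verma_coord_lin a c u 0; rewrite !addr0 Phi0 addr0.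
Qed.

(** The coordinates of u vanish since they are divisible by all the powers of
    pi, so it has to be seen that the coordinates separate points. Expand an
    operator c representing u as a pi-adic series and reduce its terms modulo
    the left ideal annihilating the highest weight vector. This left ideal is
    finitely generated, so the sum of the multipliers of each generator
    converges, and c can be replaced by a series nu of combinations of
    monomials in y. The coordinates of nu are its actual coefficients, hence nu
    is 0. *)
Lemma verma_lattice_sep u :
  (forall k, exists2 u', verma_lattice u' & u = w ^+ k ** u') -> u = 0.
Proof.
move=> hu; have [u0 [c ->]] := hu 0%N; rewrite expr0 kscale1 => uE.
have Phi0 a : verma_coord a u = 0.
  apply: ints_sep => k; have [u' Lu' ->] := hu k.
  by exists (verma_coord a u'); [apply: verma_coord_int | rewrite verma_coord_scale].
have [a ha] := cpl_expand c.
have /choice[n /choice[q hnq]] i := left_ideal_form (a i).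
have [nu hnu] := cpl_complete (fun i => cpl_in C (n i)).
have /choice[qh hqh] i := cpl_complete (fun k => cpl_in C (q k i)).
pose be i := cpl_in C (B i - (int_char (cpl_in Cb (Bb i)))%:A).
(* The multipliers of the generator b i - chi (b i) add up to qh i. *)
have cE : c = nu + \sum_i qh i * be i.
  apply/eqP; rewrite -subr_eq0; apply/eqP/cpl_separated => k.
  have [z1 ->] := ha k; have [z2 ->] := hnu k.
  have /choice[z3 z3E] i : exists z,
      qh i = \sum_(l < k) pi ^+ l *: cpl_in C (q l i) + pi ^+ k *: z.
    exact: hqh.
  exists (z1 - (z2 + \sum_i z3 i * be i)).
  have -> : \sum_(l < k) pi ^+ l *: cpl_in C (a l) =
      \sum_(l < k) pi ^+ l *: cpl_in C (n l) +
      \sum_i (\sum_(l < k) pi ^+ l *: cpl_in C (q l i)) * be i.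
    under [X in _ + X]eq_bigr do rewrite mulr_suml.
    rewrite exchange_big -big_split; apply: eq_bigr => l _ /=.
    have [_ ->] := hnq l; rewrite rmorphD rmorph_sum scalerDr scaler_sumr /=.
    by congr (_ + _); apply: eq_bigr => i _; rewrite rmorphM scalerAl.
  have -> : \sum_i qh i * be i = \sum_i (\sum_(l < k) pi ^+ l *: cpl_in C (q l i)) * be i
      + pi ^+ k *: \sum_i z3 i * be i.
    rewrite scaler_sumr -big_split; apply: eq_bigr => i _ /=.
    by rewrite {1}z3E mulrDl scalerAl.
  by rewrite addrACA opprD addrACA subrr add0r -scalerDr -scalerBr.
have bev i : af_in Ugh (be i) *: v = 0.
  have := char_vec [:: i]; rewrite !wprod_cons !wprod_nil !mulr1 => bi.
  rewrite /be rmorphB rmorphB scalerBl -[af_in _ (cpl_in _ (B i))]/(env_aff _) bi.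
  have -> (r : R) : af_in Ugh (cpl_in C r%:A) = (tofrac r)%:A.
    by rewrite linearZ /= rmorph1 af_in_lin rmorph1.
  exact: subrr.
have uE' : u = af_in Ugh nu *: v.
  rewrite uE cE rmorphD scalerDl rmorph_sum scaler_suml big1 ?addr0 // => i _.
  by rewrite rmorphM -scalerA bev scaler0.
(* It remains to see that nu vanishes; up to a multiple of pi^k it is a finite
   sum whose coefficients d a are, as the coordinates of nu vanish, divisible by
   pi^k. *)
suff nu0 : nu = 0 by rewrite uE' nu0 rmorph0 scale0r.
have phi_nu b' : (cpl_coord b' nu : R) = 0.
  have := Phi0 b'; rewrite uE' verma_coordE aff_coordE => /eqP.
  by rewrite tofrac_eq0 => /eqP.
apply: cpl_separated => k; have [z nuE] := hnu k.
have hN : lspan (range (mon Y)) (\sum_(l < k) pi ^+ l *: n l).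
  apply: (submod_sum (lspan_submod _)) => l _; apply: (submodZ (lspan_submod _)).
  by have [] := hnq l.
have [F [d [uF d0 _ NE]]] := lspan_expand hN.
have nuE' : nu = cpl_in C (\sum_(l < k) pi ^+ l *: n l) + pi ^+ k *: z.
  rewrite nuE raddf_sum; congr (_ + _); apply: eq_bigr => l _ /=.
  by rewrite linearZ.
have dE a' : a' \in F -> d a' = - (pi ^+ k * cpl_coord a' z).
  move=> aF; apply/eqP; rewrite -addr_eq0; apply/eqP; rewrite -[RHS](phi_nu a') nuE' NE.
  have pD u1 u2 :
      (cpl_coord a' (u1 + u2) : R) = (cpl_coord a' u1 : R) + cpl_coord a' u2.
    by rewrite raddfD.
  have pZ r u1 : (cpl_coord a' (r *: u1) : R) = r * cpl_coord a' u1 by rewrite linearZ.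
  rewrite pD pZ; congr (_ + _).
  rewrite !raddf_sum /= (bigD1_seq a') //= big1 => [|b' ba].
    by rewrite addr0 linearZ pZ cpl_coord_mon eqxx mulr1.
  by rewrite linearZ pZ cpl_coord_mon (negPf ba) mulr0.
exists (z - \sum_(a' <- F) cpl_in C ((cpl_coord a' z : R) *: mon Y a')).
rewrite nuE' NE scalerBr addrC; congr (_ + _).
rewrite scaler_sumr -sumrN raddf_sum big_seq [RHS]big_seq.
apply: eq_bigr => a' aF /=; rewrite !linearZ dE //= scaleNr.
by rewrite !scalerN scalerA.
Qed.
(** The correction terms from sorting have total degree less than that of b',
    also after the letters b have been evaluated on the highest weight
    vector. *)
Lemma mon_basis g a b' : (mdeg g + mdeg a <= mdeg b')%N ->
  verma_coord b' (env_aff (mon Y g) *: verma_basis a) = (b' == madd g a)%:R.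
Proof.
move=> le; rewrite /verma_basis scalerA -rmorphM -rmorphM -/(env_aff _) verma_coord_env.
rewrite -[mon Y g * mon Y a](subrK (mon Y (madd g a))).
rewrite raddfD raddfD /= -(rmorph_nat (@tofrac R)); congr (tofrac _).
rewrite cpl_coord_mon eq_sym [X in X + _](_ : _ = 0) ?add0r //.
apply: (linear_lspan0 (f := fun u => cpl_coord b' (cpl_in C u)) _ _
  (monM_straighten U x_span g a)).
  by move=> r u u'; rewrite linearP linearP.
move=> _ [[a' be] /= lt <-]; rewrite cpl_coordE /=.
case: eqP => [E|_]; last by rewrite mul0r.
by move: lt; rewrite E ltnNge (leq_trans le) ?leq_addr.
Qed.

Local Notation HU := (env_in U (tr_bp_in D H)).
Definition char_H := int_char (cpl_in Cb (env_in Ub H)).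
(** The eigenvalue of H on the highest weight vector, minus H: it measures the
    drop below the highest weight. *)
Definition deg_vec : Ugh := (tofrac char_H : K)%:A - env_aff HU.

Lemma H_word (l : seq 'I_s) :
  HU * wprod Y l = wprod Y l * HU - (\sum_(i <- l) ht i)%:R *: wprod Y l.
Proof.
elim: l => [|i l IH].
  by rewrite big_nil wprod_nil mulr1 mul1r scale0r subr0.
have HYi : HU * Y i = Y i * HU - (ht i)%:R *: Y i.
  have := env_lie U (tr_bp_in D H) (y i).
  rewrite Hy linearZ /= scaleNr => /eqP.
  by rewrite eq_sym subr_eq addrC => /eqP.
rewrite big_cons wprod_cons mulrA HYi mulrBl -[_ * HU * _]mulrA IH mulrBr.
rewrite !mulrA natrD scalerDl opprD addrA -scalerAr -scalerAl.
by rewrite addrAC.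
Qed.

Lemma deg_vec_basis a : deg_vec *: verma_basis a = (wdeg ht a)%:R ** verma_basis a.
Proof.
have Hv : env_aff HU *: v = (tofrac char_H : K) ** v.
  by rewrite /char_H -int_charE -ind_char aem_mapP aem_cplP.
pose m := mon Y a; pose d : R := (wdeg ht a)%:R.
have HY : HU * m = (- d) *: m + m * HU.
  by rewrite H_word sum_mword addrC scaleNr.
have mH : env_aff (m * HU) *: v = (tofrac char_H : K) ** (env_aff m *: v).
  by rewrite /env_aff !rmorphM -scalerA -/(env_aff HU) Hv kscaleC.
have HE : env_aff HU *: verma_basis a =
    (tofrac (- d) : K) ** verma_basis a + (tofrac char_H : K) ** verma_basis a.
  rewrite {1}/verma_basis scalerA -rmorphM -rmorphM HY -/(env_aff _) env_aff_lin scalerDl mH.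
  by rewrite kscaleZ.
rewrite /deg_vec scalerBl HE opprD addrC addrNK rmorphN scaleNr scaleNr opprK.
by rewrite rmorph_nat.
Qed.
End Verma.

(** * Comparison with the classical Verma module *)

Section Classical.
Variables (R : idomainType) (pi : R).
Variables (G : hopfAlg R) (D : triangular G) (lam : {linear tr_h D -> R^o}).
Variables (Ug : classEnv (tr_g D)) (Ugh : affEnv pi (tr_g D)).
Variables (M : classVerma lam Ug) (Mh : affVerma lam Ugh).
Variables (theta : {lrmorphism Ug -> Ugh}) (can : {additive M -> Mh}).
Hypothesis hcan : is_canonical_map theta can.
Variables (s t : nat) (y : 'I_s -> tr_g D) (b : 'I_t -> tr_bp D).
Local Notation x := (both y (fun i => tr_bp_in D (b i))).
Hypothesis x_span : forall z, exists c : 'I_s + 'I_t -> R, z = \sum_i c i *: x i.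
Local Notation K := {fraction R}.
Local Notation E := {ffun 'I_s -> nat}.
Local Notation v0 := (ivec (cv_mod M)).
Local Notation w := (tofrac pi : K).

Definition classical_basis (a : E) : M := mon (fun i => ce_in Ug (y i)) a *: v0.

Lemma theta_word (l : seq (tr_g D)) :
  theta (wprod (ce_in Ug) l) = env_aff (wprod (env_in (ae_env Ugh)) l).
Proof.
rewrite /env_aff !rmorph_wprod; apply: eq_bigr => i _ /=.
by case: hcan.
Qed.

Lemma can_scale u m : can (u *: m) = theta u *: can m.
Proof.
case: hcan => _ hc; have [u' ->] := ind_gen m.
have canv z : can (z *: v0) = im_tens (av_mod Mh) (theta z) (1 : K).
  by rewrite -[z *: v0]im_scale mulr1 hc.
by rewrite scalerA !canv rmorphM im_scale.
Qed.

Lemma can_classical_basis a : can (classical_basis a) = verma_basis Mh y a.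
Proof.
rewrite /classical_basis can_scale; congr (_ *: _); last first.
  by case: hcan => _ hc; rewrite hc rmorph1.
rewrite /mon -[X in theta X](wprod_map (ce_in Ug) y) theta_word.
by rewrite wprod_map.
Qed.

Lemma frac_span (z : ce_lie Ug) : exists c : 'I_s + 'I_t -> K,
  z = \sum_i c i *: both (fun i => lf_in (ce_lie Ug) (y i))
    (fun i => lf_in (ce_lie Ug) (tr_bp_in D (b i))) i.
Proof.
set f := both _ _.
apply: (lieFrac_ind (S := [set z | exists c : 'I_s + 'I_t -> K, z = \sum_i c i *: f i])) z.
  split; first by exists (fun=> 0); rewrite big1 // => i _; rewrite scale0r.
  move=> r _ _ [c ->] [d ->]; exists (fun i => r * c i + d i).
  rewrite scaler_sumr -big_split; apply: eq_bigr => i _ /=.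
  by rewrite scalerDl scalerA.
move=> z; have [c ->] := x_span z; exists (fun i => tofrac (c i)).
rewrite raddf_sum; apply: eq_bigr => i _ /=.
by rewrite lf_in_lin; case: i.
Qed.

Lemma b_word_vec (l : seq 'I_t) : exists c : K,
  wprod (fun i => ce_in Ug (tr_bp_in D (b i))) l *: v0 = c ** v0.
Proof.
exists (cv_chi M (wprod (fun i => ce_in (cv_Eb M) (b i)) l)).
rewrite -ind_char rmorph_wprod; congr (_ *: _).
by apply: eq_bigr => i _ /=; rewrite cem_mapP.
Qed.

Lemma classical_basis_span (m : M) :
  exists F : seq (K * E), m = \sum_(q <- F) q.1 ** classical_basis q.2.
Proof.
have [u ->] := ind_gen m.
elim: (pbw_span frac_span u) => [|r _ u' [ab _ <-] _ [F IH]].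
  by exists [::]; rewrite big_nil scale0r.
have [c bc] := b_word_vec (mword ab.2).
exists ((r * c, ab.1) :: F); rewrite big_cons scalerDl -IH; congr (_ + _).
by rewrite kscaleZ /mon2 -scalerA bc kscaleC kscaleA.
Qed.

(** The enveloping algebra over R is dense in its completion and is contained
    in the image of theta. *)
Lemma int_ops_theta (a : Ugh) k : int_ops a -> exists t0, exists2 a', int_ops a' &
  a = theta t0 + w ^+ k *: a'.
Proof.
move=> [c _ <-]; have [u [c' ->]] := cpl_dense c k.
have [t0 t0E] : exists t0, theta t0 = env_aff u.
  apply: (env_ind (S := [set u | exists t0, theta t0 = env_aff u])) u.
    split.
    - by exists 1; rewrite /env_aff !rmorph1.
    - move=> r u u' [q qE] [q' qE']; exists (tofrac r *: q + q').
      by rewrite env_aff_lin -qE -qE' raddfD /= linearZ.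
    - move=> u u' [q qE] [q' qE']; exists (q * q').
      have -> : env_aff (u * u') = env_aff u * env_aff u' by rewrite /env_aff !rmorphM.
      by rewrite -qE -qE' rmorphM.
  by move=> z; exists (ce_in Ug z); case: hcan.
exists t0, (af_in Ugh c'); first by exists c'.
by rewrite rmorphD t0E af_in_lin frac_unifX.
Qed.
End Classical.

Theorem theorem1p5 (R : idomainType) (p : nat) (pi : R)
  (hR : complete_dvr_mixed p pi)
  (G : hopfAlg R) (hG : semisimple_group G)
  (D : triangular G) (hsc : simply_connected D)
  (lam : {linear tr_h D -> R^o})
  (Ug : classEnv (tr_g D)) (Ugh : affEnv pi (tr_g D))
  (M : classVerma lam Ug) (Mh : affVerma lam Ugh)
  (theta : {lrmorphism Ug -> Ugh}) (can : {additive M -> Mh})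
  (hcan : is_canonical_map theta can) :
  (exists Phi : set Mh -> set M,
    [/\ set_bij (submodules (M:=Mh)) (submodules (M:=M)) Phi,
        forall N, submodules N -> Phi N = can @^-1` N
      & forall N N', submodules N -> submodules N' ->
          (N `<=` N' <-> Phi N `<=` Phi N')]) /\
  has_unique_simple_quotient Mh.
Proof.
have [[ft _] _] := hG.
have [H [s [y [ht [t [b [ht0 Hy b_span x_span x_free]]]]]]] := triangular_basis hR D ft.
have {}b_span z : exists c : 'I_t -> R, z = \sum_i c i *: b i by apply: b_span.
have theta_deg :
    theta ((tofrac (char_H hR Mh H))%:A - ce_in Ug (tr_bp_in D H)) = deg_vec hR Mh H.
  have tA c : theta c%:A = c%:A by rewrite linearZ rmorph1.
  rewrite raddfB /= tA /deg_vec; congr (_ - _).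
  by case: hcan.
have gen0 u : exists z, u = z *: verma_basis Mh y (mzero s).
  have [z ->] := ind_gen u; exists z.
  by rewrite /verma_basis /mon mword0 wprod_nil /env_aff !rmorph1 scale1r.
apply: (@lattice_module_submodules _ (@ints R) (tofrac pi) _ _ _ _ _ _ _ _ _
    _ _ (@int_ops _ _ _ _ Ugh) (@verma_lattice _ _ _ _ _ _ Mh) _ _ _ _ _ _ _ _ _
    s (verma_basis Mh y) (verma_coord hR b_span x_span x_free) _ _ _ _ _
    (fun g => env_aff (mon (fun i => env_in _ (y i)) g)) _ _
    ht (deg_vec hR Mh H) ht0 (deg_vec_basis hR Mh Hy) gen0
    _ _ theta can (classical_basis M y) _ (can_scale hcan) _ _ theta_deg _).
- exact: ints1.
- exact: intsB.
- exact: intsM.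
- exact: (unifK_neq0 hR).
- exact: ints_unif.
- exact: (ints_val hR).
- exact: (ints_absorb hR).
- exact: (ints_sep hR).
- exact: (fracK_char0 hR).
- exact: int_ops1.
- exact: int_opsB.
- exact: int_opsZ.
- exact: (int_ops_absorb hR).
- exact: int_ops_series.
- exact: verma_latticeD.
- exact: int_ops_lattice.
- exact: (verma_lattice_absorb hR).
- exact: (verma_lattice_sep hR b_span x_span x_free).
- exact: verma_lattice_basis.
- exact: (verma_coord_lin hR b_span x_span x_free).
- exact: (verma_coord_int hR b_span x_span x_free).
- by move=> a a'; apply: verma_coord_basis.
- exact: (verma_lattice_dense hR x_span).
- by move=> g; exists (cpl_in _ (mon (fun i => env_in _ (y i)) g)).
- by move=> g a b' le; apply: mon_basis.
- exact: (can_classical_basis hcan).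
- by move=> m; apply: (classical_basis_span x_span).
- by move=> a k; apply: (int_ops_theta hcan).
Qed.
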